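(* Let $\mathfrak{S}\subseteq\mathbb{R}^2$ be a simple cone, i.e. $\mathfrak{S}=\{a r_1+b r_2: a,b\geq 0\}$ for two linearly independent vectors $r_1,r_2\in\mathbb{R}^2$ (so that $\mathfrak{S}$ is bounded by two distinct rays making an acute, right or obtuse angle). Let $\mathcal{A}_{\mathfrak{S}}$ be the weak$^*$-closed linear span in $B(L^2(\mathbb{R}))$ of the unitaries $M_\lambda D_\mu$ with $(\lambda,\mu)\in\mathfrak{S}$. Then $\mathcal{A}_{\mathfrak{S}}$ is unitarily equivalent to the parabolic algebra $\mathcal{A}_p$, i.e. there is a unitary $W$ on $L^2(\mathbb{R})$ with $W\mathcal{A}_{\mathfrak{S}}W^*=\mathcal{A}_p$.
   Context: On $L^2(\mathbb{R})$, for real $\lambda,\mu$, let $(M_\lambda f)(x)=e^{i\lambda x}f(x)$ and $(D_\mu f)(x)=f(x-\mu)$. The parabolic algebra $\mathcal{A}_p$ is the weak operator topology closed algebra on $L^2(\mathbb{R})$ generated by $\{M_\lambda:\lambda\geq 0\}$ and $\{D_\mu:\mu\geq0\}$; it equals $\mathcal{A}_{\mathfrak{S}}$ for $\mathfrak{S}=\mathbb{R}_+^2$. *)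

(* Defs.v *)
From mathcomp Require Import all_boot all_algebra all_classical all_reals all_analysis.
From mathcomp Require Export complex.
Set Implicit Arguments. Unset Strict Implicit. Unset Printing Implicit Defensive.
Import GRing.Theory Num.Theory numFieldNormedType.Exports.
Local Open Scope ring_scope.
Local Open Scope classical_set_scope.

Section Defs.
Variable R : realType.
Local Notation C := R[i].
Local Notation leb := (@lebesgue_measure R).

Definition cfun := R -> C.
Definition op := cfun -> cfun.

Definition sqmod (z : C) : R := (complex.Re z) ^+ 2 + (complex.Im z) ^+ 2.

Definition L2fun (f : cfun) : Prop :=
  measurable_fun setT (fun t => complex.Re (f t)) /\
  measurable_fun setT (fun t => complex.Im (f t)) /\
  leb.-integrable setT (fun t => (sqmod (f t))%:E).

Definition ae_eq (f g : cfun) : Prop := {ae leb, forall t, f t = g t}.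

Definition nsq (f : cfun) : R := Rintegral leb setT (fun t => sqmod (f t)).
Definition ip (f g : cfun) : C :=
  Complex (Rintegral leb setT (fun t => complex.Re (f t * conjc (g t))))
          (Rintegral leb setT (fun t => complex.Im (f t * conjc (g t)))).

Definition rsum (v : R^nat) : R := limn (series v).
Definition csum (u : nat -> C) : C :=
  Complex (rsum (fun n => complex.Re (u n))) (rsum (fun n => complex.Im (u n))).

Definition op_eq (T S : op) : Prop := forall f, L2fun f -> ae_eq (T f) (S f).

Definition bounded_op (T : op) : Prop :=
  (forall f, L2fun f -> L2fun (T f)) /\
  (forall f g, L2fun f -> L2fun g -> ae_eq f g -> ae_eq (T f) (T g)) /\
  (forall (a : C) f g, L2fun f -> L2fun g ->
     ae_eq (T (fun t => a * f t + g t)) (fun t => a * T f t + T g t)) /\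
  (exists c : R, forall f, L2fun f -> nsq (T f) <= c * nsq f).

(* unitary W with inverse (= adjoint) W' *)
Definition unitary (W W' : op) : Prop :=
  bounded_op W /\ bounded_op W' /\
  op_eq (W \o W') id /\ op_eq (W' \o W) id /\
  (forall f g, L2fun f -> L2fun g -> ip (W f) (W g) = ip f g).

Definition op_add (T S : op) : op := fun f t => T f t + S f t.
Definition op_scale (a : C) (T : op) : op := fun f t => a * T f t.
Definition op_sub (T S : op) : op := fun f t => T f t - S f t.
Definition op_zero : op := fun f t => 0.

Definition op_subspace (V : set op) : Prop :=
  V `<=` bounded_op /\ V op_zero /\
  (forall T S, V T -> V S -> V (op_add T S)) /\
  (forall a T, V T -> V (op_scale a T)).
Definition op_subalgebra (V : set op) : Prop :=
  op_subspace V /\ (forall T S, V T -> V S -> V (T \o S)).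

Definition wot_closure (V : set op) (T : op) : Prop :=
  bounded_op T /\
  forall (k : nat) (x y : 'I_k -> cfun),
    (forall i, L2fun (x i)) -> (forall i, L2fun (y i)) ->
    forall eps : R, 0 < eps ->
    exists2 X, V X &
      forall i, sqmod (ip (op_sub T X (x i)) (y i)) < eps ^+ 2.
Definition wot_closed (V : set op) : Prop := wot_closure V `<=` V.

(* a normal (sigma-weakly continuous) functional
   S |-> sum_n <S x_n, y_n>,  with sum_n ||x_n||^2 < oo and sum_n ||y_n||^2 < oo *)
Definition normal_data (x y : nat -> cfun) : Prop :=
  (forall n, L2fun (x n)) /\ (forall n, L2fun (y n)) /\
  cvgn (series (fun n => nsq (x n))) /\ cvgn (series (fun n => nsq (y n))).
Definition omega (x y : nat -> cfun) (S : op) : C := csum (fun n => ip (S (x n)) (y n)).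

(* weak* (= sigma-weak) topology closure: basic neighbourhoods are given by finitely
   many normal functionals *)
Definition wstar_closure (V : set op) (T : op) : Prop :=
  bounded_op T /\
  forall (k : nat) (x y : 'I_k -> nat -> cfun),
    (forall i, normal_data (x i) (y i)) ->
    forall eps : R, 0 < eps ->
    exists2 X, V X &
      forall i, sqmod (omega (x i) (y i) (op_sub T X)) < eps ^+ 2.
Definition wstar_closed (V : set op) : Prop := wstar_closure V `<=` V.

Definition expi (th : R) : C := Complex (cos th) (sin th).

Definition Mop (lam : R) : op := fun f x => expi (lam * x) * f x.
Definition Dop (mu : R) : op := fun f x => f (x - mu).

(* the simple cone spanned by r1, r2 (assumed linearly independent separately) *)
Definition cone (r1 r2 : R * R) : set (R * R) :=
  [set p | exists a b : R, 0 <= a /\ 0 <= b /\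
     p = (a * r1.1 + b * r2.1, a * r1.2 + b * r2.2)].

Definition A_S (S : set (R * R)) : set op :=
  \bigcap_(V in [set V | op_subspace V /\ wstar_closed V /\
                     (forall p, S p -> V (Mop p.1 \o Dop p.2))]) V.

Definition A_p : set op :=
  \bigcap_(V in [set V | op_subalgebra V /\ wot_closed V /\
                     (forall lam, 0 <= lam -> V (Mop lam)) /\
                     (forall mu, 0 <= mu -> V (Dop mu))]) V.

End Defs.

(* Main.v *)
(* The metaplectic unitaries (chirp multiplications and the Fourier transform) implement SL(2,R) on the
   pairs (l, m): up to nonzero scalars they permute the operators M_l D_m.  After rescaling r1, some
   element of SL(2,R) maps the cone onto the quadrant, so the only real point is that the weak-star
   closed span V of the M_l D_m with l, m >= 0 contains the whole WOT-closed algebra A_p.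

   Every T in A_p is causal (it does not move supports to the left), and so is its Fourier conjugate
   S = F T F^-1, since these two conditions define a WOT-closed algebra containing the generators.
   Conversely a bicausal T lies in V.  Regularising T with the approximate units psi, psi', kap, kap',
   phi2 turns it into an integral operator whose kernel is phi(x) t(x, y) phi(y), that is, the weak
   integral over u of multiplication by phi(x) t(x, x - u) phi(x - u) followed by D_u.  Causality of T
   kills u < 0; and x |-> t(x, x - u) = <M_x S M_-x a, b> is, by causality of S, a limit of
   combinations of integrals of M_l with l >= 0 (Loebl and Muhly).

   Plancherel comes from Gram matrices: with e_b the Fourier integral of the signed indicator ind b
   of [0, b), translation and scaling give |e_b - e_a|^2 = const |b - a|, which by polarization
   determines all <e_a, e_b> since these are real. *)

Require Import Defs.
From mathcomp Require Import all_boot all_order all_algebra all_classical all_reals all_analysis.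
From mathcomp Require Import measurable_realfun ring lra.
Import Order.TTheory GRing.Theory Num.Theory numFieldNormedType.Exports.
Set Implicit Arguments. Unset Strict Implicit. Unset Printing Implicit Defensive.
Local Open Scope ring_scope.
Local Open Scope classical_set_scope.

(** * Integrals of real functions *)

Section RealIntegral.
Variable R : realType.
Local Notation leb := (@lebesgue_measure R).

Implicit Types (f g : R -> R) (a : R).

(** The weak-star closed span [V] is only a linear space, so its members may not be multiplied:
    everything put into [V] is reached from the [M_l D_m] by linear combinations, bounded weak
    limits and weak integrals. This shapes the regularisation. Convolution with [psi] and [psi']
    turns [T] into a bounded measurable kernel [t]; the cutoff [phi2] supplies the decay in [x] and
    [x - u] that makes the integral over [u] converge absolutely. The cutoff stays inside the
    symbols, so it must itself be a superposition of [M_s] with [s >= 0]. The Fourier integral of an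
    indicator of [[0, d[] is one, but it decays only like [1 / |x|], hence the square. Since [psi]
    and [psi'] live on opposite sides of 0, causality kills the kernel for every [u < 0], not merely
    for [u < - d]. The opposite inclusion is soft, because a WOT-closed algebra is weak-star closed.
    Operators act on functions rather than on classes modulo null sets, so identities hold up to
    [op_eq]; weak-star closed subspaces are stable under [op_eq] between bounded operators. *)

Definition L1 (f : R -> R) := leb.-integrable setT (EFin \o f).
Definition rint (f : R -> R) := Rintegral leb setT f.

Lemma ae_filter : Filter (almost_everywhere leb).
Proof. exact: (ae_filter_ringOfSetsType leb). Qed.

Lemma aeS (P Q : R -> Prop) : (forall x, P x -> Q x) -> {ae leb, forall x, P x} ->
  {ae leb, forall x, Q x}.
Proof. by move=> PQ; apply: (@filterS _ _ ae_filter _ _ PQ). Qed.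

Lemma aeI (P Q : R -> Prop) : {ae leb, forall x, P x} -> {ae leb, forall x, Q x} ->
  {ae leb, forall x, P x /\ Q x}.
Proof. by move=> p q; apply: (@filterI _ _ ae_filter _ _ p q). Qed.

Lemma L1_meas f : L1 f -> measurable_fun setT f.
Proof. by move=> /integrableP[/measurable_EFinP]. Qed.

Lemma le_L1 f g : measurable_fun setT f -> (forall x, `|f x| <= g x) -> L1 g -> L1 f.
Proof.
move=> mf fg Lg; apply: (le_integrable _ _ _ Lg) => //; first exact/measurable_EFinP.
by move=> x _ /=; rewrite lee_fin (le_trans (fg x))// ler_norm.
Qed.

Lemma L1D f g : L1 f -> L1 g -> L1 (fun x => f x + g x).
Proof. by move=> Lf Lg; apply: eq_integrable (integrableD _ Lf Lg). Qed.

Lemma L1Z a f : L1 f -> L1 (fun x => a * f x).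
Proof. by move=> Lf; apply: eq_integrable (integrableZl _ a Lf). Qed.

Lemma L1N f : L1 f -> L1 (fun x => - f x).
Proof. by move=> /(L1Z (-1)); apply: eq_integrable => // x _ /=; rewrite mulN1r. Qed.

Lemma L1_norm f : L1 f -> L1 (fun x => `|f x|).
Proof. by move=> Lf; apply: integrable_norm. Qed.

Lemma L10 : L1 (fun=> 0). Proof. exact: integrable0. Qed.

Lemma rintD f g : L1 f -> L1 g -> rint (fun x => f x + g x) = rint f + rint g.
Proof. by move=> Lf Lg; rewrite /rint RintegralD. Qed.

Lemma rintZ a f : L1 f -> rint (fun x => a * f x) = a * rint f.
Proof. by move=> Lf; rewrite /rint RintegralZl. Qed.

Lemma rintN f : L1 f -> rint (fun x => - f x) = - rint f.
Proof.
by move=> Lf; rewrite -mulN1r -rintZ//; congr rint; apply/funext => x; rewrite mulN1r.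
Qed.

Lemma rint0 : rint (fun=> 0) = 0.
Proof. by rewrite /rint /Rintegral integral0. Qed.

Lemma le_rint f g : L1 f -> L1 g -> (forall x, f x <= g x) -> rint f <= rint g.
Proof. by move=> Lf Lg fg; apply: le_Rintegral. Qed.

Lemma rint_ge0 f : (forall x, 0 <= f x) -> 0 <= rint f.
Proof. by move=> f0; apply: Rintegral_ge0. Qed.

Lemma rint_ae f g : {ae leb, forall x, f x = g x} -> L1 f -> measurable_fun setT g ->
  L1 g /\ rint f = rint g.
Proof.
move=> fg Lf mg.
have fg' : ae_eq leb setT (EFin \o f) (EFin \o g).
  by apply: aeS fg => x fgx _ /=; rewrite fgx.
have mfE := measurable_int _ Lf.
have mgE : measurable_fun setT (EFin \o g) by exact/measurable_EFinP.
split.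
  apply/integrableP; split => //; case/integrableP: Lf => _; congr (_ < _)%E.
  apply: ae_eq_integral => //; [exact: measurableT_comp|exact: measurableT_comp|].
  by apply: aeS fg => x /= fgx _; rewrite fgx.
by rewrite /rint /Rintegral; congr fine; apply: ae_eq_integral.
Qed.

Lemma rint_dct (f_ : nat -> R -> R) f g :
  (forall n, measurable_fun setT (f_ n)) -> L1 g ->
  (forall n x, `|f_ n x| <= g x) -> (forall x, f_ n x @[n --> \oo] --> f x) ->
  L1 f /\ rint (f_ n) @[n --> \oo] --> rint f.
Proof.
move=> mf Lg fg fcvg.
have mflim : measurable_fun setT f.
  by apply: (measurable_fun_cvg mf) => x _; exact: fcvg.
have [||||h1 _ h2] := @dominated_convergence _ _ _ leb setT measurableT
    (fun n => EFin \o f_ n) (EFin \o f) (EFin \o g) _ _ _ Lg _.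
- by move=> n; have /measurable_EFinP := mf n.
- by have /measurable_EFinP := mflim.
- apply: aeW => x _ /=; apply: cvg_EFin; last exact: fcvg.
  by apply: nearW.
- by apply: aeW => x n _ /=; rewrite lee_fin.
split=> //; move: h2; rewrite /rint /Rintegral.
have fin h : L1 h -> (\int[leb]_x (h x)%:E \is a fin_num)%E by exact: integrable_fin_num.
by move=> h2; apply: fine_cvg; rewrite fineK; [exact: h2|exact: fin].
Qed.

End RealIntegral.

(** * Fubini's theorem for real-valued integrands *)

Section Fubini.
Variable R : realType.
Local Notation leb := (@lebesgue_measure R).
Implicit Types (h : R * R -> R) (G : R -> R).

(** An integrable function is finite almost everywhere, so the value 0 that [fine] substitutes for
    infinities is seen only on a null set. *)
Lemma L1_fine (g : R -> \bar R) : leb.-integrable setT g ->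
  L1 (fine \o g) /\ rint (fine \o g) = fine (\int[leb]_x g x)%E.
Proof.
move=> ig; have mg := measurable_int _ ig.
have mfg : measurable_fun setT (EFin \o (fine \o g)).
  apply: measurableT_comp => //; apply: measurableT_comp => //.
split.
  apply: (le_integrable _ _ _ ig) => //.
  by move=> x _ /=; case: (g x) => //= [|]; rewrite normr0 leey.
rewrite /rint /Rintegral; congr fine; apply: ae_eq_integral => //.
have := integrable_ae measurableT ig; apply: aeS => x /(_ I) gx _ /=.
by rewrite fineK.
Qed.

(** The bound by [G] is Tonelli's condition in one order. In the other order a null set of [y] may
    have non-integrable slices; [rint] then returns the default value 0. *)
Lemma rint_fubini h G : measurable_fun setT h -> L1 G ->
  (forall x, L1 (fun y => h (x, y))) ->
  (forall x, rint (fun y => `|h (x, y)|) <= G x) ->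
  [/\ L1 (fun x => rint (fun y => h (x, y))),
      L1 (fun y => rint (fun x => h (x, y)))
    & rint (fun x => rint (fun y => h (x, y))) =
      rint (fun y => rint (fun x => h (x, y)))].
Proof.
move=> mh LG Lh hG.
have mhE : measurable_fun setT (EFin \o h) by apply/measurable_EFinP.
have LG0 := LG.
have ih : (leb \x leb)%E.-integrable setT (EFin \o h).
  apply/integrable12ltyP => //.
  case/integrableP: LG => _; apply: le_lt_trans.
  apply: ge0_le_integral => //=.
  - by move=> x _; apply: integral_ge0.
  - suff : measurable_fun setT (fubini_F leb (fun z => `|(h z)%:E|%E)) by [].
    apply: measurable_fun_fubini_tonelli_F => //.
    exact: measurableT_comp.
  - by have /L1_norm/L1_meas/measurable_EFinP := LG0.
  move=> x _.
  have := hG x; rewrite /rint /Rintegral => hx.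
  have /L1_norm/integrable_fin_num -/(_ measurableT) fx := Lh x.
  rewrite -(fineK fx) lee_fin; exact: le_trans hx (ler_norm _).
have [LF rF] := L1_fine (integrable_fubini_F ih).
have iG : (leb \x leb)%E.-integrable setT (EFin \o (fun z : R * R => h (z.2, z.1))).
  apply/integrable12ltyP; last by move/integrable21ltyP : ih; apply.
  by apply: measurableT_comp mhE _; exact: measurable_fun_pair.
have [LG1 rG] := L1_fine (integrable_fubini_F iG).
by split; [exact: LF|exact: LG1|rewrite [LHS]rF [RHS]rG (Fubini ih)].
Qed.
End Fubini.

(** * Affine changes of variable *)

Section Affine.
Variables (R : realType) (r a : R).
Hypothesis r0 : r != 0.
Local Notation leb := (@lebesgue_measure R).
Let phi (x : R) := r * x + a.

Let mphi : measurable_fun setT phi.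
Proof. by apply: measurable_funD => //; exact: measurable_funM. Qed.

Let nu : {measure set (measurableTypeR R) -> \bar R} :=
  @measure_function_pushforward__canonical__measure_function_Measure
    _ _ (measurableTypeR R) (measurableTypeR R) R
    (mscale (NngNum (normr_ge0 r)) leb) phi mphi.

(** Lebesgue measure is determined by its values on half-open intervals. For [r < 0] the preimage is
    closed at the other end, which leaves its length unchanged. *)
Let lebE (A : set R) : measurable A -> leb A = nu A.
Proof.
move=> mA; apply: (lebesgue_measure_unique _ mA) => X [[x y] /= xy <-].
rewrite /= /pushforward/= /mscale/=.
have [rp|rn] := ltP 0 r.
  have -> : phi @^-1` `]x, y]%classic = `](x - a) / r, (y - a) / r]%classic.
    apply/seteqP; split => z /=; rewrite !in_itv/= /phi;
    by rewrite ltr_pdivrMr// ler_pdivlMr// ltrBlDr lerBrDr mulrC.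
  rewrite !lebesgue_measure_itv/= !lte_fin ltr_pM2r ?invr_gt0// ltrD2r.
  case: ifP => _; last by rewrite mule0.
  rewrite -EFinD -EFinM; congr EFin; rewrite gtr0_norm//; by field.
have rn' : r < 0 by rewrite lt_neqAle r0.
have -> : phi @^-1` `]x, y]%classic = `[(y - a) / r, (x - a) / r[%classic.
  apply/seteqP; split => z /=; rewrite !in_itv/= /phi;
  by rewrite ltr_ndivlMr// ler_ndivrMr// ltrBlDr lerBrDr mulrC andbC.
rewrite !lebesgue_measure_itv/= !lte_fin ltr_nM2r ?invr_lt0// ltrD2r.
case: ifP => _; last by rewrite mule0.
rewrite -EFinD -EFinM; congr EFin; rewrite ltr0_norm//; by field.
Qed.

Let ge0_int (h : R -> \bar R) : measurable_fun setT h -> (forall x, 0 <= h x)%E ->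
  (\int[leb]_x h x = `|r|%:E * \int[leb]_x h (phi x))%E.
Proof.
move=> mh h0; rewrite (eq_measure_integral nu); last by move=> A mA _; exact: lebE.
rewrite ge0_integral_pushforward//.
rewrite preimage_setT ge0_integral_mscale; [by []|by []| |by move=> x _; exact: h0].
by apply: measurableT_comp mh _; exact: mphi.
Qed.

Let L1_ge0 (g : R -> R) : L1 g -> (forall x, 0 <= g x) ->
  L1 (g \o phi) /\ rint (g \o phi) = `|r|^-1 * rint g.
Proof.
move=> Lg g0; have mg := L1_meas Lg.
have mgE : measurable_fun setT (EFin \o g) by exact/measurable_EFinP.
have rp : 0 < `|r| by rewrite normr_gt0.
have E : (\int[leb]_x (g x)%:E = `|r|%:E * \int[leb]_x (g (phi x))%:E)%E.
  by rewrite (ge0_int mgE)// => x /=; rewrite lee_fin.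
have L : L1 (g \o phi).
  apply/integrableP; split; first by apply/measurable_EFinP; exact: measurableT_comp mg mphi.
  have := integrable_lty measurableT Lg; rewrite E.
  under [in X in _ -> X]eq_integral do rewrite /= ger0_norm//.
  case: (integral _ _ _) => [s _||]; rewrite ?ltry//.
  by rewrite gt0_muley.
split => //.
rewrite /rint /Rintegral E fineM//; last exact: (integrable_fin_num measurableT L).
by rewrite /= mulrA mulVf ?mul1r// gt_eqF.
Qed.

Lemma rint_affine (f : R -> R) : L1 f ->
  L1 (fun x => f (r * x + a)) /\ rint (fun x => f (r * x + a)) = `|r|^-1 * rint f.
Proof.
move=> Lf.
(* Twice the positive and twice the negative part of [f]; the case of nonnegative functions applies
   to each. *)
pose p (x : R) : R := `|f x| + f x; pose q (x : R) : R := `|f x| - f x.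
have Lp : L1 p by apply: L1D => //; exact: L1_norm.
have Lq : L1 q by apply: L1D; [exact: L1_norm|exact: L1N].
have [Lp1 ip] : L1 (p \o phi) /\ rint (p \o phi) = `|r|^-1 * rint p.
  by apply: L1_ge0 => // x; have := ler_norm (- f x); rewrite normrN /p; lra.
have [Lq1 iq] : L1 (q \o phi) /\ rint (q \o phi) = `|r|^-1 * rint q.
  by apply: L1_ge0 => // x; rewrite subr_ge0 ler_norm.
have fE : f = fun x => 2^-1 * (p x + - q x) by apply/funext => x; rewrite /p /q; lra.
have fpE : (fun x => f (r * x + a)) = fun x => 2^-1 * ((p \o phi) x + - (q \o phi) x).
  by apply/funext => x; rewrite {1}fE.
rewrite fpE; split; first by apply/L1Z/L1D => //; exact: L1N.
rewrite rintZ; last by apply: L1D => //; exact: L1N.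
rewrite rintD// ?rintN//; last exact: L1N.
rewrite ip iq [in RHS]fE rintZ; last by apply: L1D => //; exact: L1N.
by rewrite rintD// ?rintN//; [ring|exact: L1N].
Qed.
End Affine.

Section Shift.
Variable R : realType.
Implicit Types f : R -> R.

Lemma rint_shift (a : R) f : L1 f ->
  L1 (fun x => f (x + a)) /\ rint (fun x => f (x + a)) = rint f.
Proof.
move=> /(@rint_affine R 1 a (oner_neq0 R)).
by under eq_fun do rewrite mul1r; rewrite normr1 invr1 mul1r.
Qed.

Lemma rint_refl (a : R) f : L1 f ->
  L1 (fun x => f (a - x)) /\ rint (fun x => f (a - x)) = rint f.
Proof.
have N1 : (-1 : R) != 0 by rewrite oppr_eq0 oner_neq0.
move=> /(@rint_affine R (-1) a N1).
by under eq_fun do rewrite mulN1r addrC; rewrite normrN1 invr1 mul1r.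
Qed.
End Shift.

(** * Complex valued functions *)

Section Modulus.
Variable R : realType.
Local Notation C := R[i].
Implicit Types z w : C.

Definition nc z : R := Num.sqrt (sqmod z).

Lemma sqmod_ge0 z : 0 <= sqmod z.
Proof. by rewrite addr_ge0 ?sqr_ge0. Qed.

Lemma sqr_nc z : nc z ^+ 2 = sqmod z.
Proof. by rewrite sqr_sqrtr ?sqmod_ge0. Qed.

Lemma ncE z : nc z = Normc.normc z. Proof. by case: z. Qed.

Lemma nc_ge0 z : 0 <= nc z. Proof. exact: sqrtr_ge0. Qed.

Lemma ncM z w : nc (z * w) = nc z * nc w. Proof. by rewrite !ncE Normc.normcM. Qed.

Lemma ncD z w : nc (z + w) <= nc z + nc w. Proof. by rewrite !ncE le_normcD. Qed.

Lemma ncN z : nc (- z) = nc z. Proof. by rewrite !ncE normcN. Qed.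

Lemma ncB z w : nc (z - w) <= nc z + nc w.
Proof. by rewrite -[nc w]ncN ncD. Qed.

Lemma nc_distC z w : nc (z - w) = nc (w - z).
Proof. by rewrite -ncN opprB. Qed.

Lemma ncJ z : nc (conjc z) = nc z.
Proof. by case: z => a b; rewrite /nc /sqmod /= sqrrN. Qed.

Lemma nc0 : nc (0 : C) = 0. Proof. by rewrite ncE Normc.normc0. Qed.
Lemma nc1 : nc (1 : C) = 1. Proof. by rewrite ncE Normc.normc1. Qed.

Lemma nc_eq0 z : nc z = 0 -> z = 0. Proof. by rewrite ncE => /Normc.eq0_normc. Qed.

Lemma nc_real (a : R) : nc (real_complex R a) = `|a|.
Proof. by rewrite /nc /sqmod /= expr0n addr0 sqrtr_sqr. Qed.

Lemma Re_nc z : `|complex.Re z| <= nc z.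
Proof. by rewrite -sqrtr_sqr ler_wsqrtr// lerDl sqr_ge0. Qed.

Lemma Im_nc z : `|complex.Im z| <= nc z.
Proof. by rewrite -sqrtr_sqr ler_wsqrtr// lerDr sqr_ge0. Qed.

Lemma nc_ReIm z : nc z <= `|complex.Re z| + `|complex.Im z|.
Proof.
rewrite -(@ler_pXn2r _ 2) ?nnegrE ?addr_ge0 ?nc_ge0// sqr_nc sqrrD !real_normK ?num_real//.
by rewrite addrAC lerDl mulrn_wge0// mulr_ge0.
Qed.

Lemma mulJ z : z * conjc z = real_complex R (sqmod z).
Proof. by case: z => a b; apply/eqP; rewrite eq_complex /sqmod/=; apply/andP; split; apply/eqP; ring. Qed.

Lemma sqmodM z w : sqmod (z * w) = sqmod z * sqmod w.
Proof. by rewrite -!sqr_nc ncM exprMn. Qed.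

Lemma sqmodD z w : sqmod (z + w) <= 2 * sqmod z + 2 * sqmod w.
Proof.
case: z w => [a b] [c d]; rewrite /sqmod /=.
have := sqr_ge0 (a - c); have := sqr_ge0 (b - d); nra.
Qed.

Lemma cReD z w : complex.Re (z + w) = complex.Re z + complex.Re w. Proof. by case: z w => [? ?] []. Qed.
Lemma cImD z w : complex.Im (z + w) = complex.Im z + complex.Im w. Proof. by case: z w => [? ?] []. Qed.
Lemma cReM z w : complex.Re (z * w) = complex.Re z * complex.Re w - complex.Im z * complex.Im w.
Proof. by case: z w => [? ?] []. Qed.
Lemma cImM z w : complex.Im (z * w) = complex.Re z * complex.Im w + complex.Im z * complex.Re w.
Proof. by case: z w => [? ?] []. Qed.
Lemma cReN z : complex.Re (- z) = - complex.Re z. Proof. by case: z. Qed.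
Lemma cImN z : complex.Im (- z) = - complex.Im z. Proof. by case: z. Qed.
Lemma cReJ z : complex.Re (conjc z) = complex.Re z. Proof. by case: z. Qed.
Lemma cImJ z : complex.Im (conjc z) = - complex.Im z. Proof. by case: z. Qed.

Lemma conjM z w : conjc (z * w) = conjc z * conjc w. Proof. exact: rmorphM. Qed.
Lemma conjD z w : conjc (z + w) = conjc z + conjc w. Proof. exact: rmorphD. Qed.
Lemma conjB z w : conjc (z - w) = conjc z - conjc w. Proof. exact: rmorphB. Qed.

Lemma complex_eq z w : complex.Re z = complex.Re w -> complex.Im z = complex.Im w -> z = w.
Proof. by case: z w => [? ?] [? ?] /= -> ->. Qed.

Lemma expiD (a b : R) : expi (a + b) = expi a * expi b.
Proof. by apply: complex_eq; rewrite /= ?cosD ?sinD// addrC. Qed.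

Lemma expi0 : expi 0 = 1 :> C.
Proof. by rewrite /expi cos0 sin0. Qed.

Lemma expiJ (a : R) : conjc (expi a) = expi (- a).
Proof. by rewrite /expi /= cosN sinN. Qed.

Lemma nc_expi (a : R) : nc (expi a) = 1.
Proof. by rewrite /nc /sqmod /= cos2Dsin2 sqrtr1. Qed.

Lemma expi_neq0 (a : R) : expi a != 0.
Proof. by apply/eqP => h; have := nc_expi a; rewrite h nc0 => /eqP; rewrite eq_sym oner_eq0. Qed.

End Modulus.

Section ComplexMeasurable.
Variable R : realType.
Local Notation C := R[i].
Variables (d : measure_display) (T : measurableType d).
Implicit Types f g : T -> C.

Definition cmeas f := measurable_fun setT (fun x => complex.Re (f x)) /\
  measurable_fun setT (fun x => complex.Im (f x)).

Lemma cmeas_cst z : cmeas (fun=> z). Proof. by split. Qed.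

Lemma cmeasD f g : cmeas f -> cmeas g -> cmeas (fun x => f x + g x).
Proof.
move=> [a b] [c e]; split.
  by under eq_fun do rewrite cReD; exact: measurable_funD.
by under eq_fun do rewrite cImD; exact: measurable_funD.
Qed.

Lemma cmeasM f g : cmeas f -> cmeas g -> cmeas (fun x => f x * g x).
Proof.
move=> [a b] [c e]; split.
  by under eq_fun do rewrite cReM; apply: measurable_funB; exact: measurable_funM.
by under eq_fun do rewrite cImM; apply: measurable_funD; exact: measurable_funM.
Qed.

Lemma cmeasJ f : cmeas f -> cmeas (fun x => conjc (f x)).
Proof.
move=> [a b]; split; first by under eq_fun do rewrite cReJ.
by under eq_fun do rewrite cImJ; exact: measurable_funN.
Qed.

Lemma cmeasZ z f : cmeas f -> cmeas (fun x => z * f x).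
Proof. by apply: cmeasM; exact: cmeas_cst. Qed.

Lemma cmeasN f : cmeas f -> cmeas (fun x => - f x).
Proof. by move=> /(cmeasZ (-1)); under eq_fun do rewrite mulN1r. Qed.

Lemma cmeasB f g : cmeas f -> cmeas g -> cmeas (fun x => f x - g x).
Proof. by move=> mf mg; apply: cmeasD => //; exact: cmeasN. Qed.

Lemma cmeas_real (f : T -> R) : measurable_fun setT f -> cmeas (fun x => real_complex R (f x)).
Proof. by split. Qed.

Lemma cmeas_expi (f : T -> R) : measurable_fun setT f -> cmeas (fun x => expi (f x)).
Proof.
move=> mf; split => /=.
  by apply: measurableT_comp mf => //; apply: continuous_measurable_fun; exact: continuous_cos.
by apply: measurableT_comp mf => //; apply: continuous_measurable_fun; exact: continuous_sin.
Qed.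

Lemma meas_sqmod f : cmeas f -> measurable_fun setT (fun x => sqmod (f x)).
Proof. by move=> [a b]; apply: measurable_funD; exact: measurable_funX. Qed.

Lemma meas_nc f : cmeas f -> measurable_fun setT (fun x => nc (f x)).
Proof.
move=> /meas_sqmod; apply: measurableT_comp => //.
by apply: continuous_measurable_fun; exact: sqrt_continuous.
Qed.

Lemma cmeas_sum (I : Type) (s : seq I) (F : I -> T -> C) :
  (forall i, cmeas (F i)) -> cmeas (fun x => \sum_(i <- s) F i x).
Proof.
move=> mF; elim: s => [|i s IHs].
  by under eq_fun do rewrite big_nil; exact: cmeas_cst.
by under eq_fun do rewrite big_cons; exact: cmeasD.
Qed.

End ComplexMeasurable.

Lemma cmeas_comp (R : realType) d1 d2 (T1 : measurableType d1) (T2 : measurableType d2)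
  (phi : T1 -> T2) (f : T2 -> R[i]) :
  measurable_fun setT phi -> cmeas f -> cmeas (fun x => f (phi x)).
Proof. by move=> mp [a b]; split; [exact: measurableT_comp a mp|exact: measurableT_comp b mp]. Qed.

Section PlaneMeasurability.
Variable R : realType.
Implicit Types (f : R -> R[i]) (h : R * R -> R[i]).

Lemma cmeas_fst f : cmeas f -> cmeas (fun z : R * R => f z.1).
Proof. by apply: cmeas_comp; exact: measurable_fst. Qed.

Lemma cmeas_snd f : cmeas f -> cmeas (fun z : R * R => f z.2).
Proof. by apply: cmeas_comp; exact: measurable_snd. Qed.

Lemma cmeas_slice1 h x : cmeas h -> cmeas (fun y => h (x, y)).
Proof. by apply: cmeas_comp; exact: measurable_fun_pair. Qed.

Lemma cmeas_slice2 h y : cmeas h -> cmeas (fun x => h (x, y)).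
Proof. by apply: cmeas_comp; exact: measurable_fun_pair. Qed.

End PlaneMeasurability.

Section ComplexIntegral.
Variable R : realType.
Local Notation C := R[i].
Local Notation leb := (@lebesgue_measure R).
Implicit Types f g : R -> C.

Definition C1 f := L1 (fun x => complex.Re (f x)) /\ L1 (fun x => complex.Im (f x)).
Definition cint f : C := Complex (rint (fun x => complex.Re (f x))) (rint (fun x => complex.Im (f x))).

Lemma C1_meas f : C1 f -> cmeas f.
Proof. by move=> [/L1_meas a /L1_meas b]. Qed.

Lemma le_C1 f (g : R -> R) : cmeas f -> L1 g -> (forall x, nc (f x) <= g x) -> C1 f.
Proof.
move=> [mr mi] Lg fg; split.
  by apply: le_L1 Lg => // x; apply: le_trans (fg x); exact: Re_nc.
by apply: le_L1 Lg => // x; apply: le_trans (fg x); exact: Im_nc.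
Qed.

Lemma C1_nc f : C1 f -> L1 (fun x => nc (f x)).
Proof.
move=> Cf; have [Lr Li] := Cf; apply: (le_L1 _ _ (L1D (L1_norm Lr) (L1_norm Li))).
  by apply: meas_nc; exact: C1_meas.
by move=> x; rewrite ger0_norm ?nc_ge0//; exact: nc_ReIm.
Qed.

Lemma C1D f g : C1 f -> C1 g -> C1 (fun x => f x + g x).
Proof.
move=> [a b] [c e]; split.
  by under eq_fun do rewrite cReD; exact: L1D.
by under eq_fun do rewrite cImD; exact: L1D.
Qed.

Lemma C1Z z f : C1 f -> C1 (fun x => z * f x).
Proof.
move=> [a b]; split.
  by under eq_fun do rewrite cReM; apply: L1D; [exact: L1Z|apply: L1N; exact: L1Z].
by under eq_fun do rewrite cImM; apply: L1D; exact: L1Z.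
Qed.

Lemma C10 : C1 (fun=> 0). Proof. by split; exact: L10. Qed.

Lemma C1N f : C1 f -> C1 (fun x => - f x).
Proof. by move=> /(C1Z (-1)); under eq_fun do rewrite mulN1r. Qed.

Lemma C1B f g : C1 f -> C1 g -> C1 (fun x => f x - g x).
Proof. by move=> mf mg; apply: C1D => //; exact: C1N. Qed.

Lemma C1J f : C1 f -> C1 (fun x => conjc (f x)).
Proof.
move=> [a b]; split; first by under eq_fun do rewrite cReJ.
by under eq_fun do rewrite cImJ; exact: L1N.
Qed.

Lemma cintD f g : C1 f -> C1 g -> cint (fun x => f x + g x) = cint f + cint g.
Proof.
move=> [a b] [c e]; apply: complex_eq => /=.
  by under eq_fun do rewrite cReD; rewrite rintD.
by under eq_fun do rewrite cImD; rewrite rintD.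
Qed.

Lemma cintZ z f : C1 f -> cint (fun x => z * f x) = z * cint f.
Proof.
move=> [a b]; apply: complex_eq; rewrite [LHS]/= ?cReM ?cImM /=.
  under eq_fun do rewrite cReM.
  by rewrite rintD ?rintN ?rintZ//; [exact: L1Z|exact: L1Z|apply: L1N; exact: L1Z].
under eq_fun do rewrite cImM.
by rewrite rintD ?rintZ//; exact: L1Z.
Qed.

Lemma cintN f : C1 f -> cint (fun x => - f x) = - cint f.
Proof. by move=> Cf; rewrite -mulN1r -cintZ//; congr cint; apply/funext => x; rewrite mulN1r. Qed.

Lemma cintB f g : C1 f -> C1 g -> cint (fun x => f x - g x) = cint f - cint g.
Proof. by move=> Cf Cg; rewrite cintD ?cintN//; exact: C1N. Qed.

Lemma cint0 : cint (fun=> 0) = 0.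
Proof. by apply: complex_eq; rewrite /= rint0. Qed.

Lemma cintJ f : C1 f -> cint (fun x => conjc (f x)) = conjc (cint f).
Proof.
move=> [a b]; apply: complex_eq => /=.
  by under eq_fun do rewrite cReJ.
by under eq_fun do rewrite cImJ; rewrite rintN.
Qed.

Lemma C1_sum (I : Type) (s : seq I) (F : I -> R -> C) :
  (forall i, C1 (F i)) -> C1 (fun x => \sum_(i <- s) F i x).
Proof.
move=> mF; elim: s => [|i s IHs].
  by under eq_fun do rewrite big_nil; exact: C10.
by under eq_fun do rewrite big_cons; exact: C1D.
Qed.

Lemma cint_sum (I : Type) (s : seq I) (F : I -> R -> C) :
  (forall i, C1 (F i)) -> cint (fun x => \sum_(i <- s) F i x) = \sum_(i <- s) cint (F i).
Proof.
move=> mF; elim: s => [|i s IHs].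
  by under eq_fun do rewrite big_nil; rewrite big_nil cint0.
under eq_fun do rewrite big_cons; rewrite big_cons cintD ?IHs//.
exact: C1_sum.
Qed.

Lemma cint_ae f g : Defs.ae_eq f g -> C1 f -> cmeas g -> C1 g /\ cint f = cint g.
Proof.
move=> fg [Lr Li] [mr mi].
have [] := @rint_ae R (fun x => complex.Re (f x)) (fun x => complex.Re (g x)) _ Lr mr.
  by apply: aeS fg => x ->.
have [] := @rint_ae R (fun x => complex.Im (f x)) (fun x => complex.Im (g x)) _ Li mi.
  by apply: aeS fg => x ->.
by move=> ? e ? e'; split; [split|rewrite /cint e e'].
Qed.

(* Rotating by the conjugate phase turns the integral into the integral of a real part. *)
Lemma nc_cint f : C1 f -> nc (cint f) <= rint (fun x => nc (f x)).
Proof.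
move=> Cf; have [/eqP h|h] := eqVneq (nc (cint f)) 0.
  by rewrite (eqP h); apply: rint_ge0 => x; exact: nc_ge0.
set I := cint f; have Ln := C1_nc Cf.
have CJ := C1Z (conjc I) Cf.
have : nc I * nc I <= nc I * rint (fun x => nc (f x)).
  have -> : nc I * nc I = complex.Re (cint (fun x => conjc I * f x)).
    by rewrite cintZ// -/I [conjc I * I]mulrC mulJ /= -expr2 sqr_nc.
  rewrite -rintZ//; apply: le_rint.
  - by case: CJ.
  - exact: L1Z.
  move=> x; apply: le_trans (ler_norm _) _; apply: le_trans (Re_nc _) _.
  by rewrite ncM -(ncJ I).
by rewrite ler_pM2l// lt_neqAle eq_sym h nc_ge0.
Qed.

Lemma cint_le f (g : R -> R) : cmeas f -> L1 g -> (forall x, nc (f x) <= g x) ->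
  nc (cint f) <= rint g.
Proof.
move=> mf Lg fg; have Cf := le_C1 mf Lg fg.
by apply: le_trans (nc_cint Cf) _; apply: le_rint => //; exact: C1_nc.
Qed.

(** Complex convergence is expressed through the real-valued modulus, so every estimate is a squeeze
    between real sequences. *)
Definition ccvg (u : nat -> C) l := nc (u n - l) @[n --> \oo] --> 0.

Lemma cvg0_le (a b : nat -> R) : (forall n, 0 <= a n) -> (forall n, a n <= b n) ->
  b n @[n --> \oo] --> 0 -> a n @[n --> \oo] --> 0.
Proof.
move=> a0 ab hb; apply: (@squeeze_cvgr _ _ _ _ (fun=> 0) b) => //.
  by apply: nearW => n; rewrite a0 ab.
exact: cvg_cst.
Qed.

Lemma cvg0D (a b : nat -> R) : a n @[n --> \oo] --> 0 -> b n @[n --> \oo] --> 0 ->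
  (a n + b n) @[n --> \oo] --> 0.
Proof. by move=> ha hb; rewrite -[X in _ --> X]addr0; exact: cvgD. Qed.

Lemma cvg0Z k (a : nat -> R) : a n @[n --> \oo] --> 0 -> (k * a n) @[n --> \oo] --> 0.
Proof. by move=> ha; rewrite -[X in _ --> X](mulr0 k); apply: cvgM => //; exact: cvg_cst. Qed.

Lemma cvg_dist0 (a : nat -> R) l : a n @[n --> \oo] --> l -> `|a n - l| @[n --> \oo] --> 0.
Proof.
move=> ha; rewrite -[X in _ --> X](@normr0 _ R); apply: cvg_norm.
by rewrite -(subrr l); apply: cvgB => //; exact: cvg_cst.
Qed.

Lemma dist0_cvg (a : nat -> R) l : `|a n - l| @[n --> \oo] --> 0 -> a n @[n --> \oo] --> l.
Proof.
move=> h; apply/cvgrPdist_lt => e e0.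
move/cvgrPdist_lt : h => /(_ e e0); apply: filterS => n.
by rewrite sub0r normrN normr_id distrC.
Qed.

Lemma ccvgE u l : complex.Re (u n) @[n --> \oo] --> complex.Re l ->
  complex.Im (u n) @[n --> \oo] --> complex.Im l -> ccvg u l.
Proof.
move=> /cvg_dist0 hr /cvg_dist0 hi; apply: cvg0_le (cvg0D hr hi) => n; first exact: nc_ge0.
by apply: le_trans (nc_ReIm _) _; rewrite cReD cImD cReN cImN.
Qed.

Lemma ccvg_Re u l : ccvg u l -> complex.Re (u n) @[n --> \oo] --> complex.Re l.
Proof.
move=> h; apply: dist0_cvg; apply: cvg0_le h => n; first exact: normr_ge0.
by rewrite -cReN -cReD Re_nc.
Qed.

Lemma ccvg_Im u l : ccvg u l -> complex.Im (u n) @[n --> \oo] --> complex.Im l.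
Proof.
move=> h; apply: dist0_cvg; apply: cvg0_le h => n; first exact: normr_ge0.
by rewrite -cImN -cImD Im_nc.
Qed.

Lemma ccvg_unique u l l' : ccvg u l -> ccvg u l' -> l = l'.
Proof.
move=> h h'; apply: complex_eq.
  exact: cvg_unique (ccvg_Re h) (ccvg_Re h').
exact: cvg_unique (ccvg_Im h) (ccvg_Im h').
Qed.

Lemma ccvg_cst l : ccvg (fun=> l) l.
Proof. by rewrite /ccvg; under eq_fun do rewrite subrr nc0; exact: cvg_cst. Qed.

Lemma ccvgD u v l m : ccvg u l -> ccvg v m -> ccvg (fun n => u n + v n) (l + m).
Proof.
move=> hu hv; apply: cvg0_le (cvg0D hu hv) => n; first exact: nc_ge0.
by rewrite opprD addrACA ncD.
Qed.

Lemma ccvgZ z u l : ccvg u l -> ccvg (fun n => z * u n) (z * l).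
Proof.
move=> hu; apply: cvg0_le (cvg0Z (nc z) hu) => n; first exact: nc_ge0.
by rewrite -mulrBr ncM.
Qed.

Lemma ccvg_sum (I : Type) (s : seq I) (F : I -> nat -> C) (l : I -> C) :
  (forall i, ccvg (F i) (l i)) -> ccvg (fun n => \sum_(i <- s) F i n) (\sum_(i <- s) l i).
Proof.
move=> h; elim: s => [|i s IHs].
  by rewrite big_nil; under [X in ccvg X]eq_fun do rewrite big_nil; exact: ccvg_cst.
by rewrite big_cons; under [X in ccvg X]eq_fun do rewrite big_cons; exact: ccvgD.
Qed.

Lemma ccvg_nc_le u l k : ccvg u l -> (forall n, nc (u n) <= k) -> nc l <= k.
Proof.
move=> hu hk; rewrite leNgt; apply/negP => kl.
have d0 : 0 < nc l - k by rewrite subr_gt0.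
move/cvgrPdist_lt : hu => /(_ _ d0) [N _ /(_ N (leqnn N))].
rewrite /= sub0r normrN ger0_norm ?nc_ge0// => h.
have := ncB (u N) (u N - l); rewrite opprB addrC subrK => h2.
have := hk N; lra.
Qed.

Lemma cint_dct (F : nat -> R -> C) f (g : R -> R) :
  (forall n, cmeas (F n)) -> L1 g -> (forall n x, nc (F n x) <= g x) ->
  (forall x, ccvg (F ^~ x) (f x)) -> C1 f /\ ccvg (fun n => cint (F n)) (cint f).
Proof.
move=> mF Lg Fg Fcvg.
have [|||a b] := @rint_dct R (fun n x => complex.Re (F n x)) (fun x => complex.Re (f x)) g _ Lg.
- by move=> n; case: (mF n).
- by move=> n x; apply: le_trans (Re_nc _) _.
- by move=> x; exact: ccvg_Re.
have [|||c d] := @rint_dct R (fun n x => complex.Im (F n x)) (fun x => complex.Im (f x)) g _ Lg.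
- by move=> n; case: (mF n).
- by move=> n x; apply: le_trans (Im_nc _) _.
- by move=> x; exact: ccvg_Im.
by split; [split|exact: ccvgE].
Qed.

Lemma cmeas_cvg d (T : measurableType d) (F : nat -> T -> C) (f : T -> C) :
  (forall n, cmeas (F n)) -> (forall x, ccvg (F ^~ x) (f x)) -> cmeas f.
Proof.
move=> mF Fcvg; split.
  apply: (@measurable_fun_cvg _ _ _ _ (fun n x => complex.Re (F n x))) => [n|x _].
    by case: (mF n).
  exact: ccvg_Re.
apply: (@measurable_fun_cvg _ _ _ _ (fun n x => complex.Im (F n x))) => [n|x _].
  by case: (mF n).
exact: ccvg_Im.
Qed.

Lemma cint_fubini (h : R * R -> C) (G : R -> R) : cmeas h -> L1 G ->
  (forall x, C1 (fun y => h (x, y))) ->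
  (forall x, rint (fun y => nc (h (x, y))) <= G x) ->
  [/\ C1 (fun x => cint (fun y => h (x, y))),
      C1 (fun y => cint (fun x => h (x, y)))
    & cint (fun x => cint (fun y => h (x, y))) =
      cint (fun y => cint (fun x => h (x, y)))].
Proof.
move=> [mr mi] LG Ch hG.
have [||r1 r2 r3] := rint_fubini mr LG.
- by move=> x; case: (Ch x).
- move=> x; apply: le_trans (hG x); apply: le_rint => [||y].
  + by apply: L1_norm; case: (Ch x).
  + exact: C1_nc.
  + exact: Re_nc.
have [||i1 i2 i3] := rint_fubini mi LG.
- by move=> x; case: (Ch x).
- move=> x; apply: le_trans (hG x); apply: le_rint => [||y].
  + by apply: L1_norm; case: (Ch x).
  + exact: C1_nc.
  + exact: Im_nc.
by split; [by split|by split|by apply: complex_eq].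
Qed.

Lemma cint_affine (r a : R) f : r != 0 -> C1 f ->
  C1 (fun x => f (r * x + a)) /\
  cint (fun x => f (r * x + a)) = real_complex R `|r|^-1 * cint f.
Proof.
move=> r0 [Lr Li].
have [a1 a2] := rint_affine a r0 Lr; have [b1 b2] := rint_affine a r0 Li.
split; first by split.
by apply: complex_eq; rewrite [LHS]/= ?a2 ?b2 ?cReM ?cImM/= mul0r ?subr0 ?addr0.
Qed.

Lemma cint_shift (a : R) f : C1 f ->
  C1 (fun x => f (x + a)) /\ cint (fun x => f (x + a)) = cint f.
Proof.
move=> /(@cint_affine 1 a _ (oner_neq0 R)).
by under eq_fun do rewrite mul1r; rewrite normr1 invr1 mul1r.
Qed.

Lemma cint_refl (a : R) f : C1 f ->
  C1 (fun x => f (a - x)) /\ cint (fun x => f (a - x)) = cint f.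
Proof.
have N1 : (-1 : R) != 0 by rewrite oppr_eq0 oner_neq0.
move=> /(@cint_affine (-1) a _ N1).
by under eq_fun do rewrite mulN1r addrC; rewrite normrN1 invr1 mul1r.
Qed.

End ComplexIntegral.

(** * The Hilbert space of square integrable functions *)

Section L2.
Variable R : realType.
Local Notation C := R[i].
Local Notation leb := (@lebesgue_measure R).
Implicit Types (f g h : R -> C) (z : C).

Lemma L2_cmeas f : L2fun f -> cmeas f. Proof. by case=> ? []. Qed.
Lemma L2_L1 f : L2fun f -> L1 (fun x => sqmod (f x)). Proof. by case=> ? []. Qed.
Lemma L2I f : cmeas f -> L1 (fun x => sqmod (f x)) -> L2fun f. Proof. by case. Qed.
Lemma nsqE f : nsq f = rint (fun x => sqmod (f x)). Proof. by []. Qed.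
Lemma ipE f g : ip f g = cint (fun x => f x * conjc (g x)). Proof. by []. Qed.

Lemma nsq_ge0 f : 0 <= nsq f.
Proof. by rewrite nsqE; apply: rint_ge0 => x; exact: sqmod_ge0. Qed.

Lemma le_L2 f (G : R -> R) : cmeas f -> L1 G -> (forall x, sqmod (f x) <= G x) -> L2fun f.
Proof.
move=> mf LG fG; apply: L2I => //; apply: le_L1 LG => //; first exact: meas_sqmod.
by move=> x; rewrite ger0_norm ?sqmod_ge0.
Qed.

Lemma L2D f g : L2fun f -> L2fun g -> L2fun (fun x => f x + g x).
Proof.
move=> Lf Lg; apply: (le_L2 _ (L1D (L1Z 2 (L2_L1 Lf)) (L1Z 2 (L2_L1 Lg)))).
  by apply: cmeasD; exact: L2_cmeas.
by move=> x; exact: sqmodD.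
Qed.

Lemma L2_bounded q k f : cmeas q -> (forall x, nc (q x) <= k) -> L2fun f ->
  L2fun (fun x => q x * f x).
Proof.
move=> mq qk Lf; apply: (le_L2 _ (L1Z (k ^+ 2) (L2_L1 Lf))).
  by apply: cmeasM => //; exact: L2_cmeas.
move=> x; rewrite sqmodM ler_wpM2r ?sqmod_ge0// -sqr_nc ler_pXn2r// nnegrE ?nc_ge0//.
exact: le_trans (nc_ge0 _) (qk x).
Qed.

Lemma L2Z z f : L2fun f -> L2fun (fun x => z * f x).
Proof. by apply: (@L2_bounded _ (nc z)) => //; exact: cmeas_cst. Qed.

Lemma L2N f : L2fun f -> L2fun (fun x => - f x).
Proof. by move=> /(L2Z (-1)); under eq_fun do rewrite mulN1r. Qed.

Lemma L2B f g : L2fun f -> L2fun g -> L2fun (fun x => f x - g x).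
Proof. by move=> Lf Lg; apply: L2D => //; exact: L2N. Qed.

Lemma sqmod0 : sqmod (0 : C) = 0.
Proof. by rewrite /sqmod /= expr0n addr0. Qed.

Lemma L20 : L2fun (fun=> 0 : C).
Proof. by apply: (le_L2 (G := fun=> 0)); [exact: cmeas_cst|exact: L10|move=> x; rewrite sqmod0]. Qed.

Lemma L2_sum (I : Type) (s : seq I) (F : I -> R -> C) :
  (forall i, L2fun (F i)) -> L2fun (fun x => \sum_(i <- s) F i x).
Proof.
move=> mF; elim: s => [|i s IHs].
  by under eq_fun do rewrite big_nil; exact: L20.
by under eq_fun do rewrite big_cons; exact: L2D.
Qed.

Lemma L2J f : L2fun f -> L2fun (fun x => conjc (f x)).
Proof.
move=> Lf; apply: (le_L2 _ (L2_L1 Lf)); first by apply: cmeasJ; exact: L2_cmeas.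
by move=> x; rewrite -!sqr_nc ncJ.
Qed.

Lemma L1_ncM f g : L2fun f -> L2fun g -> L1 (fun x => nc (f x) * nc (g x)).
Proof.
move=> Lf Lg; apply: (le_L1 _ _ (L1D (L2_L1 Lf) (L2_L1 Lg))).
  by apply: measurable_funM; apply: meas_nc; exact: L2_cmeas.
move=> x; rewrite ger0_norm ?mulr_ge0 ?nc_ge0// -!sqr_nc.
have := sqr_ge0 (nc (f x) - nc (g x)); have := mulr_ge0 (nc_ge0 (f x)) (nc_ge0 (g x)); nra.
Qed.

Lemma L2M f g : L2fun f -> L2fun g -> C1 (fun x => f x * conjc (g x)).
Proof.
move=> Lf Lg; apply: (le_C1 _ (L1_ncM Lf Lg)).
  by apply: cmeasM; [|apply: cmeasJ]; exact: L2_cmeas.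
by move=> x; rewrite ncM ncJ.
Qed.

Lemma ipDl f g h : L2fun f -> L2fun g -> L2fun h -> ip (fun x => f x + g x) h = ip f h + ip g h.
Proof.
move=> Lf Lg Lh; rewrite !ipE -cintD; [|exact: L2M..].
by congr cint; apply/funext => x; rewrite mulrDl.
Qed.

Lemma ipZl z f h : L2fun f -> L2fun h -> ip (fun x => z * f x) h = z * ip f h.
Proof.
move=> Lf Lh; rewrite !ipE -cintZ; last exact: L2M.
by congr cint; apply/funext => x; rewrite mulrA.
Qed.

Lemma ipJ f g : L2fun f -> L2fun g -> ip g f = conjc (ip f g).
Proof.
move=> Lf Lg; rewrite !ipE -cintJ; last exact: L2M.
by congr cint; apply/funext => x; rewrite conjM conjcK mulrC.
Qed.

Lemma ipNl f h : L2fun f -> L2fun h -> ip (fun x => - f x) h = - ip f h.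
Proof.
move=> Lf Lh; rewrite -mulN1r -ipZl//; congr (ip _ h).
by apply/funext => x; rewrite mulN1r.
Qed.

Lemma ipBl f g h : L2fun f -> L2fun g -> L2fun h -> ip (fun x => f x - g x) h = ip f h - ip g h.
Proof. by move=> Lf Lg Lh; rewrite ipDl ?ipNl//; exact: L2N. Qed.

Lemma ipDr f g h : L2fun f -> L2fun g -> L2fun h -> ip h (fun x => f x + g x) = ip h f + ip h g.
Proof.
move=> Lf Lg Lh; rewrite (ipJ _ Lh); last exact: L2D.
by rewrite ipDl// conjD -!ipJ.
Qed.

Lemma ipZr z f h : L2fun f -> L2fun h -> ip h (fun x => z * f x) = conjc z * ip h f.
Proof.
by move=> Lf Lh; rewrite (ipJ (L2Z z Lf) Lh) ipZl// conjM -ipJ.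
Qed.

Lemma ipBr f g h : L2fun f -> L2fun g -> L2fun h -> ip h (fun x => f x - g x) = ip h f - ip h g.
Proof.
move=> Lf Lg Lh; rewrite (ipJ _ Lh); last exact: L2B.
by rewrite ipBl// conjB -!ipJ.
Qed.

Lemma ip0l h : ip (fun=> 0) h = 0.
Proof. by rewrite ipE; under eq_fun do rewrite mul0r; exact: cint0. Qed.

Lemma ip0r h : ip h (fun=> 0) = 0.
Proof. by rewrite ipE; under eq_fun do rewrite conjc0 mulr0; exact: cint0. Qed.

Lemma ip_suml (I : Type) (s : seq I) (F : I -> R -> C) h :
  (forall i, L2fun (F i)) -> L2fun h ->
  ip (fun x => \sum_(i <- s) F i x) h = \sum_(i <- s) ip (F i) h.
Proof.
move=> LF Lh; rewrite ipE; under eq_fun do rewrite mulr_suml.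
by rewrite cint_sum// => i; exact: L2M.
Qed.

Lemma ip_self f : ip f f = real_complex R (nsq f).
Proof.
rewrite ipE; apply: complex_eq; rewrite /= -1?[LHS]/(rint _).
  by under eq_fun do rewrite mulJ.
by under eq_fun do rewrite mulJ; exact: rint0.
Qed.

Lemma ip_ae f f' g g' : L2fun f -> L2fun f' -> L2fun g -> L2fun g' ->
  Defs.ae_eq f f' -> Defs.ae_eq g g' -> ip f g = ip f' g'.
Proof.
move=> Lf Lf' Lg Lg' ff gg; rewrite !ipE.
apply: (cint_ae _ _ _).2.
- by apply: aeS (aeI ff gg) => x [-> ->].
- exact: L2M.
- by apply: C1_meas; exact: L2M.
Qed.

Lemma nsq_ae f g : L2fun f -> L2fun g -> Defs.ae_eq f g -> nsq f = nsq g.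
Proof.
move=> Lf Lg fg; have := ip_ae Lf Lg Lf Lg fg fg.
by rewrite !ip_self => -[].
Qed.

Lemma L2_ae f g : L2fun f -> cmeas g -> Defs.ae_eq f g -> L2fun g.
Proof.
move=> Lf mg fg; apply: L2I => //.
apply: (@rint_ae R (fun x => sqmod (f x)) (fun x => sqmod (g x)) _ _ _).1.
- by apply: aeS fg => x ->.
- exact: L2_L1.
- exact: meas_sqmod.
Qed.

Lemma nsq_eq0 f : L2fun f -> nsq f = 0 -> Defs.ae_eq f (fun=> 0).
Proof.
move=> Lf n0.
have L := L2_L1 Lf; have mE : measurable_fun setT (EFin \o (fun x => sqmod (f x))).
  by case/integrableP: L.
have : (\int[leb]_x `|(EFin \o (fun x => sqmod (f x))) x| = 0)%E.
  rewrite -[RHS]/(0%:E) -n0 /nsq /Rintegral fineK; last exact: integrable_fin_num L.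
  by apply: eq_integral => x _ /=; rewrite ger0_norm ?sqmod_ge0.
move=> /(ae_eq_integral_abs leb measurableT mE); apply: aeS => x /(_ I) /= [h]; apply: nc_eq0.
by apply/eqP; rewrite /nc sqrtr_eq0 h.
Qed.

(** A quadratic that is never negative has a nonpositive discriminant; the test point is its vertex
    [i / a]. *)
Lemma quadratic_CS (a b i : R) : 0 <= a -> (forall t, 0 <= t ^+ 2 * a - 2 * t * i + b) ->
  i ^+ 2 <= a * b.
Proof.
move=> a0 h; have [a00|an0] := eqVneq a 0.
  suff -> : i = 0 by rewrite a00 expr0n mul0r.
  apply/eqP/negPn/negP => i0.
  (* At this point the remaining affine function takes the value -1. *)
  have := h ((b + 1) / (2 * i)); rewrite a00 mulr0 add0r.
  have -> : 2 * ((b + 1) / (2 * i)) * i = b + 1 by field.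
  lra.
have ap : 0 < a by rewrite lt_neqAle eq_sym an0.
have := h (i / a).
have -> : (i / a) ^+ 2 * a - 2 * (i / a) * i + b = (a * b - i ^+ 2) / a by field.
by rewrite pmulr_lge0 ?invr_gt0// subr_ge0.
Qed.

Definition l2 f : R := Num.sqrt (nsq f).

Lemma l2_ge0 f : 0 <= l2 f. Proof. exact: sqrtr_ge0. Qed.
Lemma sqr_l2 f : l2 f ^+ 2 = nsq f. Proof. by rewrite sqr_sqrtr ?nsq_ge0. Qed.

(** Cauchy-Schwarz is proved for the moduli, by integrating [(t * |f| - |g|) ^+ 2], because the
    dominating functions in Fubini arguments involve [|f| |g|]; the bound on [ip] follows. *)
Lemma rint_ncM f g : L2fun f -> L2fun g -> rint (fun x => nc (f x) * nc (g x)) <= l2 f * l2 g.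
Proof.
move=> Lf Lg; rewrite -(@ler_pXn2r _ 2) ?nnegrE ?mulr_ge0 ?l2_ge0//; last first.
  by apply: rint_ge0 => x; rewrite mulr_ge0 ?nc_ge0.
rewrite exprMn !sqr_l2; apply: quadratic_CS; first exact: nsq_ge0.
move=> t; rewrite !nsqE -rintZ; last exact: L2_L1.
rewrite -rintZ ?L1_ncM// -rintN; last by apply: L1Z; exact: L1_ncM.
rewrite -rintD; [|by apply: L1Z; exact: L2_L1|by apply/L1N/L1Z; exact: L1_ncM].
rewrite -rintD; last exact: L2_L1; last first.
  by apply: L1D; [apply: L1Z; exact: L2_L1|by apply/L1N/L1Z; exact: L1_ncM].
apply: rint_ge0 => x; rewrite -!sqr_nc.
have := sqr_ge0 (t * nc (f x) - nc (g x)); nra.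
Qed.

Lemma ip_le f g : L2fun f -> L2fun g -> nc (ip f g) <= l2 f * l2 g.
Proof.
move=> Lf Lg; apply: le_trans (rint_ncM Lf Lg).
rewrite ipE; apply: le_trans (nc_cint (L2M Lf Lg)) _.
apply: le_rint => [||x]; [by apply: C1_nc; exact: L2M|exact: L1_ncM|by rewrite ncM ncJ].
Qed.

Lemma nsqD f g : L2fun f -> L2fun g ->
  nsq (fun x => f x + g x) = nsq f + nsq g + 2 * complex.Re (ip f g).
Proof.
move=> Lf Lg; have := ip_self (fun x => f x + g x).
rewrite ipDl// ?ipDr//; last by exact: L2D.
rewrite !ip_self (ipJ Lf Lg) => /(congr1 (@complex.Re R)).
rewrite !cReD cReJ /= => <-; ring.
Qed.

Lemma l2D f g : L2fun f -> L2fun g -> l2 (fun x => f x + g x) <= l2 f + l2 g.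
Proof.
move=> Lf Lg; rewrite -(@ler_pXn2r _ 2) ?nnegrE ?addr_ge0 ?l2_ge0//.
rewrite sqr_l2 nsqD// sqrrD !sqr_l2.
have := ler_norm (complex.Re (ip f g)); have := Re_nc (ip f g); have := ip_le Lf Lg; lra.
Qed.

Lemma nsqZ z f : L2fun f -> nsq (fun x => z * f x) = sqmod z * nsq f.
Proof.
move=> Lf; rewrite !nsqE -rintZ; last exact: L2_L1.
by congr rint; apply/funext => x; rewrite sqmodM.
Qed.

Lemma l2Z z f : L2fun f -> l2 (fun x => z * f x) = nc z * l2 f.
Proof. by move=> Lf; rewrite /l2 nsqZ// sqrtrM ?sqmod_ge0. Qed.

Lemma nsqN f : nsq (fun x => - f x) = nsq f.
Proof. by rewrite !nsqE; congr rint; apply/funext => x; rewrite -!sqr_nc ncN. Qed.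

Lemma nsq0 : nsq (fun=> 0 : C) = 0.
Proof. by rewrite nsqE; under eq_fun do rewrite sqmod0; exact: rint0. Qed.

Lemma l2_0 : l2 (fun=> 0 : C) = 0.
Proof. by rewrite /l2 nsq0 sqrtr0. Qed.

Lemma l2_subrr f : l2 (fun x => f x - f x) = 0.
Proof. by under eq_fun do rewrite subrr; exact: l2_0. Qed.

Lemma l2N f : l2 (fun x => - f x) = l2 f.
Proof. by rewrite /l2 nsqN. Qed.

Lemma nsq_distC f g : nsq (fun x => f x - g x) = nsq (fun x => g x - f x).
Proof. by rewrite -nsqN; congr nsq; apply/funext => x; rewrite opprB. Qed.

Lemma le_nsq f g : L2fun f -> L2fun g -> (forall x, nc (f x) <= nc (g x)) -> nsq f <= nsq g.
Proof.
move=> Lf Lg fg; rewrite !nsqE; apply: le_rint => [||x]; [exact: L2_L1..|].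
by rewrite -!sqr_nc ler_pXn2r ?nnegrE ?nc_ge0.
Qed.

Lemma le_l2 f g : nsq f <= nsq g -> l2 f <= l2 g.
Proof. by move=> ?; rewrite ler_wsqrtr. Qed.

Lemma nsq_cvg0 (F : nat -> R -> C) (G : R -> R) : (forall n, cmeas (F n)) -> L1 G ->
  (forall n x, sqmod (F n x) <= G x) -> (forall x, nc (F n x) @[n --> \oo] --> 0) ->
  l2 (F n) @[n --> \oo] --> 0.
Proof.
move=> mF LG FG F0.
have [|||_] := @rint_dct R (fun n x => sqmod (F n x)) (fun=> 0) G _ LG.
- by move=> n; exact: meas_sqmod.
- by move=> n x; rewrite ger0_norm ?sqmod_ge0.
- move=> x; have h : (nc (F n x) * nc (F n x)) @[n --> \oo] --> 0.
    by rewrite -[X in _ --> X](mulr0 (0 : R)); apply: cvgM; exact: F0.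
  by apply: cvg0_le h => n; [exact: sqmod_ge0|rewrite -sqr_nc expr2].
move=> h; have {}h : nsq (F n) @[n --> \oo] --> 0.
  by rewrite -[X in _ --> X](rint0 R); exact: h.
rewrite -[X in _ --> X](sqrtr0 R).
exact: (cvg_comp _ _ h (@sqrt_continuous R 0)).
Qed.

Lemma cvg0_ip (u v : nat -> R -> C) f g : (forall n, L2fun (u n)) -> (forall n, L2fun (v n)) ->
  L2fun f -> L2fun g -> l2 (fun x => u n x - f x) @[n --> \oo] --> 0 ->
  l2 (fun x => v n x - g x) @[n --> \oo] --> 0 -> ccvg (fun n => ip (u n) (v n)) (ip f g).
Proof.
move=> Lu Lv Lf Lg hu hv.
have hv2 : (l2 g + l2 (fun x => v n x - g x)) @[n --> \oo] --> l2 g + 0.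
  by apply: cvgD => //; exact: cvg_cst.
have h1 : (l2 (fun x => u n x - f x) * (l2 g + l2 (fun x => v n x - g x))) @[n --> \oo] --> 0.
  by rewrite -[X in _ --> X](mul0r (l2 g + 0)); apply: cvgM.
apply: cvg0_le (cvg0D h1 (cvg0Z (l2 f) hv)) => n; first exact: nc_ge0.
have -> : ip (u n) (v n) - ip f g =
    ip (fun x => u n x - f x) (v n) + ip f (fun x => v n x - g x).
  by rewrite ipBl// ipBr//; ring.
apply: le_trans (ncD _ _) _; apply: lerD; last by apply: ip_le => //; exact: L2B.
apply: le_trans (ip_le (L2B (Lu n) Lf) (Lv n)) _.
rewrite ler_wpM2l ?l2_ge0//.
have := l2D Lg (L2B (Lv n) Lg); congr (_ <= _); congr l2.
by apply/funext => x; rewrite addrC subrK.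
Qed.

End L2.

(** * Completeness, projections and adjoints *)

Section Hilbert.
Variable R : realType.
Local Notation C := R[i].
Local Notation leb := (@lebesgue_measure R).
Implicit Types (f g h : R -> C) (z : C).

(* An explicit formula for the limit of a sequence with [`|v n.+1 - v n| <= s / 2 ^ n]. *)
Definition glim (s : R) (v : nat -> R) : R := sup (range (fun n => v n - 2 * s * 2^-1 ^+ n)).

Lemma le_of_eq (x y : R) : x = y -> x <= y. Proof. by move=> ->. Qed.

Lemma cvg0_ge (c : R) (a : nat -> R) : (forall n, c <= a n) -> a n @[n --> \oo] --> 0 -> c <= 0.
Proof.
move=> ca h; rewrite leNgt; apply/negP => c0.
move/cvgrPdist_lt : h => /(_ _ c0) [N _ /(_ N (leqnn N))] /=.
rewrite sub0r normrN => /(le_lt_trans (ler_norm _)); by rewrite ltNge ca.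
Qed.

Lemma cvg0_sqrt (a : nat -> R) : a n @[n --> \oo] --> 0 -> Num.sqrt (a n) @[n --> \oo] --> 0.
Proof.
move=> h; rewrite -[X in _ --> X](sqrtr0 R).
exact: (cvg_comp _ _ h (@sqrt_continuous R 0)).
Qed.

Lemma half_gt0 n : 0 < 2^-1 ^+ n :> R.
Proof. by rewrite exprn_gt0// invr_gt0. Qed.

(** The intervals with centre [v n] and radius [2 * s / 2 ^ n] are nested, so the supremum of their
    left ends belongs to all of them. *)
Lemma glimP s v : 0 <= s -> (forall n, `|v n.+1 - v n| <= s * 2^-1 ^+ n) ->
  forall n, `|v n - glim s v| <= 2 * s * 2^-1 ^+ n.
Proof.
move=> s0 hv.
pose a n := v n - 2 * s * 2^-1 ^+ n; pose b n := v n + 2 * s * 2^-1 ^+ n.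
have halfS n : 2^-1 ^+ n.+1 = 2^-1 * 2^-1 ^+ n :> R by rewrite exprS.
have aS n : a n <= a n.+1.
  have := hv n; rewrite /a halfS ler_norml => /andP[h1 _].
  have := mulr_ge0 s0 (ltW (half_gt0 n)); lra.
have bS n : b n.+1 <= b n.
  have := hv n; rewrite /b halfS ler_norml => /andP[_ h1].
  have := mulr_ge0 s0 (ltW (half_gt0 n)); lra.
have amono m n : (m <= n)%N -> a m <= a n by move/nondecreasing_seqP : aS; apply.
have bmono m n : (m <= n)%N -> b n <= b m.
  by move/nonincreasing_seqP : bS; apply.
have aleb n : a n <= b n.
  rewrite /a /b; have := mulr_ge0 s0 (ltW (half_gt0 n)); lra.
have ab m n : a m <= b n.
  apply: le_trans (amono _ _ (leq_maxl m n)) _.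
  exact: le_trans (aleb _) (bmono _ _ (leq_maxr m n)).
move=> n; rewrite ler_norml.
have hs : has_sup (range a) by split; [exists (a 0%N), 0%N|exists (b 0%N) => _ [m _ <-]].
have := sup_upper_bound hs => /(_ (a n)) h1.
have h2 : sup (range a) <= b n by apply: ge_sup; [exists (a 0%N), 0%N|move=> _ [m _ <-]].
have {}h1 : a n <= sup (range a) by apply: h1; exists n.
move: h1 h2; rewrite /glim -/a /b /a => h1 h2.
apply/andP; split; lra.
Qed.

Lemma cvg_half (k : R) : (k * 2^-1 ^+ n) @[n --> \oo] --> 0.
Proof.
by apply: cvg0Z; apply: cvg_expr; rewrite ger0_norm ?invr_ge0// invf_lt1// ltr1n.
Qed.

(* The sum of the weighted increments is integrable, hence finite almost everywhere,
   which forces geometric pointwise convergence. *)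
Lemma L2_complete (F : nat -> R -> C) : (forall n, L2fun (F n)) ->
  (forall n, nsq (fun x => F n.+1 x - F n x) <= 8^-1 ^+ n) ->
  exists2 f, L2fun f & l2 (fun x => F n x - f x) @[n --> \oo] --> 0.
Proof.
move=> LF hF.
(* The weight [4 ^ n] sits between two demands: the integrals [4 ^ n / 8 ^ n] remain summable, and a
   finite sum [H x] still forces increments of size at most [sqrt (H x) / 2 ^ n]. *)
pose d n x := 4 ^+ n * sqmod (F n.+1 x - F n x).
have d0 n x : 0 <= d n x by rewrite mulr_ge0 ?sqmod_ge0// exprn_ge0.
have Ld n : L1 (d n) by apply: L1Z; apply: L2_L1; apply: L2B.
have md n : measurable_fun setT (fun x => (d n x)%:E) by case/integrableP: (Ld n).
pose H x : \bar R := (\sum_(n <oo) (d n x)%:E)%E.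
have H0 x : (0 <= H x)%E by apply: nneseries_ge0 => n _ _; rewrite lee_fin.
have mH : measurable_fun setT H.
  apply: ge0_emeasurable_sum => // n x _ _; by rewrite lee_fin.
have iH : leb.-integrable setT H.
  apply/integrableP; split => //.
  under eq_integral do rewrite gee0_abs//.
  rewrite integral_nneseries//; last by move=> n x _; rewrite lee_fin.
  have le n : (\int[leb]_x (d n x)%:E <= (2^-1 ^+ n)%:E)%E.
    rewrite -(fineK (integrable_fin_num measurableT (Ld n))) lee_fin.
    have -> : fine (\int[leb]_x (d n x)%:E) = 4 ^+ n * nsq (fun x => F n.+1 x - F n x).
      by rewrite nsqE -rintZ//; apply: L2_L1; apply: L2B.
    apply: le_trans (ler_wpM2l _ (hF n)) _; first by rewrite exprn_ge0.
    rewrite -exprMn (_ : 4 * 8^-1 = 2^-1 :> R)//; lra.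
  apply: le_lt_trans (lee_nneseries _ (fun n _ => le n)) _.
    by move=> n _ _; apply: integral_ge0 => x _; rewrite lee_fin.
  have -> : (\sum_(n <oo) (2^-1 ^+ n)%:E)%E = 2%:E :> \bar R.
    have := @cvg_geometric_eseries_half R 2 0; rewrite expr0 divr1 => /cvg_lim h.
    rewrite -[RHS]h//; apply: congr_lim; apply/funext => n; rewrite /eseries /=.
    apply: eq_bigr => i _; congr EFin.
    rewrite addn1 natrX exprS invfM mulrA mulfV ?mul1r ?exprVn//.
  exact: ltry.
have [Lh _] := L1_fine iH.
pose s x := Num.sqrt (fine (H x)).
have s0 x : 0 <= s x by exact: sqrtr_ge0.
have fin x : (H x < +oo)%E -> H x \is a fin_num by move=> hx; rewrite ge0_fin_numE.
have dH n x : (H x < +oo)%E -> nc (F n.+1 x - F n x) <= s x * 2^-1 ^+ n.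
  move=> hx.
  have : ((d n x)%:E <= H x)%E.
    apply: le_trans (_ : \sum_(0 <= i < n.+1) (d i x)%:E <= _)%E; last first.
      by apply: nneseries_lim_ge => i _ _; rewrite lee_fin.
    rewrite big_nat_recr//= leeDr// sume_ge0// => i _; by rewrite lee_fin.
  rewrite -(fineK (fin _ hx)) lee_fin => hd.
  rewrite -(@ler_pXn2r _ 2) ?nnegrE ?nc_ge0 ?mulr_ge0 ?exprn_ge0 ?invr_ge0//.
  rewrite sqr_nc exprMn sqr_sqrtr; last by rewrite fine_ge0.
  rewrite -exprM mulnC exprM (_ : 2^-1 ^+ 2 = 4^-1 :> R); last by rewrite expr2; lra.
  by rewrite exprVn ler_pdivlMr ?exprn_gt0// mulrC.
pose good := [set x | (H x < +oo)%E].
have mgood : measurable good.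
  by rewrite -[good]setTI; exact: emeasurable_fun_infty_o.
pose f x := if (H x < +oo)%E then
  Complex (glim (s x) (fun n => complex.Re (F n x))) (glim (s x) (fun n => complex.Im (F n x))) else 0.
(* Replacing [F n] by 0 where [H] is infinite makes the convergence hold at every point, which
   yields measurability of the limit. *)
pose F' n x : C := if (H x < +oo)%E then F n x else 0.
have le n x : nc (F' n x - f x) <= 4 * s x * 2^-1 ^+ n.
  rewrite /F' /f; case: ifPn => hx; last first.
    by rewrite subrr nc0 !mulr_ge0// ltW// half_gt0.
  apply: le_trans (nc_ReIm _) _; rewrite cReD cImD cReN cImN /=.
  have := @glimP (s x) (fun n => complex.Re (F n x)) (s0 x) _ n.
  have := @glimP (s x) (fun n => complex.Im (F n x)) (s0 x) _ n.
  move=> h1 h2; have := h1 _; have := h2 _; move=> {}h1 {}h2.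
  suff : forall (a b : R), a <= 2 * s x * 2^-1 ^+ n -> b <= 2 * s x * 2^-1 ^+ n ->
     a + b <= 4 * s x * 2^-1 ^+ n.
    apply.
    + by apply: h1 => m; rewrite -cReN -cReD (le_trans (Re_nc _))// dH.
    + by apply: h2 => m; rewrite -cImN -cImD (le_trans (Im_nc _))// dH.
  by move=> a b; lra.
have mF' n : cmeas (F' n).
  have -> : F' n = fun x => real_complex R (\1_good x) * F n x.
    apply/funext => x; rewrite /F' indicE.
    case: ifPn => hx; first by rewrite mem_set// mul1r.
    by rewrite memNset ?mul0r//; exact/negP.
  by apply: cmeasM; [apply: cmeas_real; exact: measurable_indic|exact: L2_cmeas].
have mf : cmeas f.
  apply: (cmeas_cvg mF') => x.
  apply: cvg0_le (cvg_half (4 * s x)) => n; [exact: nc_ge0|exact: le].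
have FF' n : Defs.ae_eq (F n) (F' n).
  have := integrable_ae measurableT iH; apply: aeS => x /(_ I).
  by rewrite /F' ge0_fin_numE// => ->.
have LF' n : L2fun (F' n) by apply: L2_ae (FF' n) => //.
have LG k : L1 (fun x => k * fine (H x)) by exact: L1Z.
have sle n x : sqmod (F' n x - f x) <= 16 * 4^-1 ^+ n * fine (H x).
  rewrite -sqr_nc; apply: le_trans (_ : (4 * s x * 2^-1 ^+ n) ^+ 2 <= _).
    by rewrite ler_pXn2r ?nnegrE ?nc_ge0// !mulr_ge0// ltW// half_gt0.
  rewrite !exprMn sqr_sqrtr; last by rewrite fine_ge0.
  rewrite -exprM mulnC exprM (_ : 2^-1 ^+ 2 = 4^-1 :> R); last by rewrite expr2; lra.
  by apply: le_of_eq; rewrite expr2; ring.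
have Ld' n : L2fun (fun x => F' n x - f x).
  by apply: le_L2 (LG _) (sle n); apply: cmeasB.
have Lf : L2fun f.
  have -> : f = fun x => F' 0%N x - (F' 0%N x - f x) by apply/funext => x; rewrite subKr.
  exact: L2B.
exists f => //.
apply: cvg0_le (cvg_half (4 * Num.sqrt (rint (fun x => fine (H x))))) => n; first exact: l2_ge0.
rewrite -(@ler_pXn2r _ 2) ?nnegrE ?l2_ge0 ?mulr_ge0 ?sqrtr_ge0 ?(ltW (half_gt0 _))//.
have r0 : 0 <= rint (fun x => fine (H x)) by apply: rint_ge0 => x; rewrite fine_ge0.
rewrite sqr_l2 !exprMn sqr_sqrtr// -exprM mulnC exprM.
rewrite (_ : 2^-1 ^+ 2 = 4^-1 :> R); last by rewrite expr2; lra.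
have -> : nsq (fun x => F n x - f x) = nsq (fun x => F' n x - f x).
  apply: nsq_ae => //; first exact: L2B.
  by apply: aeS (FF' n) => x ->.
apply: le_trans (_ : rint (fun x => 16 * 4^-1 ^+ n * fine (H x)) <= _).
  by apply: le_rint => //; exact: L2_L1.
rewrite rintZ//; apply: le_of_eq; rewrite expr2; ring.
Qed.

Lemma parallelogram f g : L2fun f -> L2fun g ->
  nsq (fun x => f x + g x) + nsq (fun x => f x - g x) = 2 * nsq f + 2 * nsq g.
Proof.
move=> Lf Lg; rewrite nsqD// (nsqD Lf (L2N Lg)) nsqN.
have -> : ip f (fun x => - g x) = - ip f g.
  by rewrite (ipJ (L2N Lg) Lf) ipNl// (ipJ Lf Lg); case: (ip f g) => a b; apply: complex_eq => /=; rewrite ?opprK.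
rewrite cReN; ring.
Qed.

Definition lin_subspace (S : set (R -> C)) := [/\ S `<=` @L2fun R, S (fun=> 0),
  (forall f g, S f -> S g -> S (fun x => f x + g x)) &
  (forall z f, S f -> S (fun x => z * f x))].

(** [S] need not be closed. The projection onto its closure therefore comes with a sequence in [S]
    converging to it, obtained from almost minimisers of the distance. *)
Lemma projection (S : set (R -> C)) f : lin_subspace S -> L2fun f ->
  exists p (s : nat -> R -> C), [/\ L2fun p, (forall n, S (s n)),
    l2 (fun x => s n x - p x) @[n --> \oo] --> 0 &
    forall g, S g -> ip (fun x => f x - p x) g = 0].
Proof.
move=> [SL S0 SD SZ] Lf.
pose D := [set nsq (fun x => f x - g x) | g in S].
have hD : has_inf D.
  split; first by exists (nsq (fun x => f x - 0)); exists (fun=> 0).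
  by exists 0 => _ [g _ <-]; exact: nsq_ge0.
pose d := inf D.
have dle g : S g -> d <= nsq (fun x => f x - g x).
  by move=> Sg; apply: (inf_lbound hD.2); exists g.
(* By the parallelogram identity the squared increments are at most [2 * e n + 2 * e n.+1], which is
   below the rate [8 ^ - n] required by [L2_complete]. *)
pose e n : R := 4^-1 * 8^-1 ^+ n.
have e0 n : 0 < e n by rewrite /e mulr_gt0// ?exprn_gt0// invr_gt0.
have [s hs] : {s : nat -> R -> C & forall n, S (s n) /\ nsq (fun x => f x - s n x) <= d + e n}.
  suff h n : {g | S g /\ nsq (fun x => f x - g x) <= d + e n}.
    by exists (fun n => projT1 (h n)) => n; exact: (projT2 (h n)).
  apply: cid; have [_ [g Sg <-] /ltW h] := inf_adherent (e0 n) hD.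
  by exists g.
have Ls n : L2fun (s n) by apply: SL; case: (hs n).
have Lfs n : L2fun (fun x => f x - s n x) by exact: L2B.
have cauchy n : nsq (fun x => s n.+1 x - s n x) <= 8^-1 ^+ n.
  have := parallelogram (Lfs n) (Lfs n.+1).
  have -> : (fun x => f x - s n x - (f x - s n.+1 x)) = fun x => s n.+1 x - s n x.
    by apply/funext => x; ring.
  pose m x := 2^-1 * (s n x + s n.+1 x).
  have Sm : S m by apply: SZ; apply: SD; [case: (hs n)|case: (hs n.+1)].
  have -> : nsq (fun x => f x - s n x + (f x - s n.+1 x)) = 4 * nsq (fun x => f x - m x).
    have -> : (fun x => f x - s n x + (f x - s n.+1 x)) = fun x => 2 * (f x - m x).
      by apply/funext => x; rewrite /m; field.
    rewrite nsqZ; last by apply: L2B => //; exact: SL.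
    by congr (_ * _); rewrite /sqmod /=; ring.
  have := dle _ Sm; have := (hs n).2; have := (hs n.+1).2.
  rewrite /e exprS; have : 0 < 8^-1 ^+ n :> R by rewrite exprn_gt0// invr_gt0.
  lra.
have [p Lp hp] := L2_complete Ls cauchy.
exists p, s; split => //; first by move=> n; case: (hs n).
move=> g Sg; have Lg := SL _ Sg.
pose k := nsq g + 1.
have k0 : 0 < k by rewrite /k; have := nsq_ge0 g; lra.
have An n : sqmod (ip (fun x => f x - s n x) g) <= k * e n.
  set A := ip _ g.
  (* Moving [s n] by [A / k] along [g] lowers the squared distance by at least [|A|^2 / k], and
     near-minimality allows at most [e n]. The summand 1 in [k] avoids division by zero when [g] is
     null. *)
  have Sg' : S (fun x => s n x + (k^-1)%:C%C * A * g x) by apply: SD; [case: (hs n)|exact: SZ].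
  have := dle _ Sg'.
  have -> : (fun x => f x - (s n x + (k^-1)%:C%C * A * g x)) =
     fun x => (f x - s n x) + (- ((k^-1)%:C%C * A)) * g x by apply/funext => x; ring.
  rewrite nsqD//; last exact: L2Z.
  rewrite nsqZ// ipZr// -/A.
  have -> : conjc (- ((k^-1)%:C%C * A)) * A = (- (k^-1 * sqmod A))%:C%C.
    by case: (A) => a b; apply: complex_eq; rewrite /sqmod /=; ring.
  have -> : sqmod (- ((k^-1)%:C%C * A)) = k^-1 ^+ 2 * sqmod A.
    by case: (A) => a b; rewrite /sqmod /=; ring.
  have := (hs n).2; rewrite /= => h1 h2.
  have h3 : k^-1 ^+ 2 * sqmod A * nsq g <= k^-1 * sqmod A.
    rewrite expr2 -!mulrA ler_wpM2l ?invr_ge0 ?(ltW k0)// mulrCA -[leRHS]mulr1.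
    rewrite ler_wpM2l ?sqmod_ge0// ler_pdivrMl// mulr1 /k; lra.
  have h4 : k^-1 * sqmod A <= e n by lra.
  by rewrite -ler_pdivrMl.
have h1 : ccvg (fun n => ip (fun x => f x - s n x) g) (ip (fun x => f x - p x) g).
  apply: cvg0_ip => //; first exact: L2B.
    apply: cvg0_le hp => n; first exact: l2_ge0.
    rewrite -l2N; apply: le_of_eq; congr l2; apply/funext => x; ring.
  by rewrite l2_subrr; exact: cvg_cst.
apply: (ccvg_unique h1).
have h2 : Num.sqrt (k * e n) @[n --> \oo] --> 0.
  apply: cvg0_sqrt; rewrite /e; apply: cvg0Z; apply: cvg0Z.
  by apply: cvg_expr; rewrite ger0_norm ?invr_ge0// invf_lt1// ltr1n.
apply: cvg0_le h2 => n; first exact: nc_ge0.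
by rewrite subr0 /nc ler_wsqrtr.
Qed.

Lemma L2_ip_inj u v : L2fun u -> L2fun v -> (forall f, L2fun f -> ip f u = ip f v) ->
  Defs.ae_eq u v.
Proof.
move=> Lu Lv h; have Luv := L2B Lu Lv.
have : nsq (fun x => u x - v x) = 0.
  have : ip (fun x => u x - v x) (fun x => u x - v x) = 0.
    by rewrite ipBr// h// subrr.
  by rewrite ip_self => -[].
move/(nsq_eq0 Luv); apply: aeS => x /eqP; by rewrite subr_eq0 => /eqP.
Qed.

Lemma riesz (l : (R -> C) -> C) k :
  (forall z f g, L2fun f -> L2fun g -> l (fun x => z * f x + g x) = z * l f + l g) ->
  (forall f, L2fun f -> nc (l f) <= k * l2 f) ->
  exists2 g, L2fun g & forall f, L2fun f -> l f = ip f g.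
Proof.
move=> llin lb.
have lD f g : L2fun f -> L2fun g -> l (fun x => f x + g x) = l f + l g.
  move=> Lf Lg; rewrite -[l f]mul1r -llin//; congr l.
  by apply/funext => x; rewrite mul1r.
have l0 : l (fun=> 0) = 0.
  have := lD _ _ (@L20 R) (@L20 R); under eq_fun do rewrite addr0.
  by move=> /eqP; rewrite -subr_eq subrr => /eqP <-.
have lZ z f : L2fun f -> l (fun x => z * f x) = z * l f.
  move=> Lf; have := llin z f _ Lf (@L20 R); rewrite l0 addr0 => <-; congr l.
  by apply/funext => x; rewrite addr0.
have [[f0 [Lf0 lf0]]|nex] := pselect (exists f, L2fun f /\ l f <> 0); last first.
  exists (fun=> 0); first exact: L20.
  by move=> f Lf; rewrite ip0r; apply: contrapT => h; apply: nex; exists f.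
pose S := [set f | L2fun f /\ l f = 0].
have sS : lin_subspace S.
  split.
  - by move=> f [].
  - by split; [exact: L20|exact: l0].
  - by move=> f g [Lf lf] [Lg lg]; split; [exact: L2D|rewrite lD// lf lg addr0].
  - by move=> z f [Lf lf]; split; [exact: L2Z|rewrite lZ// lf mulr0].
have [p [s [Lp Ss hs orth]]] := projection sS Lf0.
(* [p] is only a limit of elements of the kernel of [l]; the bound on [l] carries the vanishing
   over. *)
have lp : l p = 0.
  apply: nc_eq0; apply/eqP; rewrite eq_le nc_ge0 andbT.
  have h : (k * l2 (fun x => s n x - p x)) @[n --> \oo] --> 0 by exact: cvg0Z.
  apply: (cvg0_ge _ h) => n.
  have [Ls ls] := Ss n.
  apply: le_trans (_ : nc (l (fun x => s n x - p x)) <= _); last by apply: lb; exact: L2B.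
  have -> : (fun x => s n x - p x) = (fun x => s n x + (-1) * p x).
    by apply/funext => x; rewrite mulN1r.
  rewrite lD//; last exact: L2Z.
  by rewrite ls lZ// add0r mulN1r ncN.
pose q x := f0 x - p x.
have Lq : L2fun q by exact: L2B.
have lq : l q = l f0.
  have -> : q = (fun x => f0 x + (-1) * p x) by apply/funext => x; rewrite mulN1r.
  rewrite lD//; last exact: L2Z.
  by rewrite lZ// lp mulr0 addr0.
have q0 : ip q q != 0.
  rewrite ip_self; apply/eqP => -[/eqP qq]; apply: lf0; rewrite -lq.
  apply: nc_eq0; apply/eqP; rewrite eq_le nc_ge0 andbT.
  by apply: le_trans (lb _ Lq) _; rewrite /l2 (eqP qq) sqrtr0 mulr0.
exists (fun x => conjc (l q / ip q q) * q x); first exact: L2Z.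
move=> f Lf; rewrite ipZr// conjcK.
have Sf : S (fun x => f x + (- (l f / l q)) * q x).
  split; first by apply: L2D => //; exact: L2Z.
  rewrite lD//; last exact: L2Z.
  by rewrite lZ// mulNr divfK ?subrr// lq; exact/eqP.
have := orth _ Sf; rewrite -/q (ipJ _ Lq); last by case: Sf.
move=> /(congr1 conjc); rewrite conjcK conjc0 ipDl//; last exact: L2Z.
rewrite ipZl// => /eqP; rewrite addr_eq0 mulNr opprK => /eqP ->.
have lq0 : l q != 0 by rewrite lq; exact/eqP.
by rewrite mulrA; field; rewrite q0 lq0.
Qed.

Lemma op_L2 (T : op R) f : bounded_op T -> L2fun f -> L2fun (T f).
Proof. by move=> [h _]; exact: h. Qed.

Lemma op_ae (T : op R) f g : bounded_op T -> L2fun f -> L2fun g -> Defs.ae_eq f g ->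
  Defs.ae_eq (T f) (T g).
Proof. by move=> [_ [h _]]; exact: h. Qed.

Lemma op_lin (T : op R) a f g : bounded_op T -> L2fun f -> L2fun g ->
  Defs.ae_eq (T (fun t => a * f t + g t)) (fun t => a * T f t + T g t).
Proof. by move=> [_ [_ [h _]]]; exact: h. Qed.

Lemma op_bound (T : op R) : bounded_op T ->
  exists2 k, 0 <= k & forall f, L2fun f -> l2 (T f) <= k * l2 f.
Proof.
move=> [_ [_ [_ [c hc]]]]; exists (Num.sqrt `|c|) => // f Lf.
rewrite /l2 -sqrtrM// ler_wsqrtr//; apply: le_trans (hc f Lf) _.
by rewrite ler_wpM2r ?nsq_ge0// ler_norm.
Qed.

Lemma opI (T : op R) k : 0 <= k -> (forall f, L2fun f -> L2fun (T f)) ->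
  (forall f g, L2fun f -> L2fun g -> Defs.ae_eq f g -> Defs.ae_eq (T f) (T g)) ->
  (forall (a : C) f g, L2fun f -> L2fun g ->
     Defs.ae_eq (T (fun t => a * f t + g t)) (fun t => a * T f t + T g t)) ->
  (forall f, L2fun f -> l2 (T f) <= k * l2 f) -> bounded_op T.
Proof.
move=> k0 h1 h2 h3 h4; split => //; split => //; split => //.
exists (k ^+ 2) => f Lf; rewrite -!sqr_l2 -exprMn ler_pXn2r ?nnegrE ?mulr_ge0 ?l2_ge0//.
exact: h4.
Qed.

Lemma op_ip_lin (T : op R) a f g h : bounded_op T -> L2fun f -> L2fun g -> L2fun h ->
  ip (T (fun t => a * f t + g t)) h = a * ip (T f) h + ip (T g) h.
Proof.
move=> bT Lf Lg Lh; have LTf := op_L2 bT Lf; have LTg := op_L2 bT Lg.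
rewrite -ipZl// -ipDl//; last exact: L2Z.
apply: ip_ae => //; last exact: aeW.
- by apply: op_L2 => //; apply: L2D => //; exact: L2Z.
- by apply: L2D => //; exact: L2Z.
- exact: op_lin.
Qed.

Lemma adjoint (T : op R) : bounded_op T -> exists2 T', bounded_op T' &
  forall f g, L2fun f -> L2fun g -> ip (T f) g = ip f (T' g).
Proof.
move=> bT; have [k k0 hk] := op_bound bT.
have ex g : {g' | L2fun g -> L2fun g' /\ forall f, L2fun f -> ip (T f) g = ip f g'}.
  (* An operator has to be defined on all functions, so 0 is chosen outside the square integrable
     ones. *)
  apply: cid; have [Lg|nLg] := pselect (L2fun g); last by exists (fun=> 0).
  have [||g' Lg' h] := @riesz (fun f => ip (T f) g) (k * l2 g).
  - by move=> z f h Lf Lh; exact: op_ip_lin.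
  - move=> f Lf; apply: le_trans (ip_le (op_L2 bT Lf) Lg) _.
    by rewrite mulrAC ler_wpM2r ?l2_ge0 ?hk.
  by exists g'.
pose T' g := projT1 (ex g).
have hT' g : L2fun g -> L2fun (T' g) /\ forall f, L2fun f -> ip (T f) g = ip f (T' g).
  exact: (projT2 (ex g)).
exists T'; last by move=> f g Lf Lg; exact: (hT' g Lg).2.
apply: (opI k0).
- by move=> f Lf; exact: (hT' f Lf).1.
- move=> f g Lf Lg fg; apply: L2_ip_inj; [exact: (hT' f Lf).1|exact: (hT' g Lg).1|].
  move=> h Lh; rewrite -(hT' f Lf).2// -(hT' g Lg).2//.
  by apply: ip_ae => //; [exact: op_L2|exact: op_L2|exact: aeW].
- move=> a f g Lf Lg.
  have La : L2fun (fun t => a * f t + g t) by apply: L2D => //; exact: L2Z.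
  have L' : L2fun (fun t => a * T' f t) by apply: L2Z; exact: (hT' f Lf).1.
  apply: L2_ip_inj; [exact: (hT' _ La).1|by apply: L2D => //; exact: (hT' g Lg).1|].
  move=> h Lh; rewrite -(hT' _ La).2//.
  have LT := op_L2 bT Lh.
  rewrite !ipDr ?ipZr//; [|exact: (hT' f Lf).1|exact: (hT' g Lg).1|exact: L2Z].
  by rewrite (hT' f Lf).2// (hT' g Lg).2.
- move=> g Lg; have LTg := (hT' g Lg).1.
  have : l2 (T' g) * l2 (T' g) <= k * l2 g * l2 (T' g).
    rewrite -expr2 sqr_l2.
    have -> : nsq (T' g) = complex.Re (ip (T (T' g)) g).
      by rewrite (hT' g Lg).2// ip_self.
    apply: le_trans (ler_norm _) _; apply: le_trans (Re_nc _) _.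
    apply: le_trans (ip_le (op_L2 bT LTg) Lg) _.
    by rewrite mulrAC ler_wpM2r ?l2_ge0 ?hk.
  have [->|n0] := eqVneq (l2 (T' g)) 0; first by rewrite mulr_ge0 ?l2_ge0.
  by rewrite ler_pM2r// lt_neqAle eq_sym n0 l2_ge0.
Qed.

End Hilbert.

(** * The Fourier transform *)

Section SignedIndicator.
Variable R : realType.
Local Notation C := R[i].
Local Notation leb := (@lebesgue_measure R).

(** The negative sign for [b < 0] makes the difference of any two of these functions a signed
    indicator of an interval, as with an integral started at 0. Half-open intervals make this exact
    at every point. *)
Definition indR (b x : R) : R := (0 <= x < b)%R%:R - (b <= x < 0)%R%:R.
Definition ind (b x : R) : C := real_complex R (indR b x).

Lemma indR_itv (a b x : R) : a <= b -> indR b x - indR a x = (a <= x < b)%R%:R.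
Proof.
move=> ab; rewrite /indR.
have [h1|h1] := leP 0 x; have [h2|h2] := ltP x b; have [h3|h3] := leP a x;
  have [h4|h4] := ltP x 0; have [h5|h5] := leP b x; have [h6|h6] := ltP x a => //=; lra.
Qed.

Lemma indR0 x : indR 0 x = 0.
Proof. by rewrite /indR; case: (leP 0 x); case: (ltP x 0) => //=; lra. Qed.

Lemma indR_shift (a b x : R) : indR b x - indR a x = indR (b - a) (x - a).
Proof.
have [ab|ba] := leP a b.
  rewrite indR_itv// -[RHS]subr0 -(indR0 (x - a)) indR_itv ?subr_ge0//.
  by rewrite ltrD2r.
have h1 := indR_itv x (ltW ba).
have := @indR_itv (b - a) 0 (x - a); rewrite lerD2r subr_lt0 indR0 subr_le0 => /(_ (ltW ba)).
lra.
Qed.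

Lemma indR_scale (b x : R) : 0 < b -> indR b x = indR 1 (b^-1 * x).
Proof.
move=> b0; rewrite /indR pmulr_rge0 ?invr_gt0// pmulr_rlt0 ?invr_gt0//.
by rewrite ltr_pdivrMl// mulr1 ler_pdivlMl// mulr1.
Qed.

Lemma rint_itv (a b : R) : a <= b -> L1 (fun x => (a <= x < b)%R%:R) /\
  rint (fun x => (a <= x < b)%R%:R) = b - a.
Proof.
move=> ab.
have E : (fun x => (a <= x < b)%R%:R) = \1_(`[a, b[%classic) :> (R -> R).
  by apply/funext => x; rewrite indicE mem_setE in_itv.
rewrite E; split; first exact: integrable_indic_itv.
rewrite /rint /Rintegral integral_indic//.
transitivity (fine (leb `[a, b[%classic)); first by rewrite setIT.
rewrite lebesgue_measure_itv/= lte_fin.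
have [//|ba] := ltP a b; last by have -> : a = b; [lra|rewrite subrr].
Qed.

Lemma L1_indR b : L1 (indR b).
Proof.
have [b0|/ltW b0] := leP 0 b.
  have -> : indR b = fun x => (0 <= x < b)%R%:R.
    by apply/funext => x; rewrite -indR_itv// indR0 subr0.
  exact: (rint_itv b0).1.
have -> : indR b = fun x => - (b <= x < 0)%R%:R.
  by apply/funext => x; rewrite -indR_itv// indR0 sub0r opprK.
exact: L1N (rint_itv b0).1.
Qed.

Lemma meas_indR b : measurable_fun setT (indR b).
Proof. exact: L1_meas (L1_indR b). Qed.

Lemma cmeas_ind b : cmeas (ind b).
Proof. by apply: cmeas_real; exact: meas_indR. Qed.

Lemma nc_ind b x : nc (ind b x) = `|indR b x|. Proof. exact: nc_real. Qed.

Lemma C1_ind b : C1 (ind b).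
Proof. by split; [exact: L1_indR|exact: L10]. Qed.

Lemma ind0 : ind 0 = fun=> 0.
Proof. by apply/funext => x; rewrite /ind indR0. Qed.

Lemma ind_shift a b x : ind b x - ind a x = ind (b - a) (x - a).
Proof. by rewrite /ind -rmorphB/= indR_shift. Qed.

Lemma rint_indB a b : L1 (fun x => `|indR b x - indR a x|) /\
  rint (fun x => `|indR b x - indR a x|) = `|b - a|.
Proof.
wlog ab : a b / a <= b => [hw|].
  have [/hw//|/ltW /hw] := leP a b.
  have E : (fun x => `|indR b x - indR a x|) = (fun x => `|indR a x - indR b x|).
    by apply/funext => x; rewrite distrC.
  by rewrite distrC E.
have -> : (fun x => `|indR b x - indR a x|) = fun x => (a <= x < b)%R%:R.
  by apply/funext => x; rewrite indR_itv// normr_nat.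
by have [? ->] := rint_itv ab; rewrite ger0_norm// subr_ge0.
Qed.

Lemma nsq_indB a b : L2fun (fun x => ind b x - ind a x) /\
  nsq (fun x => ind b x - ind a x) = `|b - a|.
Proof.
have E : (fun x => sqmod (ind b x - ind a x)) = fun x => `|indR b x - indR a x|.
  apply/funext => x; rewrite -sqr_nc /ind -rmorphB/= nc_real.
  wlog ab : a b / a <= b => [hw|].
    have [/hw//|/ltW /hw] := leP a b.
    by rewrite distrC.
  by rewrite indR_itv// normr_nat; case: (_ && _); rewrite ?expr0n ?expr1n.
have [h1 h2] := rint_indB a b.
split; last by rewrite nsqE E.
by apply: L2I; [apply: cmeasB; exact: cmeas_ind|rewrite E].
Qed.

Lemma L2_ind b : L2fun (ind b).
Proof. by have := (nsq_indB 0 b).1; rewrite ind0; under eq_fun do rewrite subr0. Qed.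

Lemma nsq_ind b : nsq (ind b) = `|b|.
Proof. by have := (nsq_indB 0 b).2; rewrite ind0; under eq_fun do rewrite subr0; rewrite subr0. Qed.

Lemma conj_ind b x : conjc (ind b x) = ind b x.
Proof. exact: conjc_real. Qed.

Lemma polarization (u v : R -> C) : L2fun u -> L2fun v -> complex.Im (ip u v) = 0 ->
  ip u v = real_complex R (2^-1 * (nsq u + nsq v - nsq (fun x => u x - v x))).
Proof.
move=> Lu Lv im; apply: complex_eq => //=.
rewrite (nsqD Lu (L2N Lv)) nsqN.
have -> : ip u (fun x => - v x) = - ip u v.
  rewrite (ipJ (L2N Lv) Lu) ipNl// (ipJ Lu Lv); case: (ip u v) => a b.
  by apply: complex_eq => /=; rewrite ?opprK.
by rewrite cReN /=; field.
Qed.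

(** This is [min |a| |b|] when [a] and [b] have the same sign and 0 otherwise: the covariance of
    two-sided Brownian motion. *)
Definition gramI (a b : R) : R := 2^-1 * (`|a| + `|b| - `|a - b|).

Lemma ip_ind a b : ip (ind a) (ind b) = real_complex R (gramI a b).
Proof.
rewrite polarization; [|exact: L2_ind|exact: L2_ind|].
  by rewrite !nsq_ind (nsq_indB _ _).2.
have -> : ip (ind a) (ind b) = cint (fun x => real_complex R (indR a x * indR b x)).
  by rewrite ipE; congr cint; apply/funext => x; rewrite conj_ind /ind -rmorphM.
exact: rint0.
Qed.

(** The assumptions make [g] only locally integrable. Cut down to [[-n, n[], it has an identically
    vanishing primitive, and Lebesgue's differentiation of integrals gives [g = 0] almost everywhere
    there. *)
Lemma ae_eq0_of_ind (g : R -> R) :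
  (forall b, L1 (fun x => g x * indR b x)) -> (forall b, rint (fun x => g x * indR b x) = 0) ->
  {ae leb, forall x, g x = 0}.
Proof.
move=> Lg g0.
suff h n : {ae leb, forall x, - n%:R <= x < n%:R -> g x = 0}.
  have := @ae_foralln _ _ _ leb (fun n x => (- n%:R <= x < n%:R) -> g x = 0) h.
  apply: aeS => x hx; have [n hn] : exists n : nat, `|x| < n%:R.
    by exists (Num.truncn `|x|).+1; exact: truncnS_gt.
  by apply: (hx n); move: hn; rewrite ltr_norml => /andP[/ltW -> ->].
pose gn x := g x * (indR n%:R x - indR (- n%:R) x).
have nn : - n%:R <= n%:R :> R by rewrite -subr_ge0 opprK addr_ge0.
have Lgn : L1 gn.
  have -> : gn = fun x => g x * indR n%:R x + - (g x * indR (- n%:R) x).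
    by apply/funext => x; rewrite /gn; ring.
  by apply: L1D => //; exact: L1N.
have F0 y : Rintegral leb `]-oo, y]%classic gn = 0.
  transitivity (Rintegral leb `]-oo, y[%classic gn).
    by apply/esym/Rintegral_itv_bndo_bndc; apply: integrableS Lgn.
  rewrite Rintegral_mkcond.
  (* [c] is [y] clamped to [[-n, n]], so that cutting [gn] at [y] amounts to cutting [g] to [[-n,
     c[]. *)
  pose c := Num.max (- n%:R) (Num.min y n%:R).
  rewrite (_ : _ \_ _ = fun x => g x * indR c x + - (g x * indR (- n%:R) x)).
    by rewrite -/(rint _) rintD ?rintN ?g0 ?subr0//; exact: L1N.
  apply/funext => x.
  have cE : indR c x - indR (- n%:R) x = (- n%:R <= x < c)%R%:R.
    by apply: indR_itv; rewrite /c le_max lexx.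
  rewrite patchE mem_setE in_itv/= -mulrBr cE.
  rewrite /gn indR_itv// /c lt_max lt_min.
  case: (leP (- n%:R) x) => h1 /=; last by rewrite mulr0; case: ifP.
  by case: (ltP x y) => h2 //=; rewrite mulr0.
have ign y : leb.-integrable `]-oo, y]%classic (EFin \o gn) by apply: integrableS Lgn.
have := FTC1Ny ign (open_integrable_locally openT Lgn).
apply: aeS => x [_].
rewrite (_ : (fun x => _) = fun=> 0); last by apply/funext => y; exact: F0.
rewrite derive1_cst => gn0 hx.
by move: gn0; rewrite /gn indR_itv// hx mulr1 => ->.
Qed.

Lemma cae_eq0_of_ind (g : R -> C) :
  (forall b, C1 (fun x => g x * ind b x)) -> (forall b, cint (fun x => g x * ind b x) = 0) ->
  Defs.ae_eq g (fun=> 0).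
Proof.
move=> Cg g0.
have rE b : (fun x => complex.Re (g x * ind b x)) = fun x => complex.Re (g x) * indR b x.
  by apply/funext => x; rewrite cReM /= mulr0 subr0.
have iE b : (fun x => complex.Im (g x * ind b x)) = fun x => complex.Im (g x) * indR b x.
  by apply/funext => x; rewrite cImM /= mulr0 add0r.
have hr : {ae leb, forall x, complex.Re (g x) = 0}.
  apply: ae_eq0_of_ind => b; first by have [] := Cg b; rewrite rE.
  by have /(congr1 (@complex.Re R)) := g0 b; rewrite /= rE.
have hi : {ae leb, forall x, complex.Im (g x) = 0}.
  apply: ae_eq0_of_ind => b; first by have [] := Cg b; rewrite iE.
  by have /(congr1 (@complex.Im R)) := g0 b; rewrite /= iE.
by apply: aeS (aeI hr hi) => x [a b]; exact: complex_eq.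
Qed.

Lemma ind_total (f : R -> C) : L2fun f -> (forall b, ip f (ind b) = 0) -> Defs.ae_eq f (fun=> 0).
Proof.
move=> Lf h; apply: cae_eq0_of_ind => b.
  by have := L2M Lf (L2_ind b); under eq_fun do rewrite conj_ind.
by rewrite -(h b) ipE; congr cint; apply/funext => x; rewrite conj_ind.
Qed.

End SignedIndicator.

Section FourierIntegral.
Variable R : realType.
Local Notation C := R[i].
Local Notation leb := (@lebesgue_measure R).
Implicit Types f : R -> C.

Definition ft f (x : R) : C := cint (fun xi => f xi * expi (xi * x)).

Lemma meas_mulr (x : R) : measurable_fun setT (fun xi : R => xi * x).
Proof. exact: measurable_funM. Qed.

Lemma C1_expi f (phi : R -> R) : measurable_fun setT phi -> C1 f ->
  C1 (fun xi => f xi * expi (phi xi)).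
Proof.
move=> mp Cf; apply: le_C1 (C1_nc Cf) _.
  by apply: cmeasM; [exact: C1_meas|exact: cmeas_expi].
by move=> xi; rewrite ncM nc_expi mulr1.
Qed.

Lemma C1_ft f x : C1 f -> C1 (fun xi => f xi * expi (xi * x)).
Proof. by apply: C1_expi; exact: meas_mulr. Qed.

Lemma ft_le f x : C1 f -> nc (ft f x) <= rint (fun xi => nc (f xi)).
Proof.
move=> Cf; apply: le_trans (nc_cint (C1_ft x Cf)) _.
by apply: le_of_eq; congr rint; apply/funext => xi; rewrite ncM nc_expi mulr1.
Qed.

Lemma ccvg_expi (u : nat -> R) l : u n @[n --> \oo] --> l -> ccvg (fun n => expi (u n)) (expi l).
Proof.
move=> h; apply: ccvgE => /=.
  exact: (cvg_comp _ _ h (@continuous_cos R l)).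
exact: (cvg_comp _ _ h (@continuous_sin R l)).
Qed.

Lemma ft_seq f (u : nat -> R) l : C1 f -> u n @[n --> \oo] --> l ->
  ccvg (fun n => ft f (u n)) (ft f l).
Proof.
move=> Cf hu.
have [||||_] := @cint_dct R (fun n xi => f xi * expi (xi * u n)) (fun xi => f xi * expi (xi * l))
   (fun xi => nc (f xi)) _ _ _ _ => //.
- by move=> n; apply: C1_meas; exact: C1_ft.
- exact: C1_nc.
- by move=> n x; rewrite ncM nc_expi mulr1.
- move=> x; apply: ccvgZ; apply: ccvg_expi; apply: cvgM => //; exact: cvg_cst.
Qed.

Lemma seq_cmeas (g : R -> C) : (forall u l, u n @[n --> \oo] --> l ->
  ccvg (fun n => g (u n)) (g l)) -> cmeas g.
Proof.
move=> hg; split; apply: continuous_measurable_fun => l; apply/(@cvg_nbhsP _ R^o) => u hu.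
  exact: (ccvg_Re (hg _ _ hu)).
exact: (ccvg_Im (hg _ _ hu)).
Qed.

Lemma ft_meas f : C1 f -> cmeas (ft f).
Proof. by move=> Cf; apply: seq_cmeas => u l; exact: ft_seq. Qed.

Definition eb (b : R) := ft (@ind R b).

Lemma eb_shift a b x : eb b x - eb a x = expi (a * x) * eb (b - a) x.
Proof.
rewrite /eb /ft -cintB; [|exact/C1_ft/C1_ind..].
have [_ <-] := cint_shift (- a) (C1_ft x (C1_ind (b - a))).
rewrite -cintZ; last exact: (cint_shift _ (C1_ft x (C1_ind _))).1.
congr cint; apply/funext => xi.
rewrite -mulrBl ind_shift mulrCA -expiD; congr (_ * expi _); ring.
Qed.

Lemma eb0 x : eb 0 x = 0.
Proof. by rewrite /eb /ft ind0; under eq_fun do rewrite mul0r; exact: cint0. Qed.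

Lemma eb_opp a x : eb (- a) x = - (expi (- (a * x)) * eb a x).
Proof.
have := eb_shift (- a) 0 x; rewrite eb0 sub0r sub0r opprK mulNr => h.
by rewrite -h opprK.
Qed.

Lemma eb_scale b x : 0 < b -> eb b x = real_complex R b * eb 1 (b * x).
Proof.
move=> b0; have bn0 : b^-1 != 0 by rewrite invr_eq0 gt_eqF.
have [_ h] := cint_affine 0 bn0 (C1_ft (b * x) (C1_ind 1)).
rewrite normfV invrK gtr0_norm// in h; rewrite /eb /ft -h; congr cint; apply/funext => xi.
rewrite addr0 /ind indR_scale//; congr (_ * expi _); field.
by rewrite gt_eqF.
Qed.

Lemma ebJ b x : conjc (eb b x) = eb b (- x).
Proof.
rewrite /eb /ft -cintJ; last exact/C1_ft/C1_ind.
by congr cint; apply/funext => xi; rewrite conjM conj_ind expiJ mulrN.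
Qed.

Lemma eb_le b x : nc (eb b x) <= `|b|.
Proof.
apply: le_trans (ft_le _ (C1_ind b)) _; apply: le_of_eq.
have := (rint_indB 0 b).2; rewrite subr0 => <-; congr rint; apply/funext => xi.
by rewrite nc_ind indR0 subr0.
Qed.

(* Translating by half a period changes the sign of the exponential. *)
Lemma eb_decay b x : x != 0 -> nc (eb b x) <= pi / `|x|.
Proof.
move=> x0; pose h := pi / x.
have e1 : eb (b + h) x - eb h x = - eb b x.
  rewrite eb_shift addrK /h divfK//.
  have -> : expi (pi : R) = -1 by apply: complex_eq => /=; rewrite ?cospi ?sinpi ?oppr0.
  by rewrite mulN1r.
have e2 : eb b x + eb b x = - expi (b * x) * eb h x + eb h x.
  have := eb_shift b (b + h) x; rewrite [b + h - b]addrAC subrr add0r => e3.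
  have e4 : eb (b + h) x = eb h x - eb b x by rewrite -e1 addrCA subrr addr0.
  by rewrite mulNr -e3 e4; ring.
have : 2 * nc (eb b x) <= 2 * `|h|.
  have -> : 2 * nc (eb b x) = nc (eb b x + eb b x).
    rewrite -mulr2n -[eb b x *+ 2]mulr_natl ncM; congr (_ * _).
    have -> : (2 : C) = real_complex R 2 by rewrite rmorph_nat.
    by rewrite nc_real ger0_norm.
  rewrite e2; apply: le_trans (ncD _ _) _; rewrite ncM ncN nc_expi mul1r.
  by have := eb_le h x; lra.
rewrite ler_pM2l// => /le_trans; apply.
by rewrite /h normrM normfV ger0_norm// pi_ge0.
Qed.

Lemma L1_oneDsqrV : L1 (fun x : R => (1 + x ^+ 2)^-1).
Proof.
apply/integrableP; split.
  by apply/measurable_EFinP; apply: continuous_measurable_fun; exact: continuous_oneDsqrV.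
under eq_integral do rewrite /= ger0_norm ?invr_ge0 ?addr_ge0 ?sqr_ge0//.
rewrite ge0_symfun_integralT.
- have := integral0y_oneDsqr R; rewrite set_itvE /= => ->; exact: ltry.
- by move=> x; rewrite invr_ge0 addr_ge0 ?sqr_ge0.
- exact: continuous_oneDsqrV.
- by move=> x /=; rewrite sqrrN.
Qed.

(** The term [b ^+ 2] is the trivial bound and [pi ^+ 2] is the decay bound multiplied by [x ^+ 2];
    together they cover both small and large [x]. *)
Lemma sqmod_eb_le b x : sqmod (eb b x) <= (b ^+ 2 + pi ^+ 2) / (1 + x ^+ 2).
Proof.
have p : 0 < 1 + x ^+ 2 by have := sqr_ge0 x; lra.
rewrite ler_pdivlMr// -sqr_nc mulrDr mulr1; apply: lerD.
  by rewrite -[b ^+ 2]real_normK ?num_real// ler_pXn2r ?nnegrE ?nc_ge0// eb_le.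
have [->|x0] := eqVneq x 0; first by rewrite expr0n mulr0 sqr_ge0.
have -> : x ^+ 2 = `|x| ^+ 2 by rewrite real_normK ?num_real.
rewrite -exprMn ler_pXn2r ?nnegrE ?mulr_ge0 ?nc_ge0 ?pi_ge0//.
by rewrite -ler_pdivlMr ?normr_gt0// eb_decay.
Qed.

Lemma L2_eb b : L2fun (eb b).
Proof.
by apply: (le_L2 _ (L1Z _ L1_oneDsqrV) (sqmod_eb_le b)); exact: ft_meas (C1_ind b).
Qed.

(** Classically equal to [2 * pi]. It is kept symbolic and its inverse square root normalises the
    Fourier transform. *)
Definition nrm := nsq (eb 1).

Lemma nsq_eb b : nsq (eb b) = nrm * `|b|.
Proof.
have pos a : 0 < a -> nsq (eb a) = nrm * `|a|.
  move=> a0; have an0 : a != 0 by rewrite gt_eqF.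
  have [_ h] := rint_affine 0 an0 (L2_L1 (L2_eb 1)).
  rewrite nsqE; have -> : (fun x => sqmod (eb a x)) = fun x => a ^+ 2 * sqmod (eb 1 (a * x + 0)).
    apply/funext => x; rewrite eb_scale// sqmodM addr0; congr (_ * _).
    by rewrite /sqmod /= expr0n addr0.
  rewrite rintZ; last exact: (rint_affine 0 an0 (L2_L1 (L2_eb 1))).1.
  by rewrite h /nrm nsqE gtr0_norm//; field.
have [b0|b0|->] := ltgtP b 0.
- have -> : nsq (eb b) = nsq (eb (- b)).
    rewrite !nsqE; congr rint; apply/funext => x.
    by rewrite eb_opp -!sqr_nc ncN ncM nc_expi mul1r.
  by rewrite pos ?oppr_gt0// normrN.
- exact: pos.
- by have -> : eb 0 = fun=> 0; [apply/funext => x; exact: eb0|rewrite normr0 mulr0 nsq0].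
Qed.

Lemma nsq_ebB a b : nsq (fun x => eb b x - eb a x) = nrm * `|b - a|.
Proof.
rewrite -nsq_eb !nsqE; congr rint; apply/funext => x.
by rewrite eb_shift sqmodM -sqr_nc nc_expi expr1n mul1r.
Qed.

Lemma ip_eb a b : ip (eb a) (eb b) = real_complex R (nrm * gramI a b).
Proof.
rewrite polarization; [|exact: L2_eb|exact: L2_eb|].
  by rewrite !nsq_eb nsq_ebB /gramI; apply: complex_eq => //=; ring.
(* The reflection [x -> - x] conjugates every [eb b], so the inner product equals its own conjugate
   and is real. *)
have : ip (eb a) (eb b) = conjc (ip (eb a) (eb b)).
  rewrite -ipJ; [|exact: L2_eb|exact: L2_eb].
  rewrite !ipE; have [_ <-] := cint_refl 0 (L2M (L2_eb a) (L2_eb b)).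
  congr cint; apply/funext => x; rewrite sub0r -!ebJ; rewrite conjcK mulrC.
  by [].
by case: (ip _ _) => u v [] /=; lra.
Qed.

(** For [x] in [[0, 1/2[] all phases [xi * x] with [xi] in [[0, 1[] stay below [1/2 < pi / 2], so
    the real part of [eb 1 x] is at least [cos (1/2) > 0] on an interval of positive length. *)
Lemma nrm_gt0 : 0 < nrm.
Proof.
have c0 : 0 < cos (2^-1 : R).
  by apply: cos_gt0_pihalf; have := @pi_ge2 R; lra.
have low x : 0 <= x < 2^-1 -> cos 2^-1 <= complex.Re (eb 1 x).
  move=> /andP[x0 x1]; rewrite /eb /ft /=.
  have -> : cos 2^-1 = rint (fun xi : R => cos 2^-1 * indR 1 xi).
    rewrite rintZ; last exact: L1_indR.
    have -> : rint (indR (1 : R)) = 1.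
      transitivity (rint (fun xi : R => (0 <= xi < 1)%R%:R)); last first.
        by rewrite (rint_itv (@ler01 R)).2 subr0.
      congr rint; apply/funext => xi.
      by rewrite -indR_itv// indR0 subr0.
    by rewrite mulr1.
  apply: le_rint => [||xi].
  - by apply: L1Z; exact: L1_indR.
  - by have [] := C1_ft x (C1_ind 1).
  rewrite mul0r subr0 -[indR 1 xi]subr0 -(indR0 xi) indR_itv//.
  have [/andP[xi0 xi1]|_] := boolP (0 <= xi < 1); last by rewrite mulr0 mul0r.
  rewrite mulr1 mul1r; have [->//|ne] := eqVneq (xi * x) 2^-1.
  apply: ltW; rewrite ltr_cos ?in_itv/=.
  - nra.
  - by have := @pi_ge2 R; nra.
  - by have := @pi_ge2 R; nra.
have p2 : 0 <= 2^-1 :> R by rewrite invr_ge0.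
have [h1 h2] := rint_itv p2.
apply: lt_le_trans (_ : (cos 2^-1) ^+ 2 * 2^-1 <= _); first by rewrite mulr_gt0 ?exprn_gt0 ?invr_gt0.
rewrite -[X in _ * X]subr0 -h2 -rintZ// /nrm nsqE; apply: le_rint => [||x].
- exact: L1Z.
- exact: L2_L1 (L2_eb 1).
have [hx|_] := boolP (0 <= x < 2^-1); last by rewrite mulr0 sqmod_ge0.
rewrite mulr1 /sqmod; have := low _ hx.
have := sqr_ge0 (complex.Im (eb 1 x)); nra.
Qed.

End FourierIntegral.

(** * Extension of an isometry given on a total family *)

Section IsometryExtension.
Variable R : realType.
Local Notation C := R[i].
Implicit Types (f g : R -> C) (l : seq (C * R)).

Definition comb (e : R -> R -> C) l x := \sum_(p <- l) p.1 * e p.2 x.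

Variables e e' : R -> R -> C.
Hypothesis Le : forall b, L2fun (e b).
Hypothesis Le' : forall b, L2fun (e' b).
Hypothesis gram : forall a b, ip (e a) (e b) = ip (e' a) (e' b).
Hypothesis total : forall f, L2fun f -> (forall b, ip f (e b) = 0) -> Defs.ae_eq f (fun=> 0).

Let L2_comb (u : R -> R -> C) : (forall b, L2fun (u b)) -> forall l, L2fun (comb u l).
Proof. by move=> Lu l; apply: L2_sum => p; exact: L2Z. Qed.

Let comb_cat u l l' : comb u (l ++ l') = fun x => comb u l x + comb u l' x.
Proof. by apply/funext => x; rewrite /comb big_cat. Qed.

Let comb_scale u z l : comb u [seq (z * p.1, p.2) | p <- l] = fun x => z * comb u l x.
Proof.
apply/funext => x; rewrite /comb big_map mulr_sumr.
by apply: eq_bigr => p _; rewrite mulrA.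
Qed.

Let combB u l l' : comb u (l ++ [seq (-1 * p.1, p.2) | p <- l']) = fun x => comb u l x - comb u l' x.
Proof. by rewrite comb_cat comb_scale; apply/funext => x; rewrite mulN1r. Qed.

Let ip_comb u l l' : (forall b, L2fun (u b)) ->
  ip (comb u l) (comb u l') = \sum_(p <- l) \sum_(q <- l') p.1 * (conjc q.1 * ip (u p.2) (u q.2)).
Proof.
move=> Lu; rewrite ip_suml; [|by move=> p; exact: L2Z|exact: L2_comb].
apply: eq_bigr => p _; rewrite ipZl//; last exact: L2_comb.
rewrite -mulr_sumr; congr (_ * _).
rewrite (ipJ (L2_comb Lu l') (Lu _)) ip_suml//; last by move=> q; exact: L2Z.
rewrite rmorph_sum; apply: eq_bigr => q _.
transitivity (conjc (ip (fun x => q.1 * u q.2 x) (u p.2))); first by [].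
rewrite (ipZl _ (Lu _) (Lu _)) conjM; congr (_ * _); exact/esym/ipJ.
Qed.

Let nsq_comb l : nsq (comb e l) = nsq (comb e' l).
Proof.
have : ip (comb e l) (comb e l) = ip (comb e' l) (comb e' l).
  rewrite !ip_comb//; apply: eq_bigr => p _; apply: eq_bigr => q _.
  by rewrite gram.
by rewrite !ip_self => -[].
Qed.

Let approx f eps : L2fun f -> 0 < eps -> exists l, l2 (fun x => comb e l x - f x) <= eps.
Proof.
move=> Lf eps0.
pose S := [set g | exists l, g = comb e l].
have sS : lin_subspace S.
  split.
  - by move=> g [l E]; rewrite E; exact: L2_comb.
  - by exists [::]; apply/funext => x; rewrite /comb big_nil.
  - by move=> g g' [l E] [l' E']; exists (l ++ l'); rewrite comb_cat E E'.
  - by move=> z g [l E]; exists [seq (z * p.1, p.2) | p <- l]; rewrite comb_scale E.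
have [p [s [Lp Ss hs orth]]] := projection sS Lf.
have fp : Defs.ae_eq (fun x => f x - p x) (fun=> 0).
  apply: total; first exact: L2B.
  move=> b; apply: orth; exists [:: (1, b)].
  by apply/funext => x; rewrite /comb big_cons big_nil addr0 mul1r.
move/cvgrPdist_lt : hs => /(_ _ eps0) [N _ /(_ N (leqnn N))] /=.
rewrite sub0r normrN ger0_norm ?l2_ge0// => /ltW h.
have [l E] := Ss N; exists l; rewrite -E; apply: le_trans h.
apply: le_of_eq; congr Num.sqrt.
have LsN : L2fun (s N) by rewrite E; exact: L2_comb.
apply: nsq_ae; [exact: L2B|exact: L2B|].
by apply: aeS fp => x /eqP; rewrite subr_eq0 => /eqP ->.
Qed.

(* The graph of the extension. *)
Let P f g := forall eps, 0 < eps -> exists l,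
  l2 (fun x => comb e l x - f x) <= eps /\ l2 (fun x => comb e' l x - g x) <= eps.

Let P_exists f : L2fun f -> exists2 g, L2fun g & P f g.
Proof.
move=> Lf.
(* As in [projection], the factor [1/4] keeps the squared increments of the approximating
   combinations below [8 ^ - n]. *)
pose d n : R := 4^-1 * (8^-1 ^+ n).
have d0 n : 0 < d n by rewrite mulr_gt0// ?exprn_gt0// invr_gt0.
have [l hl] : {l : nat -> seq (C * R) & forall n, nsq (fun x => comb e (l n) x - f x) <= d n}.
  suff h n : {l | nsq (fun x => comb e l x - f x) <= d n}.
    by exists (fun n => projT1 (h n)) => n; exact: (projT2 (h n)).
  apply: cid; have s0 : 0 < Num.sqrt (d n) by rewrite sqrtr_gt0.
  have [l hl] := approx Lf s0; exists l.
  rewrite -sqr_l2 -[d n]sqr_sqrtr; last exact: ltW.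
  by rewrite ler_pXn2r ?nnegrE ?l2_ge0 ?sqrtr_ge0.
have Lcf n : L2fun (fun x => comb e (l n) x - f x) by apply: L2B => //; exact: L2_comb.
have [||g Lg hg] := @L2_complete R (fun n => comb e' (l n)).
- by move=> n; exact: L2_comb.
- move=> n; rewrite -combB -nsq_comb combB.
  have -> : (fun x => comb e (l n.+1) x - comb e (l n) x) =
     fun x => (comb e (l n.+1) x - f x) - (comb e (l n) x - f x) by apply/funext => x; ring.
  have := parallelogram (Lcf n.+1) (Lcf n).
  have := nsq_ge0 (fun x => comb e (l n.+1) x - f x + (comb e (l n) x - f x)).
  have := hl n; have := hl n.+1; rewrite /d exprS.
  have : 0 < 8^-1 ^+ n :> R by rewrite exprn_gt0// invr_gt0.
  lra.
exists g => // eps eps0.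
have h2 : l2 (fun x => comb e (l n) x - f x) @[n --> \oo] --> 0.
  have h : Num.sqrt (d n) @[n --> \oo] --> 0.
    apply: cvg0_sqrt; apply: cvg0Z.
    by apply: cvg_expr; rewrite ger0_norm ?invr_ge0// invf_lt1// ltr1n.
  by apply: cvg0_le h => n; [exact: l2_ge0|rewrite ler_wsqrtr].
have := cvg0D h2 hg => /cvgrPdist_lt /(_ _ eps0) [N _ /(_ N (leqnn N))] /=.
rewrite sub0r normrN ger0_norm ?addr_ge0 ?l2_ge0// => h.
have := l2_ge0 (fun x => comb e (l N) x - f x).
have := l2_ge0 (fun x => comb e' (l N) x - g x).
by exists (l N); split; lra.
Qed.

Let P_l2 f g : L2fun f -> L2fun g -> P f g -> l2 g = l2 f.
Proof.
move=> Lf Lg Pfg.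
have tri (u v : R -> C) : L2fun u -> L2fun v -> `|l2 u - l2 v| <= l2 (fun x => u x - v x).
  move=> Lu Lv; have h1 := l2D Lv (L2B Lu Lv); have h2 := l2D Lu (L2B Lv Lu).
  rewrite (_ : (fun x => v x + (u x - v x)) = u) in h1; last by apply/funext => x; ring.
  rewrite (_ : (fun x => u x + (v x - u x)) = v) in h2; last by apply/funext => x; ring.
  rewrite (_ : l2 (fun x => v x - u x) = l2 (fun x => u x - v x)) in h2; last by rewrite /l2 nsq_distC.
  rewrite ler_norml; apply/andP; split; lra.
apply/eqP; rewrite -subr_eq0 -normr_eq0 eq_le normr_ge0 andbT.
apply/ler_addgt0Pl => eps eps0; rewrite addr0.
have e2 : 0 < eps / 2 by lra.
have [l [h1 h2]] := Pfg _ e2.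
have h3 := tri _ _ (L2_comb Le l) Lf; have h4 := tri _ _ (L2_comb Le' l) Lg.
have h5 : l2 (comb e l) = l2 (comb e' l) by rewrite /l2 nsq_comb.
move: h3 h4; rewrite h5 !ler_norml => /andP[a1 a2] /andP[a3 a4].
apply/andP; split; lra.
Qed.

Let P_lin a f f' g g' : L2fun f -> L2fun f' -> L2fun g -> L2fun g' -> P f g -> P f' g' ->
  P (fun x => a * f x + f' x) (fun x => a * g x + g' x).
Proof.
move=> Lf Lf' Lg Lg' h h' eps eps0.
have k0 : 0 < nc a + 1 by have := nc_ge0 a; lra.
have d0 : 0 < eps / (nc a + 1) by rewrite divr_gt0.
have [l [l1 l2']] := h _ d0; have [m [m1 m2]] := h' _ d0.
have aux (u : R -> R -> C) (v v' : R -> C) : (forall b, L2fun (u b)) -> L2fun v -> L2fun v' ->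
   l2 (fun x => comb u l x - v x) <= eps / (nc a + 1) ->
   l2 (fun x => comb u m x - v' x) <= eps / (nc a + 1) ->
   l2 (fun x => comb u ([seq (a * p.1, p.2) | p <- l] ++ m) x - (a * v x + v' x)) <= eps.
  move=> Lu Lv Lv' b1 b2; rewrite comb_cat comb_scale.
  have -> : (fun x => a * comb u l x + comb u m x - (a * v x + v' x)) =
     fun x => a * (comb u l x - v x) + (comb u m x - v' x) by apply/funext => x; ring.
  have L1' : L2fun (fun x => comb u l x - v x) by apply: L2B => //; exact: L2_comb.
  have L2' : L2fun (fun x => comb u m x - v' x) by apply: L2B => //; exact: L2_comb.
  apply: le_trans (l2D (L2Z a L1') L2') _; rewrite l2Z//.
  have -> : eps = nc a * (eps / (nc a + 1)) + eps / (nc a + 1).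
    by field; rewrite gt_eqF.
  by apply: lerD => //; rewrite ler_wpM2l ?nc_ge0.
by exists ([seq (a * p.1, p.2) | p <- l] ++ m); split; apply: aux.
Qed.

Let P_ae f f' g : L2fun f -> L2fun f' -> Defs.ae_eq f f' -> P f g -> P f' g.
Proof.
move=> Lf Lf' ff h eps /h [l [h1 h2]]; exists l; split => //.
apply: le_trans h1; apply: le_of_eq; congr Num.sqrt; apply: nsq_ae.
- by apply: L2B => //; exact: L2_comb.
- by apply: L2B => //; exact: L2_comb.
- by apply: aeS ff => x ->.
Qed.

Let P_uniq f g g' : L2fun f -> L2fun g -> L2fun g' -> P f g -> P f g' -> Defs.ae_eq g g'.
Proof.
move=> Lf Lg Lg' h h'.
have := P_lin (-1) Lf Lf Lg Lg' h h'.
set z := (fun x => -1 * g x + g' x).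
have -> : (fun x => -1 * f x + f x) = fun=> 0 by apply/funext => x; ring.
have Lz : L2fun z by apply: L2D => //; exact: L2Z.
move/(P_l2 (@L20 R) Lz) => z0.
have : nsq z = 0 by rewrite -sqr_l2 z0 l2_0 expr0n.
move/(nsq_eq0 Lz); apply: aeS => x /eqP; rewrite /z mulN1r addrC subr_eq0 => /eqP ->.
by [].
Qed.

(** Equal Gram matrices make [e b -> e' b] isometric on finite combinations, and totality of [e]
    makes these dense. Working with the closure [P] of the graph avoids choosing coefficients: a
    pair with first member 0 has a null second member, so [P] is the graph of a map modulo null
    sets. *)
Lemma isometry_extension : exists2 U, bounded_op U &
  (forall f, L2fun f -> nsq (U f) = nsq f) /\ (forall b, Defs.ae_eq (U (e b)) (e' b)).
Proof.
have ex f : {g | L2fun f -> L2fun g /\ P f g}.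
  apply: cid; have [Lf|nLf] := pselect (L2fun f); last by exists (fun=> 0).
  by have [g Lg Pg] := P_exists Lf; exists g.
pose U f := projT1 (ex f).
have hU f : L2fun f -> L2fun (U f) /\ P f (U f) by exact: (projT2 (ex f)).
exists U.
  apply: (@opI R U 1) => //.
  - by move=> f Lf; exact: (hU f Lf).1.
  - move=> f g Lf Lg fg; have [L1' P1] := hU f Lf; have [L2' P2] := hU g Lg.
    exact: P_uniq Lg L1' L2' (P_ae Lf Lg fg P1) P2.
  - move=> a f g Lf Lg; have [L1' P1] := hU f Lf; have [L2' P2] := hU g Lg.
    have La : L2fun (fun t => a * f t + g t) by apply: L2D => //; exact: L2Z.
    have [L3 P3] := hU _ La.
    apply: (P_uniq La L3 _ P3); first by apply: L2D => //; exact: L2Z.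
    exact: P_lin.
  - by move=> f Lf; have [L1' P1] := hU f Lf; rewrite mul1r (P_l2 Lf L1').
split.
  by move=> f Lf; have [L1' P1] := hU f Lf; rewrite -!sqr_l2 (P_l2 Lf L1').
move=> b; have [L1' P1] := hU _ (Le b).
apply: (P_uniq (Le b) L1' (Le' b) P1) => eps eps0.
have E (u : R -> R -> C) : comb u [:: (1, b)] = u b.
  by apply/funext => x; rewrite /comb big_cons big_nil addr0 mul1r.
by exists [:: (1, b)]; rewrite !E !l2_subrr; split; exact: ltW.
Qed.

End IsometryExtension.

(** * Bounded operators: multiplications and translations *)

Section Operators.
Variable R : realType.
Local Notation C := R[i].
Implicit Types (f g : R -> C) (T S : op R).

Lemma ae_refl f : Defs.ae_eq f f. Proof. exact: aeW. Qed.

Lemma ae_sym f g : Defs.ae_eq f g -> Defs.ae_eq g f.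
Proof. by apply: aeS => x ->. Qed.

Lemma ae_trans f g h : Defs.ae_eq f g -> Defs.ae_eq g h -> Defs.ae_eq f h.
Proof. by move=> fg gh; apply: aeS (aeI fg gh) => x [-> ->]. Qed.

Lemma bounded_id : bounded_op (@id (cfun R)).
Proof.
apply: (@opI R _ 1) => // [a f g Lf Lg|f Lf]; first exact: ae_refl.
by rewrite mul1r.
Qed.

Lemma bounded_comp T S : bounded_op T -> bounded_op S -> bounded_op (T \o S).
Proof.
move=> bT bS; have [k k0 hk] := op_bound bT; have [m m0 hm] := op_bound bS.
apply: (@opI R _ (k * m)); first exact: mulr_ge0.
- by move=> f Lf; exact: op_L2 bT (op_L2 bS Lf).
- by move=> f g Lf Lg fg; exact: (op_ae bT (op_L2 bS Lf) (op_L2 bS Lg) (op_ae bS Lf Lg fg)).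
- move=> a f g Lf Lg /=.
  have La : L2fun (fun t => a * f t + g t) by apply: L2D => //; exact: L2Z.
  apply: ae_trans (op_lin _ bT (op_L2 bS Lf) (op_L2 bS Lg)).
  apply: op_ae => //; [exact: op_L2| |exact: op_lin].
  by apply: L2D; [apply: L2Z|]; exact: op_L2.
- move=> f Lf /=; apply: le_trans (hk _ (op_L2 bS Lf)) _.
  by rewrite -mulrA ler_wpM2l// hm.
Qed.

(** Passing to adjoints replaces a density argument: the difference of the adjoints, applied to any
    [f], is orthogonal to the whole total family. *)
Lemma op_eq_total (e : R -> R -> C) T S : (forall b, L2fun (e b)) ->
  (forall f, L2fun f -> (forall b, ip f (e b) = 0) -> Defs.ae_eq f (fun=> 0)) ->
  bounded_op T -> bounded_op S -> (forall b, Defs.ae_eq (T (e b)) (S (e b))) -> op_eq T S.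
Proof.
move=> Le total bT bS h g Lg.
have [T' bT' hT'] := adjoint bT; have [S' bS' hS'] := adjoint bS.
apply: L2_ip_inj; [exact: op_L2|exact: op_L2|] => f Lf.
have LT' := op_L2 bT' Lf; have LS' := op_L2 bS' Lf.
have E : Defs.ae_eq (T' f) (S' f).
  have LB := L2B LT' LS'.
  have : Defs.ae_eq (fun x => T' f x - S' f x) (fun=> 0).
    apply: total => // b; rewrite (ipJ (Le b) LB) ipBr// -hT'// -hS'//.
    rewrite (ip_ae (op_L2 bT (Le b)) (op_L2 bS (Le b)) Lf Lf (h b) (ae_refl f)).
    by rewrite subrr conjc0.
  by apply: aeS => x /eqP; rewrite subr_eq0 => /eqP.
rewrite (ipJ (op_L2 bT Lg) Lf) (ipJ (op_L2 bS Lg) Lf) hT'// hS'//.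
congr conjc; exact: ip_ae (ae_refl g) E.
Qed.

Definition mulop (q : R -> C) : op R := fun f x => q x * f x.

Lemma bounded_mulop q k : cmeas q -> 0 <= k -> (forall x, nc (q x) <= k) -> bounded_op (mulop q).
Proof.
move=> mq k0 qk; have LM f : L2fun f -> L2fun (mulop q f) by exact: (L2_bounded mq qk).
apply: (@opI R _ k) => //.
- by move=> f g Lf Lg; apply: aeS => x E; rewrite /mulop E.
- by move=> a f g Lf Lg; apply: aeW => x; rewrite /mulop; ring.
- move=> f Lf; rewrite -[k]ger0_norm// -nc_real -l2Z//; apply: le_l2.
  apply: le_nsq; [exact: LM|exact: L2Z|] => x.
  by rewrite /mulop !ncM ler_wpM2r ?nc_ge0// nc_real ger0_norm.
Qed.

Lemma mulop_le q k f : cmeas q -> 0 <= k -> (forall x, nc (q x) <= k) -> L2fun f ->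
  l2 (mulop q f) <= k * l2 f.
Proof.
move=> mq k0 qk Lf; rewrite -[k]ger0_norm// -nc_real -l2Z//; apply: le_l2.
apply: le_nsq; [exact: (L2_bounded mq qk)|exact: L2Z|] => x.
by rewrite /mulop !ncM ler_wpM2r ?nc_ge0// nc_real ger0_norm.
Qed.

Lemma meas_mull (l : R) : measurable_fun setT (fun x : R => l * x).
Proof. exact: measurable_funM. Qed.

Lemma cmeas_expiM (l : R) : cmeas (fun x : R => expi (l * x)).
Proof. by apply: cmeas_expi; exact: meas_mull. Qed.

Lemma bounded_M l : bounded_op (@Mop R l).
Proof.
by apply: (@bounded_mulop _ 1 (cmeas_expiM l)) => // x; rewrite nc_expi.
Qed.

Lemma L2_D m f : L2fun f -> L2fun (Dop m f).
Proof.
move=> Lf; apply: L2I; last exact: (rint_shift (- m) (L2_L1 Lf)).1.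
apply: (cmeas_comp _ (L2_cmeas Lf)); exact: measurable_funD.
Qed.

Lemma ip_D m f g : L2fun f -> L2fun g -> ip (Dop m f) (Dop m g) = ip f g.
Proof. by move=> Lf Lg; rewrite !ipE -(cint_shift (- m) (L2M Lf Lg)).2. Qed.

Lemma nsq_D m f : L2fun f -> nsq (Dop m f) = nsq f.
Proof. by move=> Lf; have := ip_D m Lf Lf; rewrite !ip_self => -[]. Qed.

Lemma bounded_D m : bounded_op (@Dop R m).
Proof.
apply: (@opI R _ 1) => //.
- by move=> f; exact: L2_D.
(* Compatibility with almost everywhere equality is read off from invariance of the norm, applied to
   [f - g]. *)
- move=> f g Lf Lg fg; have LB := L2B Lf Lg.
  have : nsq (Dop m (fun x => f x - g x)) = 0.
    by rewrite nsq_D// (nsq_ae LB (@L20 R)) ?nsq0//; apply: aeS fg => x ->; rewrite subrr.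
  move/(nsq_eq0 (L2_D m LB)); apply: aeS => x /eqP.
  by rewrite /Dop subr_eq0 => /eqP.
- by move=> a f g Lf Lg; exact: ae_refl.
- by move=> f Lf; rewrite mul1r /l2 nsq_D.
Qed.

End Operators.

Section Unitary.
Variable R : realType.
Implicit Types (f g : R -> R[i]).
Variables W W' : op R.
Hypothesis uW : unitary W W'.

Lemma unitary_bounded : bounded_op W. Proof. by case: uW. Qed.
Lemma unitary_bounded' : bounded_op W'. Proof. by case: uW => _ []. Qed.
Lemma unitaryK f : L2fun f -> Defs.ae_eq (W' (W f)) f.
Proof. by case: uW => _ [_ [_ [h _]]]; exact: h. Qed.
Lemma unitaryK' f : L2fun f -> Defs.ae_eq (W (W' f)) f.
Proof. by case: uW => _ [_ [h _]]; exact: h. Qed.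
Lemma unitary_ip f g : L2fun f -> L2fun g -> ip (W f) (W g) = ip f g.
Proof. by case: uW => _ [_ [_ [_ h]]]; exact: h. Qed.

Let bW := unitary_bounded.
Let bW' := unitary_bounded'.

Lemma unitary_adj f g : L2fun f -> L2fun g -> ip (W f) g = ip f (W' g).
Proof.
move=> Lf Lg; have LW := op_L2 bW' Lg; rewrite -(unitary_ip Lf LW).
apply: ip_ae => //; [exact: op_L2|exact: op_L2|exact: op_L2|exact: ae_refl|].
by apply: ae_sym; exact: unitaryK'.
Qed.

Lemma unitary_sym : unitary W' W.
Proof.
split; first exact: bW'; split; first exact: bW.
split; first by move=> f; exact: unitaryK.
split; first by move=> f; exact: unitaryK'.
move=> f g Lf Lg; have Lf' := op_L2 bW' Lf; have Lg' := op_L2 bW' Lg.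
rewrite -unitary_adj//; apply: ip_ae => //; [exact: op_L2|exact: unitaryK'|exact: ae_refl].
Qed.

Lemma nsq_unitary f : L2fun f -> nsq (W f) = nsq f.
Proof. by move=> Lf; have := unitary_ip Lf Lf; rewrite !ip_self => -[]. Qed.

End Unitary.

(** * The unitary Fourier transform and its intertwining relations *)

Section Fourier.
Variable R : realType.
Local Notation C := R[i].
Implicit Types (f g : R -> C).

Lemma multiplication_formula f g : C1 f -> C1 g ->
  C1 (fun x => f x * ft g x) /\ cint (fun x => f x * ft g x) = cint (fun y => ft f y * g y).
Proof.
move=> Cf Cg; set k := rint (fun y => nc (g y)).
pose h (z : R * R) := (f z.1 * g z.2) * expi (z.2 * z.1).
have mh : cmeas h.
  apply: cmeasM; first apply: cmeasM.
  - exact: cmeas_fst (C1_meas Cf).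
  - exact: cmeas_snd (C1_meas Cg).
  - by apply: cmeas_expi; apply: measurable_funM; [exact: measurable_snd|exact: measurable_fst].
have E x : (fun y => h (x, y)) = fun y => f x * (g y * expi (y * x)).
  by apply/funext => y; rewrite /h /= mulrA.
have E' y : (fun x => h (x, y)) = fun x => g y * (f x * expi (x * y)).
  by apply/funext => x; rewrite /h /= [y * x]mulrC; ring.
have [|x|x|h1 h2 h3] := @cint_fubini R h (fun x => k * nc (f x)) mh.
- by apply: L1Z; exact: C1_nc.
- by rewrite E; apply: C1Z; exact: C1_ft.
- have -> : (fun y => nc (h (x, y))) = fun y => nc (f x) * nc (g y).
    by apply/funext => y; rewrite /h /= !ncM nc_expi mulr1.
  by rewrite rintZ; [rewrite mulrC|exact: C1_nc].
have F1 : (fun x => cint (fun y => h (x, y))) = fun x => f x * ft g x.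
  by apply/funext => x; rewrite E; exact: cintZ (C1_ft x Cg).
have F2 : (fun y => cint (fun x => h (x, y))) = fun y => ft f y * g y.
  by apply/funext => y; rewrite E' mulrC; exact: cintZ (C1_ft y Cf).
by rewrite F1 F2 in h1 h3.
Qed.

Definition ftm f (x : R) : C := cint (fun xi => f xi * expi (- (xi * x))).

Lemma ftmE f x : C1 f -> ftm f x = conjc (ft (fun y => conjc (f y)) x).
Proof.
move=> Cf; rewrite /ft -cintJ; last by apply: C1_ft; exact: C1J.
by congr cint; apply/funext => xi; rewrite conjM conjcK expiJ.
Qed.

Lemma ftm_ft f x : ftm f x = ft f (- x).
Proof. by congr cint; apply/funext => xi; rewrite mulrN. Qed.

Lemma ftm_meas f : C1 f -> cmeas (ftm f).
Proof.
move=> Cf; have -> : ftm f = fun x => ft f (- x) by apply/funext => x; exact: ftm_ft.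
by apply: (cmeas_comp _ (ft_meas Cf)); exact: measurable_funN.
Qed.

Definition nrmc : C := real_complex R (Num.sqrt (nrm R))^-1.

Lemma nrmc_sqr : sqmod nrmc * nrm R = 1.
Proof.
rewrite /sqmod /= expr0n addr0 exprVn sqr_sqrtr; last exact: ltW (nrm_gt0 R).
by rewrite mulVf// gt_eqF// nrm_gt0.
Qed.

Lemma conj_nrmc : conjc nrmc = nrmc. Proof. exact: conjc_real. Qed.

(** Both candidates [F] and [F'] come from [isometry_extension], with conjugate images of [ind b];
    the Gram matrices agree because they are real. The multiplication formula makes the two adjoint
    to each other on indicators, hence everywhere, and an isometry composed with its adjoint is the
    identity. Doing this for both orders gives unitarity without a separate proof of
    surjectivity. *)
Theorem fourier : exists F F' : op R, unitary F F' /\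
  forall f, L2fun f -> C1 f -> Defs.ae_eq (F f) (fun x => nrmc * ftm f x).
Proof.
pose ep b x := nrmc * eb b x; pose em b x := nrmc * conjc (eb b x).
have Lp b : L2fun (ep b) by apply: L2Z; exact: L2_eb.
have Lm b : L2fun (em b) by apply: L2Z; apply: L2J; exact: L2_eb.
have gramp a b : ip (ind a) (ind b) = ip (ep a) (ep b).
  rewrite ipZl//; last exact: L2_eb.
  rewrite ipZr; [|exact: L2_eb..].
  rewrite mulrA mulJ ip_eb ip_ind -rmorphM mulrA nrmc_sqr mul1r.
  by [].
have gramm a b : ip (ind a) (ind b) = ip (em a) (em b).
  rewrite gramp; have : ip (em a) (em b) = conjc (ip (ep a) (ep b)).
    rewrite !ipE -cintJ; last exact: L2M.
    by congr cint; apply/funext => x; rewrite /em /ep !conjM !conjcK conj_nrmc.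
  by move=> ->; rewrite -gramp ip_ind conjc_real.
have [F bF [isoF Fe]] := isometry_extension (@L2_ind R) Lm gramm (@ind_total R).
have [F' bF' [isoF' F'e]] := isometry_extension (@L2_ind R) Lp gramp (@ind_total R).
have Lind := @L2_ind R.
have adj0 a b : ip (F (ind a)) (ind b) = ip (ind a) (F' (ind b)).
  rewrite (ip_ae (op_L2 bF (Lind a)) (Lm a) (Lind b) (Lind b) (Fe a) (ae_refl _)).
  rewrite (ip_ae (Lind a) (Lind a) (op_L2 bF' (Lind b)) (Lp b) (ae_refl _) (F'e b)).
  have [Cm hm] := multiplication_formula (C1_ind a) (C1_ind b).
  rewrite (ipZl _ (L2J (L2_eb a)) (Lind b)) (ipZr _ (L2_eb b) (Lind a)) conj_nrmc; congr (_ * _).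
  rewrite !ipE.
  transitivity (conjc (cint (fun x => ft (ind a) x * ind b x))).
    rewrite -cintJ.
      by congr cint; apply/funext => x; rewrite conjM conj_ind.
    have := L2M (L2_eb a) (Lind b); by under eq_fun do rewrite conj_ind.
  rewrite -hm -cintJ//; congr cint; apply/funext => x.
  by rewrite conjM conj_ind.
have [G bG hG] := adjoint bF.
have GF' : op_eq G F'.
  apply: (op_eq_total Lind (@ind_total R) bG bF') => b.
  have LG := op_L2 bG (Lind b); have LF := op_L2 bF' (Lind b).
  have : Defs.ae_eq (fun x => G (ind b) x - F' (ind b) x) (fun=> 0).
    apply: ind_total => [|a]; first exact: L2B.
    rewrite (ipJ (Lind a)); last exact: L2B.
    by rewrite ipBr// -hG// adj0 subrr conjc0.
  by apply: aeS => x /eqP; rewrite subr_eq0 => /eqP.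
have adj f g : L2fun f -> L2fun g -> ip (F f) g = ip f (F' g).
  move=> Lf Lg; rewrite hG//; apply: ip_ae => //; [exact: op_L2|exact: op_L2|exact: ae_refl|].
  exact: GF'.
have adj' f g : L2fun f -> L2fun g -> ip (F' f) g = ip f (F g).
  move=> Lf Lg; rewrite (ipJ Lg (op_L2 bF' Lf)) -adj// -ipJ//.
  exact: op_L2.
have F'F : op_eq (F' \o F) id.
  apply: (op_eq_total Lind (@ind_total R)) => [||b]; [exact: bounded_comp|exact: bounded_id|].
  have L1' := op_L2 bF (Lind b); have L2' := op_L2 bF' L1'.
  have : Defs.ae_eq (fun x => F' (F (ind b)) x - ind b x) (fun=> 0).
    apply: ind_total => [|a]; first exact: L2B.
    rewrite ipBl// adj'// gramm.
    by rewrite (ip_ae L1' (Lm b) (op_L2 bF (Lind a)) (Lm a) (Fe b) (Fe a)) subrr.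
  by apply: aeS => x /eqP; rewrite subr_eq0 => /eqP.
have FF' : op_eq (F \o F') id.
  apply: (op_eq_total Lind (@ind_total R)) => [||b]; [exact: bounded_comp|exact: bounded_id|].
  have L1' := op_L2 bF' (Lind b); have L2' := op_L2 bF L1'.
  have : Defs.ae_eq (fun x => F (F' (ind b)) x - ind b x) (fun=> 0).
    apply: ind_total => [|a]; first exact: L2B.
    rewrite ipBl// adj// gramp.
    by rewrite (ip_ae L1' (Lp b) (op_L2 bF' (Lind a)) (Lp a) (F'e b) (F'e a)) subrr.
  by apply: aeS => x /eqP; rewrite subr_eq0 => /eqP.
exists F, F'; split.
  split => //; split => //; split => //; split => // f g Lf Lg.
  rewrite adj//; last exact: op_L2.
  apply: ip_ae => //; [|exact: ae_refl|exact: F'F].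
  by apply: op_L2 => //; exact: op_L2.
(* The integral formula is tested against [ind b]: adjointness moves the transform to [F' (ind b)],
   which is explicit, and the multiplication formula moves it back as an integral. *)
move=> f Lf Cf; have LF := op_L2 bF Lf.
have mft : cmeas (fun x => nrmc * ftm f x).
  by apply: cmeasZ; exact: ftm_meas.
have CF b : C1 (fun x => F f x * ind b x).
  by have := L2M LF (Lind b); under eq_fun do rewrite conj_ind.
have C2h2 b := multiplication_formula (C1J Cf) (C1_ind b).
have Cft b : C1 (fun x => ftm f x * ind b x).
  have := C1_ind b => Ci; apply: (le_C1 _ (L1Z (rint (fun x => nc (f x))) (C1_nc Ci))).
    by apply: cmeasM; [exact: ftm_meas|exact: cmeas_ind].
  by move=> x; rewrite ncM ler_wpM2r ?nc_ge0// ftm_ft ft_le.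
have : Defs.ae_eq (fun x => F f x - nrmc * ftm f x) (fun=> 0).
  apply: cae_eq0_of_ind => b.
    have := C1B (CF b) (C1Z nrmc (Cft b)); congr C1; apply/funext => x; ring.
  transitivity (cint (fun x => F f x * ind b x) - nrmc * cint (fun x => ftm f x * ind b x)).
    rewrite -cintZ// -cintB//; last exact: C1Z.
    congr cint; apply/funext => x; ring.
  have -> : cint (fun x => F f x * ind b x) = ip (F f) (ind b).
    by rewrite ipE; congr cint; apply/funext => x; rewrite conj_ind.
  rewrite adj// (ip_ae Lf Lf (op_L2 bF' (Lind b)) (Lp b) (ae_refl _) (F'e b)).
  rewrite (ipZr _ (L2_eb b) Lf) conj_nrmc -mulrBr.
  suff -> : ip f (eb b) = cint (fun x => ftm f x * ind b x) by rewrite subrr mulr0.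
  transitivity (conjc (cint (fun x => conjc (f x) * ft (ind b) x))).
    rewrite -cintJ//; last by case: (C2h2 b).
    by rewrite ipE; congr cint; apply/funext => x; rewrite conjM conjcK.
  rewrite (C2h2 b).2 -cintJ.
    by congr cint; apply/funext => x; rewrite conjM conj_ind ftmE.
  have := C1J (Cft b); under eq_fun do rewrite conjM conj_ind ftmE// conjcK.
  by [].
by apply: aeS => x /eqP; rewrite subr_eq0 => /eqP.
Qed.

(** On indicators [F] is an honest integral, where both relations are a change of exponent or of
    variable; totality of the indicators does the rest. *)
Lemma fourier_MD (F F' : op R) : unitary F F' ->
  (forall f, L2fun f -> C1 f -> Defs.ae_eq (F f) (fun x => nrmc * ftm f x)) ->
  (forall l, op_eq (F \o Mop l) (Dop l \o F)) /\ (forall m, op_eq (F \o Dop m) (Mop (- m) \o F)).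
Proof.
move=> [bF _] Ff.
have Lind := @L2_ind R.
split=> [l|m]; apply: (op_eq_total Lind (@ind_total R)).
- exact: bounded_comp bF (bounded_M l).
- exact: bounded_comp (bounded_D l) bF.
- move=> b /=.
  have LM := op_L2 (bounded_M l) (Lind b).
  have CM : C1 (Mop l (ind b)).
    have := C1_expi (meas_mull l) (C1_ind b); congr C1; apply/funext => x; exact: mulrC.
  have Lh : L2fun (fun x => nrmc * ftm (ind b) x).
    by apply: L2_ae (Ff _ (Lind b) (C1_ind b)); [exact: op_L2|apply: cmeasZ; exact: ftm_meas (C1_ind b)].
  apply: ae_trans (Ff _ LM CM) _; apply: ae_sym.
  apply: ae_trans (op_ae (bounded_D l) (op_L2 bF (Lind b)) Lh (Ff _ (Lind b) (C1_ind b))) _.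
  apply: aeW => x; rewrite /Dop; congr (_ * _); congr cint; apply/funext => xi.
  rewrite /Mop [RHS]mulrAC -expiD [RHS]mulrC; congr (_ * expi _); ring.
- exact: bounded_comp bF (bounded_D m).
- exact: bounded_comp (bounded_M (- m)) bF.
- move=> b /=.
  have LD := L2_D m (Lind b).
  have CD : C1 (Dop m (ind b)) by exact: (cint_shift (- m) (C1_ind b)).1.
  have Lh : L2fun (fun x => nrmc * ftm (ind b) x).
    by apply: L2_ae (Ff _ (Lind b) (C1_ind b)); [exact: op_L2|apply: cmeasZ; exact: ftm_meas (C1_ind b)].
  apply: ae_trans (Ff _ LD CD) _; apply: ae_sym.
  apply: ae_trans (op_ae (bounded_M (- m)) (op_L2 bF (Lind b)) Lh (Ff _ (Lind b) (C1_ind b))) _.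
  apply: aeW => x; rewrite /Mop mulrCA; congr (_ * _).
  have Ce : C1 (fun xi => ind b xi * expi (- (xi * x))).
    by apply: C1_expi (C1_ind b); apply: measurable_funN; exact: meas_mulr.
  have [Cs hs] := cint_shift (- m) Ce.
  rewrite /ftm -hs -cintZ//; congr cint; apply/funext => xi.
  rewrite mulrCA -expiD /Dop; congr (_ * expi _); ring.
Qed.

End Fourier.

(** * Weak-star closed subspaces *)

(** The bare set [U] is first identified with the row space of a matrix [M] of maximal rank whose
    rows span a subspace of [U]. The columns of [cokermx M] are then finitely many functionals that
    cut out [U]. *)
Lemma subspace_separation (K : fieldType) (k : nat) (U : set 'rV[K]_k) (t : 'rV[K]_k) :
  U 0 -> (forall u v, U u -> U v -> U (u + v)) -> (forall a u, U u -> U (a *: u)) ->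
  (forall a : 'cV[K]_k, (forall u, U u -> u *m a = 0) -> t *m a = 0) -> U t.
Proof.
move=> U0 UD UZ h.
pose P r := `[< exists M : 'M[K]_k, (forall w : 'rV_k, (w <= M)%MS -> U w) /\ \rank M = r >].
have exP : exists r, P r.
  exists 0%N; apply/asboolP; exists 0; rewrite mxrank0; split => // w.
  by rewrite submx0 => /eqP ->.
have bP r : P r -> (r <= k)%N by move=> /asboolP[M [_ <-]]; exact: rank_leq_row.
have := ex_maxnP exP bP; case: ex_maxnP => r /asboolP[M [MU rM]] maxr _.
have UM u : U u -> (u <= M)%MS.
  move=> Uu; pose M' := (u + M)%MS.
  have M'U (w : 'rV_k) : (w <= M')%MS -> U w.
    move=> /sub_addsmxP[[c1 c2] ->] /=; apply: UD; last by apply: MU; exact: submxMl.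
    have -> : c1 *m u = c1 0 0 *: u by rewrite [c1]mx11_scalar mul_scalar_mx !mxE eqxx mulr1n.
    exact: UZ.
  have : P (\rank M') by apply/asboolP; exists M'.
  move/maxr => le; have sM : (M <= M')%MS by exact: addsmxSr.
  have /eqmxP/eqmx_sym e : (M == M')%MS.
    by rewrite -(mxrank_leqif_eq sM); rewrite eqn_leq mxrankS// rM.
  by rewrite -e addsmxSl.
have : t *m cokermx M = 0.
  apply/matrixP => i j; rewrite [RHS]mxE.
  have : t *m (cokermx M *m delta_mx j (0 : 'I_1)) = 0.
    by apply: h => u /UM; rewrite submxE => /eqP e; rewrite mulmxA e mul0mx.
  by rewrite mulmxA -colE => /matrixP/(_ i 0); rewrite [LHS]mxE [RHS]mxE.
by move/eqP; rewrite -submxE => /MU.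
Qed.

(** * Absolutely convergent complex series *)

Section Summation.
Variable R : realType.
Local Notation C := R[i].
Implicit Types (a : nat -> R) (u v : nat -> C).

Lemma cvg_seriesZ k a : cvgn (series a) -> cvgn (series (fun n => k * a n)).
Proof. by move=> ca; apply: is_cvg_seriesZ. Qed.

Lemma rsum_ge a n : (forall i, 0 <= a i) -> cvgn (series a) -> series a n <= rsum a.
Proof.
move=> a0 ca; apply: nondecreasing_cvgn_le => //.
by apply/nondecreasing_seqP => m; rewrite /series /= big_nat_recr//= lerDl.
Qed.

Definition cpart u n := \sum_(0 <= i < n) u i.

Lemma csum_cvg u a : (forall i, nc (u i) <= a i) -> cvgn (series a) ->
  ccvg (cpart u) (csum u).
Proof.
move=> ua ca.
have aux (w : nat -> R) : (forall i, `|w i| <= a i) -> series w n @[n --> \oo] --> rsum w.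
  move=> wa; have : cvgn (series w).
    apply: normed_cvg; apply: (@series_le_cvg R (fun i => `|w i|) a) => // i.
    exact: le_trans (normr_ge0 _) (wa i).
  by [].
have Re_part n : complex.Re (cpart u n) = series (fun i => complex.Re (u i)) n.
  by rewrite /cpart /series /=; elim/big_rec2: _ => // i y1 y2 _ <-; rewrite cReD.
have Im_part n : complex.Im (cpart u n) = series (fun i => complex.Im (u i)) n.
  by rewrite /cpart /series /=; elim/big_rec2: _ => // i y1 y2 _ <-; rewrite cImD.
apply: ccvgE => /=.
  under eq_fun do rewrite Re_part; apply: aux => i; exact: le_trans (Re_nc _) (ua i).
under eq_fun do rewrite Im_part; apply: aux => i; exact: le_trans (Im_nc _) (ua i).
Qed.

Lemma cpart_le u a n : (forall i, nc (u i) <= a i) -> nc (cpart u n) <= series a n.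
Proof.
move=> ua; rewrite /cpart /series /=; elim: n => [|n IH]; first by rewrite !big_geq// nc0.
rewrite !big_nat_recr//=; apply: le_trans (ncD _ _) _; exact: lerD.
Qed.

Lemma csumD u v a b : (forall i, nc (u i) <= a i) -> (forall i, nc (v i) <= b i) ->
  cvgn (series a) -> cvgn (series b) -> csum (fun n => u n + v n) = csum u + csum v.
Proof.
move=> ua vb ca cb.
have h : ccvg (cpart (fun n => u n + v n)) (csum u + csum v).
  rewrite (_ : cpart _ = fun n => cpart u n + cpart v n); first exact: ccvgD (csum_cvg ua ca) (csum_cvg vb cb).
  by apply/funext => n; rewrite /cpart big_split.
apply: ccvg_unique h; apply: (csum_cvg (a := fun n => a n + b n)).
  by move=> i; apply: le_trans (ncD _ _) _; exact: lerD.
by have := is_cvg_seriesD ca cb.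
Qed.

Lemma csumZ z u a : (forall i, nc (u i) <= a i) -> cvgn (series a) ->
  csum (fun n => z * u n) = z * csum u.
Proof.
move=> ua ca.
have h : ccvg (cpart (fun n => z * u n)) (z * csum u).
  rewrite (_ : cpart _ = fun n => z * cpart u n); first exact: ccvgZ (csum_cvg ua ca).
  by apply/funext => n; rewrite /cpart mulr_sumr.
apply: ccvg_unique h; apply: (csum_cvg (a := fun n => nc z * a n)).
  by move=> i; rewrite ncM ler_wpM2l ?nc_ge0.
exact: cvg_seriesZ.
Qed.

(** Tannery's theorem: beyond some [N] both tails are controlled by the tail of [a], uniformly in
    [m], while finitely many terms converge. *)
Lemma csum_dct (u : nat -> nat -> C) v a : (forall m i, nc (u m i) <= a i) ->
  cvgn (series a) -> (forall i, ccvg (u ^~ i) (v i)) -> ccvg (fun m => csum (u m)) (csum v).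
Proof.
move=> ua ca uv.
have va i : nc (v i) <= a i by apply: ccvg_nc_le (uv i) _.
have a0 i : 0 <= a i by exact: le_trans (nc_ge0 _) (va i).
apply/cvgrPdist_lt => e e0.
have e4 : 0 < e / 4 by lra.
have /cvgrPdist_lt /(_ _ e4) [N _ /(_ N (leqnn N)) /=] : series a n @[n --> \oo] --> rsum a by [].
rewrite ger0_norm ?subr_ge0 ?rsum_ge// => hN.
have tail (w : nat -> C) : (forall i, nc (w i) <= a i) ->
    nc (csum w - cpart w N) <= rsum a - series a N.
  move=> wa; apply: (@ccvg_nc_le R (fun M => cpart w (N + M)%N - cpart w N)).
    apply: ccvgD; last exact: ccvg_cst.
    have := csum_cvg wa ca; rewrite /ccvg => h.
    apply/cvgrPdist_lt => d d0; move/cvgrPdist_lt : h => /(_ _ d0) [M _ hM].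
    by exists M => //= m /= Mm; apply: hM => /=; exact: leq_trans Mm (leq_addl _ _).
  move=> M; have -> : cpart w (N + M)%N - cpart w N = cpart (fun i => w (N + i)%N) M.
    rewrite /cpart (big_cat_nat (leq0n N) (leq_addr M N))/= addrAC subrr add0r.
    by rewrite -{1}[N]add0n big_addn addnC addnK; apply: eq_bigr => i _; rewrite addnC.
  apply: le_trans (cpart_le M (a := fun i => a (N + i)%N) _) _ => //.
  rewrite lerBrDl; apply: le_trans (rsum_ge (N + M)%N a0 ca).
  rewrite /series /= (big_cat_nat (leq0n N) (leq_addr M N))/= lerD2l.
  by rewrite -{2}[N]add0n big_addn addnC addnK; apply: ler_sum => i _; rewrite addnC.
have : ccvg (fun m => cpart (u m) N) (cpart v N).
  by apply: ccvg_sum.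
rewrite /ccvg => /cvgrPdist_lt /(_ _ e4) [M _ hM].
exists M => //= m Mm; have := hM m Mm => /=.
rewrite !sub0r !normrN !ger0_norm ?nc_ge0// => h1.
have -> : csum (u m) - csum v = (csum (u m) - cpart (u m) N) +
   ((cpart (u m) N - cpart v N) + (cpart v N - csum v)) by ring.
apply: le_lt_trans (ncD _ _) _.
have := ncD (cpart (u m) N - cpart v N) (cpart v N - csum v).
have := tail _ (ua m); have := tail _ va; rewrite [nc (csum v - _)]nc_distC.
lra.
Qed.

Lemma csum_cint (f : nat -> R -> C) (rho : R -> R) a : L1 rho -> (forall s, 0 <= rho s) ->
  (forall n, cmeas (f n)) -> (forall n s, nc (f n s) <= rho s * a n) ->
  (forall n, 0 <= a n) -> cvgn (series a) ->
  C1 (fun s => csum (f ^~ s)) /\ cint (fun s => csum (f ^~ s)) = csum (fun n => cint (f n)).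
Proof.
move=> Lrho rho0 mf fa a0 ca.
have cas s : cvgn (series (fun n => rho s * a n)) by exact: cvg_seriesZ.
have Cf n : C1 (f n).
  by apply: (le_C1 (mf n) (L1Z (a n) Lrho)) => s; rewrite mulrC.
have [|||h1 h2] := @cint_dct R (fun N s => cpart (f ^~ s) N) (fun s => csum (f ^~ s))
   (fun s => rsum a * rho s) _ (L1Z _ Lrho).
- by move=> N; rewrite /cpart; exact: cmeas_sum.
- move=> N s; apply: le_trans (cpart_le N (fa ^~ s)) _.
  rewrite /series /= -mulr_sumr mulrC ler_wpM2r//.
  exact: (rsum_ge N a0 ca).
- by move=> s; exact: (csum_cvg (fa ^~ s) (cas s)).
split => //; apply: (ccvg_unique h2).
have -> : (fun n => cint (fun s => cpart (f ^~ s) n)) = cpart (fun n => cint (f n)).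
  by apply/funext => N; rewrite /cpart cint_sum.
apply: (csum_cvg (a := fun n => rint rho * a n)); last exact: cvg_seriesZ.
move=> n; rewrite mulrC -rintZ//; apply: cint_le => //; first exact: L1Z.
by move=> s; rewrite mulrC.
Qed.

End Summation.

(** * Normal functionals and weak-star closed subspaces *)

Section WeakClosure.
Variable R : realType.
Local Notation C := R[i].
Implicit Types (f g : R -> C) (T S : op R) (V : set (op R)).

Definition weight (x y : nat -> R -> C) n : R := l2 (x n) * l2 (y n).

Lemma weight_ge0 x y n : 0 <= weight x y n. Proof. by rewrite mulr_ge0 ?l2_ge0. Qed.

Lemma weight_cvg x y : normal_data x y -> cvgn (series (weight x y)).
Proof.
move=> [_ [_ [cx cy]]].
apply: (@series_le_cvg R _ (fun n => nsq (x n) + nsq (y n))).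
- by move=> n; exact: weight_ge0.
- by move=> n; rewrite addr_ge0 ?nsq_ge0.
- move=> n; rewrite /weight -!sqr_l2.
  have := sqr_ge0 (l2 (x n) - l2 (y n)); have := mulr_ge0 (l2_ge0 (x n)) (l2_ge0 (y n)); nra.
- by have := is_cvg_seriesD cx cy.
Qed.

Definition dominated k T := forall f g, L2fun f -> L2fun g -> nc (ip (T f) g) <= k * (l2 f * l2 g).

Lemma bounded_dominated T : bounded_op T -> exists k, dominated k T.
Proof.
move=> bT; have [k k0 hk] := op_bound bT; exists k => f g Lf Lg.
apply: le_trans (ip_le (op_L2 bT Lf) Lg) _; rewrite mulrA ler_wpM2r ?l2_ge0//.
exact: hk.
Qed.

Lemma normal_le x y T k : normal_data x y -> dominated k T ->
  forall n, nc (ip (T (x n)) (y n)) <= k * weight x y n.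
Proof. by move=> [Lx [Ly _]] dT n; exact: dT. Qed.

Lemma omegaD x y T S : normal_data x y -> bounded_op T -> bounded_op S ->
  omega x y (op_add T S) = omega x y T + omega x y S.
Proof.
move=> nd bT bS; have [k dT] := bounded_dominated bT; have [m dS] := bounded_dominated bS.
have cw := weight_cvg nd.
rewrite /omega -(csumD (normal_le nd dT) (normal_le nd dS)); [|exact: cvg_seriesZ..].
have [Lx [Ly _]] := nd.
by congr csum; apply/funext => n; rewrite ipDl//; exact: op_L2.
Qed.

Lemma omegaZ x y a T : normal_data x y -> bounded_op T ->
  omega x y (op_scale a T) = a * omega x y T.
Proof.
move=> nd bT; have [k dT] := bounded_dominated bT.
rewrite /omega -(csumZ a (normal_le nd dT)); last exact/cvg_seriesZ/weight_cvg.
have [Lx [Ly _]] := nd.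
by congr csum; apply/funext => n; rewrite ipZl//; exact: op_L2.
Qed.

Lemma omega_sub x y T S : normal_data x y -> bounded_op T -> bounded_op S ->
  omega x y (op_sub T S) = omega x y T - omega x y S.
Proof.
move=> nd bT bS; have [k dT] := bounded_dominated bT; have [m dS] := bounded_dominated bS.
have cw := weight_cvg nd; have [Lx [Ly _]] := nd.
rewrite -mulN1r -(omegaZ _ nd bS) /omega.
have [m' dS'] : exists m', dominated m' (op_scale (-1) S).
  exists m => f g Lf Lg; rewrite ipZl//; last exact: op_L2.
  by rewrite mulN1r ncN; exact: dS.
rewrite -(csumD (normal_le nd dT) (normal_le nd dS')); [|exact: cvg_seriesZ..].
congr csum; apply/funext => n.
by rewrite ipBl ?ipZl ?mulN1r//; exact: op_L2.
Qed.

Lemma omega0 x y : omega x y (@op_zero R) = 0.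
Proof.
rewrite /omega (_ : (fun n => _) = fun=> 0); last by apply/funext => n; exact: ip0l.
have e : rsum (fun=> 0 : R) = 0.
  by rewrite /rsum /series /=; under eq_fun do rewrite big1//; exact: lim_cst.
by apply: complex_eq; rewrite /= e.
Qed.

(* A finite dimensional separation argument replaces Hahn-Banach. *)
Lemma wstar_separation V T : op_subspace V -> wstar_closed V -> bounded_op T ->
  (forall k (x y : 'I_k -> nat -> R -> C) (a : 'I_k -> C),
    (forall i, normal_data (x i) (y i)) ->
    (forall S, V S -> \sum_i omega (x i) (y i) S * a i = 0) ->
    \sum_i omega (x i) (y i) T * a i = 0) -> V T.
Proof.
move=> [Vb [V0 [VD VZ]]] hc bT h; apply: hc; split => // k x y nd eps eps0.
pose U := [set w : 'rV[C]_k | exists2 X, V X & forall i, w 0 i = omega (x i) (y i) X].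
have : U (\row_i omega (x i) (y i) T).
  apply: subspace_separation.
  - by exists (@op_zero R) => // i; rewrite mxE omega0.
  - move=> u v [X VX hX] [Y VY hY]; exists (op_add X Y); first exact: VD.
    by move=> i; rewrite mxE hX hY omegaD//; exact: Vb.
  - move=> a u [X VX hX]; exists (op_scale a X); first exact: VZ.
    by move=> i; rewrite mxE hX omegaZ//; exact: Vb.
  - move=> a ha; apply/matrixP => i j; rewrite !mxE !ord1.
    transitivity (\sum_i omega (x i) (y i) T * a i 0).
      by apply: eq_bigr => l _; rewrite mxE.
    apply: h => // S VS.
    have /ha /matrixP /(_ 0 0) : U (\row_i omega (x i) (y i) S).
      by exists S => // l; rewrite mxE.
    move=> e; transitivity ((\row_i omega (x i) (y i) S *m a) 0 0); last by rewrite e mxE.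
    by rewrite mxE; apply: eq_bigr => l _; rewrite mxE.
(* Subspaces of a finite dimensional space are closed, so the approximation is exact: [X] has the
   same values as [T] under all [k] functionals. *)
move=> [X VX hX]; exists X => // i.
have := hX i; rewrite mxE (omega_sub (nd i) bT (Vb _ VX)) => ->.
by rewrite subrr sqmod0 exprn_gt0.
Qed.

(** The product bound [rho s * weight n] allows a normal functional to be exchanged with the
    integral, so a combination of normal functionals that annihilates every [Ts s] annihilates
    [T]. *)
Lemma wstar_weak_integral V T (Ts : R -> op R) (rho : R -> R) : op_subspace V -> wstar_closed V ->
  bounded_op T -> L1 rho -> (forall s, 0 <= rho s) -> (forall s, V (Ts s)) ->
  (forall s, dominated (rho s) (Ts s)) ->
  (forall f g, L2fun f -> L2fun g -> cmeas (fun s => ip (Ts s f) g)) ->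
  (forall f g, L2fun f -> L2fun g -> ip (T f) g = cint (fun s => ip (Ts s f) g)) -> V T.
Proof.
move=> sV hc bT Lrho rho0 VTs dTs mTs hT; apply: wstar_separation => // k x y a nd h.
have om i : C1 (fun s => omega (x i) (y i) (Ts s)) /\
    cint (fun s => omega (x i) (y i) (Ts s)) = omega (x i) (y i) T.
  have [Lx [Ly _]] := nd i.
  have [||||h1 h2] := @csum_cint R (fun n s => ip (Ts s (x i n)) (y i n)) rho
     (weight (x i) (y i)) Lrho rho0.
  - by move=> n; exact: mTs.
  - by move=> n s; exact: dTs.
  - exact: weight_ge0.
  - exact: weight_cvg.
  split => //; rewrite [LHS]h2 /omega; congr csum; apply/funext => n.
  by rewrite -hT.
transitivity (cint (fun s => \sum_i omega (x i) (y i) (Ts s) * a i)).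
  rewrite cint_sum; last first.
    by move=> i; have := C1Z (a i) (om i).1; under eq_fun do rewrite mulrC.
  apply: eq_bigr => i _; rewrite -(om i).2 mulrC -cintZ; last by case: (om i).
  by congr cint; apply/funext => s; rewrite mulrC.
rewrite (_ : (fun s => _) = fun=> 0) ?cint0//.
by apply/funext => s; apply: h.
Qed.

(** The common bound [k] upgrades weak operator convergence to convergence under each normal
    functional, by dominated convergence of the defining series. *)
Lemma wstar_weak_limit V T (Tn : nat -> op R) k : op_subspace V -> wstar_closed V ->
  bounded_op T -> (forall n, V (Tn n)) -> (forall n, dominated k (Tn n)) ->
  (forall f g, L2fun f -> L2fun g -> ccvg (fun n => ip (Tn n f) g) (ip (T f) g)) -> V T.
Proof.
move=> sV hc bT VTn dTn hT; apply: wstar_separation => // m x y a nd h.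
have om i : ccvg (fun n => omega (x i) (y i) (Tn n)) (omega (x i) (y i) T).
  have [Lx [Ly _]] := nd i.
  apply: (@csum_dct R _ _ (fun n => k * weight (x i) (y i) n)).
  - by move=> n j; exact: dTn.
  - exact/cvg_seriesZ/weight_cvg.
  - by move=> j; exact: hT.
have hs : ccvg (fun n => \sum_i omega (x i) (y i) (Tn n) * a i) (\sum_i omega (x i) (y i) T * a i).
  apply: ccvg_sum => i; have := ccvgZ (a i) (om i).
  by under eq_fun do rewrite mulrC; rewrite mulrC.
apply: (ccvg_unique hs).
rewrite (_ : (fun n => _) = fun=> 0); last by apply/funext => n; exact: h.
exact: ccvg_cst.
Qed.

(** A constant sequence converges weakly to every bounded operator that agrees with it modulo null
    sets. This makes membership in [V] insensitive to the choice of representatives. *)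
Lemma wstar_op_eq V T S : op_subspace V -> wstar_closed V -> bounded_op T -> V S -> op_eq S T -> V T.
Proof.
move=> sV hc bT VS ST; have bS : bounded_op S by case: sV => h _; exact: h.
have [k dS] := bounded_dominated bS.
apply: (@wstar_weak_limit V T (fun=> S) k) => // f g Lf Lg.
rewrite (ip_ae (op_L2 bS Lf) (op_L2 bT Lf) Lg Lg (ST f Lf) (ae_refl _)).
exact: ccvg_cst.
Qed.

End WeakClosure.

Section L2Convergence.
Variable R : realType.
Local Notation C := R[i].
Implicit Types (f g p q : R -> C).

Lemma op_cvg (T : op R) (u : nat -> R -> C) f : bounded_op T -> (forall n, L2fun (u n)) -> L2fun f ->
  l2 (fun x => u n x - f x) @[n --> \oo] --> 0 ->
  l2 (fun x => T (u n) x - T f x) @[n --> \oo] --> 0.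
Proof.
move=> bT Lu Lf uf; have [k k0 hk] := op_bound bT.
have LTu n := op_L2 bT (Lu n); have LTf := op_L2 bT Lf.
apply: cvg0_le (cvg0Z k uf) => n; first exact: l2_ge0.
have LD := L2B (Lu n) Lf; apply: le_trans (hk _ LD); apply: le_of_eq.
rewrite /l2; congr Num.sqrt; apply: nsq_ae; [exact: L2B|exact: op_L2|].
have E : (fun x => u n x - f x) = (fun x => -1 * f x + u n x).
  by apply/funext => x; rewrite mulN1r addrC.
rewrite E; apply: ae_sym; apply: aeS (op_lin (-1) bT Lf (Lu n)) => x ->.
by rewrite mulN1r addrC.
Qed.

Lemma mulop_cvg (q u : nat -> R -> C) p f : (forall n, cmeas (q n)) -> (forall n x, nc (q n x) <= 1) ->
  (forall x, ccvg (q ^~ x) (p x)) -> (forall n, L2fun (u n)) -> L2fun f ->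
  l2 (fun x => u n x - f x) @[n --> \oo] --> 0 ->
  l2 (fun x => mulop (q n) (u n) x - mulop p f x) @[n --> \oo] --> 0.
Proof.
move=> mq q1 qc Lu Lf uf.
have mp : cmeas p by exact: cmeas_cvg mq qc.
have p1 x : nc (p x) <= 1 by exact: ccvg_nc_le (qc x) _.
have Lpf : L2fun (mulop p f) := L2_bounded mp p1 Lf.
have Lqf n : L2fun (mulop (q n) f) := L2_bounded (mq n) (q1 n) Lf.
have Lqu n : L2fun (mulop (q n) (fun x => u n x - f x)).
  exact: L2_bounded (mq n) (q1 n) (L2B (Lu n) Lf).
have qf : l2 (fun x => mulop (q n) f x - mulop p f x) @[n --> \oo] --> 0.
  apply: (nsq_cvg0 (G := fun y => 4 * sqmod (f y))).
  - by move=> n; apply: L2_cmeas; exact: L2B.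
  - by apply: L1Z; exact: L2_L1.
  - move=> n y; rewrite /mulop -mulrBl sqmodM ler_wpM2r ?sqmod_ge0// -sqr_nc.
    have -> : 4 = 2 ^+ 2 :> R by ring.
    rewrite ler_pXn2r ?nnegrE ?nc_ge0//; apply: le_trans (ncB _ _) _.
    by have := q1 n y; have := p1 y; lra.
  - move=> y; rewrite /mulop; under eq_fun do rewrite -mulrBl ncM mulrC.
    by rewrite -(mulr0 (nc (f y))); apply: cvgMr; exact: qc.
apply: cvg0_le (cvg0D uf qf) => n; first exact: l2_ge0.
have -> : (fun x => mulop (q n) (u n) x - mulop p f x) =
   fun x => mulop (q n) (fun x => u n x - f x) x + (mulop (q n) f x - mulop p f x).
  by apply/funext => x; rewrite /mulop; ring.
apply: le_trans (l2D (Lqu n) (L2B (Lqf n) Lpf)) _; rewrite lerD2r.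
rewrite -[leRHS]mul1r; apply: mulop_le => //; exact: L2B.
Qed.

Lemma mulop_cvg1 (q u : nat -> R -> C) f : (forall n, cmeas (q n)) -> (forall n x, nc (q n x) <= 1) ->
  (forall x, ccvg (q ^~ x) 1) -> (forall n, L2fun (u n)) -> L2fun f ->
  l2 (fun x => u n x - f x) @[n --> \oo] --> 0 ->
  l2 (fun x => mulop (q n) (u n) x - f x) @[n --> \oo] --> 0.
Proof.
move=> mq q1 qc Lu Lf uf; have := mulop_cvg (p := fun=> 1) mq q1 qc Lu Lf uf.
by under eq_fun do under eq_fun do rewrite [mulop (fun=> 1) _ _]mul1r.
Qed.

End L2Convergence.

(** * Symbols of operators in a weak-star closed subspace *)

Section Grid.
Variable R : realType.
Local Notation C := R[i].
Implicit Types (G : R -> C) (n : nat) (y : R).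

(** Left ends of a grid on [[-(n+1), n+1[] of mesh [1/(n+1)], which accounts for the [2 (n+1)^2]
    cells in [gridsum]: the grid exhausts the line while it refines. *)
Definition knot n (j : nat) : R := - n.+1%:R + j%:R / n.+1%:R.
Definition cell n (j : nat) y : C := ind (knot n j.+1) y - ind (knot n j) y.
Definition gridsum n G y := \sum_(j < (2 * n.+1 ^ 2)%N) G (knot n j) * cell n j y.

Lemma knotS n j : knot n j.+1 = knot n j + n.+1%:R^-1.
Proof. by rewrite /knot -[j.+1%:R]natr1 mulrDl mul1r addrA. Qed.

Lemma knot_le n i j : (i <= j)%N -> knot n i <= knot n j.
Proof. by move=> ij; rewrite /knot lerD2l ler_wpM2r ?invr_ge0// ler_nat. Qed.

Lemma cellE n j y : cell n j y = real_complex R (knot n j <= y < knot n j.+1)%R%:R.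
Proof. by rewrite /cell /ind -rmorphB/= indR_itv// knot_le. Qed.

Lemma knot_last n : knot n (2 * n.+1 ^ 2)%N = n.+1%:R.
Proof.
rewrite /knot natrM natrX expr2 mulrA mulfK ?pnatr_eq0//.
ring.
Qed.

Lemma knot0 n : knot n 0 = - n.+1%:R. Proof. by rewrite /knot mul0r addr0. Qed.

Lemma gridsum_out n G y : ~~ (- n.+1%:R <= y < n.+1%:R) -> gridsum n G y = 0.
Proof.
move=> h; rewrite /gridsum big1// => j _; rewrite cellE.
case: (boolP (_ <= _ < _)) => [/andP[h1 h2]|_]; last by rewrite mulr0.
have := le_trans (knot_le n (leq0n j)) h1; have := lt_le_trans h2 (knot_le n (ltn_ord j)).
by rewrite knot0 knot_last => a b; rewrite a b in h.
Qed.

Lemma gridsum_in n y : - n.+1%:R <= y < n.+1%:R -> exists2 t, t <= y < t + n.+1%:R^-1 &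
  forall G, gridsum n G y = G t.
Proof.
move=> h; have one : gridsum n (fun=> 1) y = 1.
  rewrite /gridsum; under eq_bigr do rewrite mul1r.
  have -> : \sum_(j < 2 * n.+1 ^ 2) cell n j y = ind (knot n (2 * n.+1 ^ 2)) y - ind (knot n 0) y.
    by rewrite -(big_mkord xpredT (fun j => cell n j y)) telescope_sumr.
  by rewrite /ind -rmorphB/= indR_itv ?knot_le// knot_last knot0 h.
have [j hj] : exists j : 'I_(2 * n.+1 ^ 2), knot n j <= y < knot n j.+1.
  apply: contrapT => nex; move: one; rewrite /gridsum big1 => [/eqP|j _].
    by rewrite eq_sym oner_eq0.
  rewrite cellE; case: (boolP (_ <= _ < _)) => [h1|_]; last by rewrite mulr0.
  by case: nex; exists j.
exists (knot n j); first by rewrite -knotS.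
move=> G; rewrite /gridsum (bigD1 j)//= cellE hj mulr1 big1 ?addr0// => i ij.
rewrite cellE; case: (boolP (_ <= _ < _)) => [/andP[h1 h2]|_]; last by rewrite mulr0.
case/andP: hj => h3 h4; exfalso; move: ij; rewrite neq_ltn => /orP[ij|ij].
  by have := lt_le_trans h2 (le_trans (knot_le n ij) h3); rewrite ltxx.
by have := lt_le_trans h4 (le_trans (knot_le n ij) h1); rewrite ltxx.
Qed.

Lemma gridsum_le n G y k : 0 <= k -> (forall t, nc (G t) <= k) -> nc (gridsum n G y) <= k.
Proof.
move=> k0 hG; have [h|h] := boolP (- n.+1%:R <= y < n.+1%:R).
  by have [t _ ->] := gridsum_in h.
by rewrite gridsum_out// nc0.
Qed.

Lemma gridsum_cvg G y : (forall u l, u n @[n --> \oo] --> l -> ccvg (fun n => G (u n)) (G l)) ->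
  ccvg (fun n => gridsum n G y) (G y).
Proof.
move=> hG.
have ex n : {t : R | `|t - y| <= n.+1%:R^-1 &
    (- n.+1%:R <= y < n.+1%:R -> gridsum n G y = G t)}.
  apply: cid2; have [h|h] := boolP (- n.+1%:R <= y < n.+1%:R); last first.
    by exists y => //; rewrite subrr normr0 invr_ge0.
  have [t /andP[t1 t2] tG] := gridsum_in h; exists t => //.
  have : 0 < n.+1%:R^-1 :> R by rewrite invr_gt0.
  move: t2; set i := n.+1%:R^-1 => t2 i0.
  by rewrite ler_norml; apply/andP; split; lra.
pose u n := s2val (ex n).
have hu n : `|u n - y| <= n.+1%:R^-1 by exact: (s2valP (ex n)).
have hu' n : - n.+1%:R <= y < n.+1%:R -> gridsum n G y = G (u n) by exact: (s2valP' (ex n)).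
have cu : u n @[n --> \oo] --> y.
  apply: dist0_cvg; apply: cvg0_le (@cvg_harmonic R) => n; first exact: normr_ge0.
  exact: hu.
have := hG _ _ cu; rewrite /ccvg => /cvgrPdist_lt h; apply/cvgrPdist_lt => e e0.
have [N _ hN] := h e e0.
(* The second entry guarantees that [y] lies inside the grid, where the sum equals [G] at the left
   end of the cell of [y]. *)
exists (maxn N (Num.truncn `|y|)) => // n /= nN.
have -> : gridsum n G y = G (u n).
  apply: hu'; have : `|y| < n.+1%:R.
    apply: lt_le_trans (truncnS_gt `|y|) _; rewrite ler_nat ltnS.
    exact: leq_trans (leq_maxr _ _) nN.
  by rewrite ltr_norml => /andP[/ltW -> ->].
by apply: hN => /=; exact: leq_trans (leq_maxl _ _) nN.
Qed.

Lemma cmeas_separately (t : R -> R -> C) : (forall y, cmeas (t ^~ y)) ->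
  (forall x u l, u n @[n --> \oo] --> l -> ccvg (fun n => t x (u n)) (t x l)) ->
  cmeas (fun z : R * R => t z.1 z.2).
Proof.
move=> mt ct.
apply: (@cmeas_cvg R _ _ (fun n (z : R * R) => gridsum n (t z.1) z.2)); last first.
  by move=> z; apply: gridsum_cvg => u l; exact: ct.
move=> n; rewrite /gridsum; apply: cmeas_sum => j; apply: cmeasM.
  exact: cmeas_fst (mt (knot n j)).
by apply: (cmeas_snd (f := cell n j)); apply: cmeasB; exact: cmeas_ind.
Qed.

End Grid.

(** * Multiplication symbols compatible with [V] *)

Section Symbols.
Variable R : realType.
Local Notation C := R[i].
Implicit Types (f g a b q : R -> C).

Variable V : set (op R).
Hypothesis sV : op_subspace V.
Hypothesis cV : wstar_closed V.
Hypothesis gV : forall l m, 0 <= l -> 0 <= m -> V (Mop l \o Dop m).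

(* The factors [expi (l * x)] are built in because [V] is not assumed to be an algebra. *)
Definition good q := [/\ exists2 k, 0 <= k & forall x, nc (q x) <= k, cmeas q &
  forall l u, 0 <= l -> 0 <= u -> V (mulop (fun x => expi (l * x) * q x) \o Dop u)].

Lemma V_zero : V (@op_zero R). Proof. by case: sV => _ []. Qed.

Lemma good1 : good (fun=> 1).
Proof.
split; [exists 1 => // x; by rewrite nc1|exact: cmeas_cst|].
move=> l u l0 u0; have := gV l0 u0; congr V.
by apply/funext => f; apply/funext => x; rewrite /= /mulop mulr1.
Qed.

Lemma goodZ z q : good q -> good (fun x => z * q x).
Proof.
move=> [[k k0 qk] mq Vq]; split.
- exists (nc z * k); first by rewrite mulr_ge0 ?nc_ge0.
  by move=> x; rewrite ncM ler_wpM2l ?nc_ge0.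
- exact: cmeasZ.
- move=> l u l0 u0; have [_ [_ [_ VZ]]] := sV.
  have := VZ z _ (Vq l u l0 u0); congr V.
  by apply/funext => f; apply/funext => x; rewrite /op_scale /comp /mulop; ring.
Qed.

Lemma goodD q p : good q -> good p -> good (fun x => q x + p x).
Proof.
move=> [[k k0 qk] mq Vq] [[m m0 pm] mp Vp]; split.
- exists (k + m); first exact: addr_ge0.
  by move=> x; apply: le_trans (ncD _ _) _; exact: lerD.
- exact: cmeasD.
- move=> l u l0 u0; have [_ [_ [VD _]]] := sV.
  have := VD _ _ (Vq l u l0 u0) (Vp l u l0 u0); congr V.
  by apply/funext => f; apply/funext => x; rewrite /op_add /comp /mulop; ring.
Qed.

Lemma good0 : good (fun=> 0).
Proof. by have := goodZ 0 good1; under eq_fun do rewrite mul0r. Qed.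

Lemma good_sum (I : Type) (s : seq I) (q : I -> R -> C) : (forall i, good (q i)) ->
  good (fun x => \sum_(i <- s) q i x).
Proof.
move=> gq; elim: s => [|i s IHs].
  by under eq_fun do rewrite big_nil; exact: good0.
by under eq_fun do rewrite big_cons; exact: goodD.
Qed.

Lemma good_expi l q : 0 <= l -> good q -> good (fun x => expi (l * x) * q x).
Proof.
move=> l0 [[k k0 qk] mq Vq]; split.
- by exists k => // x; rewrite ncM nc_expi mul1r.
- by apply: cmeasM => //; exact: cmeas_expiM.
- move=> l' u l'0 u0; have := Vq (l' + l) u (addr_ge0 l'0 l0) u0; congr V.
  by apply/funext => f; apply/funext => x; rewrite /= /mulop mulrDl expiD !mulrA.
Qed.

Lemma mulD_dominated q k u : cmeas q -> 0 <= k -> (forall x, nc (q x) <= k) ->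
  dominated k (mulop q \o Dop u).
Proof.
move=> mq k0 qk f g Lf Lg; have LD := L2_D u Lf.
apply: le_trans (ip_le (L2_bounded mq qk LD) Lg) _.
rewrite mulrA ler_wpM2r ?l2_ge0//; apply: le_trans (mulop_le mq k0 qk LD) _.
by rewrite /l2 nsq_D.
Qed.

(** [V] is closed under weak integrals, so symbols may be integrated over a parameter once an
    integrable [rho] dominates them uniformly in [x]. *)
Lemma good_int (qs : R -> R -> C) (rho : R -> R) : L1 rho -> (forall s, 0 <= rho s) ->
  (forall s, good (qs s)) -> (forall s x, nc (qs s x) <= rho s) ->
  cmeas (fun z : R * R => qs z.1 z.2) -> good (fun x => cint (qs ^~ x)).
Proof.
move=> Lrho rho0 gq qrho mq.
have mqx x : cmeas (qs ^~ x) := cmeas_slice2 x mq.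
have Cq x : C1 (qs ^~ x) by exact: le_C1 (mqx x) Lrho _.
have qle x : nc (cint (qs ^~ x)) <= rint rho by exact: cint_le.
have mcint : cmeas (fun x => cint (qs ^~ x)).
  (* Fubini is to give measurability of the integral in [x], but [qs s] is merely bounded in [x].
     The weight [w] makes it integrable and is multiplied away afterwards. *)
  pose w (x : R) : C := real_complex R (1 + x ^+ 2)^-1.
  have mw : cmeas w.
    by apply: cmeas_real; have := L1_meas (@L1_oneDsqrV R).
  have pw (x : R) : 0 < 1 + x ^+ 2 by have := sqr_ge0 x; lra.
  have ncw x : nc (w x) = (1 + x ^+ 2)^-1 by rewrite nc_real ger0_norm// invr_ge0 ltW.
  have [|||_ h _] := @cint_fubini R (fun z => qs z.1 z.2 * w z.2)
      (fun s => rint (fun x : R => (1 + x ^+ 2)^-1) * rho s) _ (L1Z _ Lrho).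
  - by apply: cmeasM => //; exact: cmeas_snd mw.
  - move=> s; apply: (le_C1 _ (L1Z (rho s) (@L1_oneDsqrV R))).
      by apply: cmeasM => //; case: (gq s).
    by move=> x; rewrite ncM ncw ler_wpM2r// invr_ge0 ltW.
  - move=> s; rewrite mulrC -rintZ; last exact: L1_oneDsqrV.
    apply: le_rint => [||x] /=.
    + apply: (le_L1 _ _ (L1Z (rho s) (@L1_oneDsqrV R))).
        by apply: meas_nc; apply: cmeasM => //; case: (gq s).
      move=> x; rewrite ger0_norm ?nc_ge0// ncM ncw ler_wpM2r// invr_ge0 ltW//.
    + exact: L1Z (@L1_oneDsqrV R).
    + by rewrite ncM ncw ler_wpM2r// invr_ge0 ltW.
  have := cmeasM (cmeas_real (_ : measurable_fun setT (fun x : R => 1 + x ^+ 2))) (C1_meas h).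
  move=> /(_ _)/= hh; have := hh _; rewrite (_ : (fun x => _) = fun x => cint (qs ^~ x)).
    by apply; apply: measurable_funD => //; exact: measurable_funX.
  apply/funext => x.
  have -> : cint (fun s => qs s x * w x) = w x * cint (qs ^~ x).
    by rewrite -cintZ//; congr cint; apply/funext => s; rewrite mulrC.
  by rewrite mulrA /w -rmorphM/= mulfV ?mul1r// gt_eqF.
split.
- by exists (rint rho) => //; exact: rint_ge0.
- exact: mcint.
move=> l u l0 u0.
have me s : cmeas (fun x => expi (l * x) * qs s x).
  by apply: cmeasM; [exact: cmeas_expiM|case: (gq s)].
have em : cmeas (fun y : R => expi (l * y) * cint (qs ^~ y)).
  by apply: cmeasM => //; exact: cmeas_expiM.
have bT : bounded_op (mulop (fun x => expi (l * x) * cint (qs ^~ x)) \o Dop u).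
  apply: bounded_comp (bounded_D u).
  apply: (bounded_mulop em (k := rint rho)); first exact: rint_ge0.
  by move=> x; rewrite ncM nc_expi mul1r.
have fub f g : L2fun f -> L2fun g ->
   C1 (fun s => ip ((mulop (fun x => expi (l * x) * qs s x) \o Dop u) f) g) /\
   cint (fun s => ip ((mulop (fun x => expi (l * x) * qs s x) \o Dop u) f) g) =
   ip ((mulop (fun x => expi (l * x) * cint (qs ^~ x)) \o Dop u) f) g.
  move=> Lf Lg; have LD := L2_D u Lf.
  pose h (z : R * R) := expi (l * z.2) * qs z.1 z.2 * Dop u f z.2 * conjc (g z.2).
  have LM := L1_ncM LD Lg.
  have nch s x : nc (h (s, x)) <= rho s * (nc (Dop u f x) * nc (g x)).
    rewrite /h /= !ncM nc_expi mul1r ncJ -mulrA ler_wpM2r// mulr_ge0 ?nc_ge0//.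
  have mhs s : cmeas (fun x => h (s, x)).
    by apply: cmeasM; [apply: cmeasM; [exact: me|]|apply: cmeasJ]; exact: L2_cmeas.
  have [|||h1 h2 h3] := @cint_fubini R h (fun s => (l2 f * l2 g) * rho s) _ (L1Z _ Lrho).
  - apply: cmeasM; [apply: cmeasM; [apply: cmeasM => //|]|].
    + exact: (cmeas_snd (cmeas_expiM l)).
    + exact: (cmeas_snd (L2_cmeas LD)).
    + exact: (cmeas_snd (cmeasJ (L2_cmeas Lg))).
  - by move=> s; apply: (le_C1 (mhs s) (L1Z (rho s) LM)) => x; exact: nch.
  - move=> s; apply: le_trans (_ : rint (fun x => rho s * (nc (Dop u f x) * nc (g x))) <= _).
      apply: le_rint => [||x]; [|exact: L1Z|exact: nch].
      apply: (le_L1 (meas_nc (mhs s)) _ (L1Z (rho s) LM)) => x.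
      by rewrite ger0_norm ?nc_ge0//; exact: nch.
    rewrite rintZ// mulrC ler_wpM2r//; apply: le_trans (rint_ncM LD Lg) _.
    by rewrite /l2 nsq_D.
  have e1 s : cint (fun x => h (s, x)) = ip ((mulop (fun x => expi (l * x) * qs s x) \o Dop u) f) g.
    by [].
  have e2 x : cint (fun s => h (s, x)) =
     mulop (fun x => expi (l * x) * cint (qs ^~ x)) (Dop u f) x * conjc (g x).
    transitivity (cint (fun s => (expi (l * x) * Dop u f x * conjc (g x)) * qs s x)).
      by congr cint; apply/funext => s; rewrite /h /=; ring.
    by rewrite cintZ; [rewrite /mulop mulrAC (mulrAC (expi (l * x)))|exact: Cq].
  split; first by move: h1; under eq_fun do rewrite e1.
  by move: h3; under eq_fun do rewrite e1; move=> ->; rewrite ipE; congr cint; apply/funext => x.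
apply: (wstar_weak_integral (Ts := fun s => mulop (fun x => expi (l * x) * qs s x) \o Dop u)
   sV cV bT Lrho rho0).
- by move=> s; have [_ _] := gq s; apply.
- by move=> s; apply: mulD_dominated => // x; rewrite ncM nc_expi mul1r.
- by move=> f g Lf Lg; apply: C1_meas; case: (fub f g Lf Lg).
- by move=> f g Lf Lg; have [_ ->] := fub f g Lf Lg.
Qed.

Lemma ccvg_mul3 (u : nat -> C) (l a b c : C) : ccvg u l ->
  ccvg (fun n => a * u n * b * c) (a * l * b * c).
Proof.
have e z : a * z * b * c = a * b * c * z by ring.
by move=> h; under eq_fun do rewrite e; rewrite e; exact: ccvgZ.
Qed.

Lemma good_lim (qn : nat -> R -> C) q k : 0 <= k -> (forall n, good (qn n)) ->
  (forall n x, nc (qn n x) <= k) -> (forall x, ccvg (qn ^~ x) (q x)) -> good q.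
Proof.
move=> k0 gq qk qcvg.
have mq : cmeas q by apply: cmeas_cvg qcvg => n; case: (gq n).
have qle x : nc (q x) <= k by exact: ccvg_nc_le (qcvg x) _.
split; [by exists k|exact: mq|] => l u l0 u0.
have me (p : R -> C) : cmeas p -> cmeas (fun x => expi (l * x) * p x).
  by move=> mp; apply: cmeasM => //; exact: cmeas_expiM.
have bT : bounded_op (mulop (fun x => expi (l * x) * q x) \o Dop u).
  apply: bounded_comp (bounded_D u).
  by apply: (bounded_mulop (k := k)) => //; [exact: me|move=> x; rewrite ncM nc_expi mul1r].
apply: (wstar_weak_limit (Tn := fun n => mulop (fun x => expi (l * x) * qn n x) \o Dop u) (k := k) sV cV bT).
- by move=> n; have [_ _] := gq n; apply.
- move=> n; apply: mulD_dominated => // [|x]; first by apply: me; case: (gq n).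
  by rewrite ncM nc_expi mul1r.
- move=> f g Lf Lg; have LD := L2_D u Lf.
  have [|||_] := @cint_dct R (fun n x => expi (l * x) * qn n x * Dop u f x * conjc (g x))
     (fun x => expi (l * x) * q x * Dop u f x * conjc (g x))
     (fun x => k * (nc (Dop u f x) * nc (g x))) _ (L1Z k (L1_ncM LD Lg)) => //.
  + move=> n; apply: cmeasM; [apply: cmeasM|apply: cmeasJ]; last exact: L2_cmeas.
      by apply: me; case: (gq n).
    exact: L2_cmeas.
  + move=> n x; rewrite !ncM nc_expi mul1r ncJ -mulrA ler_wpM2r ?mulr_ge0 ?nc_ge0//.
  + move=> x; exact: ccvg_mul3 (qcvg x).
Qed.

(** [eb d] superposes the characters [expi (s * x)] with [0 <= s < d], all of nonnegative frequency;
    the translation by [u] only contributes the constants [expi (- (s * u))]. *)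
Lemma good_eb d u q : 0 <= d -> good q -> good (fun x => eb d (x - u) * q x).
Proof.
move=> d0 gq; have [[k k0 qk] mq _] := gq.
pose qs (s x : R) := ind d s * expi (s * (x - u)) * q x.
have -> : (fun x => eb d (x - u) * q x) = fun x => cint (qs ^~ x).
  apply/funext => x; rewrite mulrC /eb /ft -cintZ; last exact: C1_ft (C1_ind d).
  by congr cint; apply/funext => s; rewrite /qs; ring.
have Lr : L1 (fun s => k * `|indR d s|) by apply: L1Z; apply: L1_norm; exact: L1_indR.
apply: (good_int Lr).
- by move=> s; rewrite mulr_ge0.
- move=> s; have [s0|s0] := ltP s 0.
    have -> : qs s = fun=> 0; last exact: good0.
    apply/funext => x; rewrite /qs /ind /indR (lt_geF s0)/= s0 andbT.
    have -> : (d <= s) = false by apply/negbTE; rewrite -ltNge; exact: lt_le_trans s0 d0.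
    by rewrite subrr !mul0r.
  have := goodZ (ind d s * expi (- (s * u))) (good_expi s0 gq); congr good.
  apply/funext => x; rewrite /qs mulrBr expiD; ring.
- move=> s x; rewrite /qs !ncM nc_expi mulr1 nc_ind mulrC ler_wpM2r//.
- rewrite /qs; apply: cmeasM; first apply: cmeasM.
  + exact: cmeas_fst (cmeas_ind d).
  + apply: cmeas_expi; apply: measurable_funM; first exact: measurable_fst.
    by apply: measurable_funB => //; exact: measurable_snd.
  + exact: cmeas_snd mq.
Qed.

(** The formulation by vanishing inner products passes to weak operator limits at once. The supports
    are pointwise, so a function that vanishes only almost everywhere is truncated by [tail] before
    the property is applied. *)
Definition causal (S : op R) := forall t f g, L2fun f -> L2fun g ->
  (forall x, x < t -> f x = 0) -> (forall x, t <= x -> g x = 0) -> ip (S f) g = 0.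

Lemma ip_MN x f g : ip (Mop x f) g = ip f (Mop (- x) g).
Proof.
rewrite !ipE; congr cint; apply/funext => y; rewrite /Mop conjM expiJ mulNr opprK.
by rewrite mulrCA mulrA.
Qed.

Definition tail (t : R) b (x : R) : C := real_complex R (\1_(`[t, +oo[%classic) x) * b x.

Lemma tailE t b x : tail t b x = if t <= x then b x else 0.
Proof.
rewrite /tail indicE (_ : x \in _ = (t <= x)); last first.
  by apply/idP/idP; rewrite inE /= in_itv /= andbT.
by case: ifP => _; rewrite ?mul1r ?mul0r.
Qed.

Lemma L2_tail t b : L2fun b -> L2fun (tail t b).
Proof.
move=> Lb; apply: (L2_bounded (k := 1) _ _ Lb).
  by apply: cmeas_real; exact: measurable_indic.
move=> x; rewrite nc_real indicE; case: (_ \in _) => /=; by rewrite ?normr1 ?normr0.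
Qed.

(* Causality restricts the integral of [expi ((y - t) * x) * S a y * conjc (b y)] to [y >= t],
   where the frequency [y - t] is nonnegative. *)
Lemma good_cell S t a b : bounded_op S -> causal S -> L2fun a -> L2fun b ->
  (forall x, x < t -> a x = 0) -> good (fun x => expi (- (x * t)) * ip (Mop x (S a)) b).
Proof.
move=> bS cS La Lb at0; have LS := op_L2 bS La; have Lt := L2_tail t Lb.
pose q0 y := S a y * conjc (tail t b y).
pose qs (y x : R) := expi ((y - t) * x) * q0 y.
have Lq := L2M LS Lt.
have -> : (fun x => expi (- (x * t)) * ip (Mop x (S a)) b) = fun x => cint (qs ^~ x).
  apply/funext => x.
  have LM (h : R -> C) : L2fun h -> L2fun (Mop (- x) h) by exact: op_L2 (bounded_M _).
  have -> : ip (Mop x (S a)) b = ip (Mop x (S a)) (tail t b).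
    have LMb := LM _ Lb; have LMt := LM _ Lt.
    rewrite !ip_MN; apply/eqP; rewrite -subr_eq0 -ipBr//.
    apply/eqP; apply: (cS t) => //; first exact: L2B.
    by move=> y ty; rewrite /Mop tailE ty subrr.
  rewrite ipE -cintZ; last by apply: L2M => //; exact: op_L2 (bounded_M x) LS.
  congr cint; apply/funext => y; rewrite /qs /q0 /Mop !mulrA -expiD.
  by congr (expi _ * _ * _); ring.
apply: (good_int (L1_ncM LS Lb)).
- by move=> y; rewrite mulr_ge0 ?nc_ge0.
- move=> y; rewrite /qs; case: (ltP y t) => ty.
    have -> : q0 y = 0 by rewrite /q0 tailE ifN ?leNgt ?ty// (rmorph0 (@conjc R)) mulr0.
    by under eq_fun do rewrite mulr0; exact: good0.
  under eq_fun do rewrite mulrC; apply: goodZ.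
  have ty' : 0 <= y - t by rewrite subr_ge0.
  by have := good_expi ty' good1; under eq_fun do rewrite mulr1.
- move=> y x; rewrite /qs ncM nc_expi mul1r /q0 ncM ncJ ler_wpM2l ?nc_ge0//.
  by rewrite tailE; case: ifP => _ //; rewrite nc0 nc_ge0.
- apply: cmeasM.
    apply: cmeas_expi; apply: measurable_funM; last exact: measurable_snd.
    by apply: measurable_funB => //; exact: measurable_fst.
  apply: (cmeas_fst (f := q0)).
  by apply: cmeasM; [|apply: cmeasJ]; exact: L2_cmeas.
Qed.

Lemma cmeas_cell n j : cmeas (@cell R n j).
Proof. by apply: cmeasB; exact: cmeas_ind. Qed.

Lemma nc_cell n j y : nc (@cell R n j y) <= 1.
Proof. by rewrite cellE nc_real; case: (_ <= _ < _); rewrite ?normr1 ?normr0. Qed.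

Lemma cmeas_gridsum n (G : R -> C) : cmeas (gridsum n G).
Proof. by apply: cmeas_sum => j; apply: cmeasM; [exact: cmeas_cst|exact: cmeas_cell]. Qed.

(* [a] is cut into pieces supported on the cells of a grid, on each of which [good_cell] applies. *)
Lemma loebl_muhly S a b : bounded_op S -> causal S -> L2fun a -> L2fun b ->
  good (fun x => ip (Mop x (S (Mop (- x) a))) b).
Proof.
move=> bS cS La Lb; have [S' bS' adj] := adjoint bS; have [k k0 hk] := op_bound bS.
pose E (x y : R) : C := expi (- x * y).
(* This is the target expression with the character [E x] acting on [a] replaced by its step
   function on the grid: on each cell the phase is frozen at the left end, the point [t] of
   [good_cell]. *)
pose qn n x := \sum_(j < (2 * n.+1 ^ 2)%N) expi (- (x * knot R n j)) *
  ip (Mop x (S (fun y => cell n j y * a y))) b.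
have La' n j : L2fun (fun y => cell n j y * a y).
  exact: L2_bounded (cmeas_cell n j) (nc_cell n j) La.
have LM x (h : R -> C) : L2fun h -> L2fun (Mop x h) by exact: op_L2 (bounded_M _).
have gE n x y : nc (gridsum n (E x) y) <= 1.
  by apply: gridsum_le => // t; rewrite /E nc_expi.
have Lg n x : L2fun (mulop (gridsum n (E x)) a).
  exact: L2_bounded (cmeas_gridsum n (E x)) (gE n x) La.
have qnE n x : qn n x = ip (Mop x (S (mulop (gridsum n (E x)) a))) b.
  rewrite ip_MN adj//; last exact: LM.
  rewrite (_ : mulop _ a =
     fun y => \sum_(j < (2 * n.+1 ^ 2)%N) E x (knot R n j) * (cell n j y * a y)); last first.
    apply/funext => y; rewrite /mulop /gridsum mulr_suml.
    by apply: eq_bigr => j _; rewrite mulrA.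
  rewrite ip_suml; [|by move=> j; exact: L2Z|by apply: (op_L2 bS'); exact: LM].
  apply: eq_bigr => j _; rewrite ipZl//; last by apply: (op_L2 bS'); exact: LM.
  by rewrite ip_MN adj//; [rewrite /E mulNr|exact: LM].
apply: (@good_lim qn _ (k * l2 a * l2 b)).
- by rewrite !mulr_ge0 ?l2_ge0.
- move=> n; apply: good_sum => j; apply: good_cell => // x xk.
  by rewrite cellE leNgt xk/= mul0r.
- move=> n x; rewrite qnE; apply: le_trans (ip_le (LM _ _ (op_L2 bS (Lg _ _))) Lb) _.
  rewrite ler_wpM2r ?l2_ge0//; apply: le_trans (_ : l2 (S (mulop (gridsum n (E x)) a)) <= _).
    by apply: le_of_eq; rewrite /l2 /nsq; congr Num.sqrt; congr Rintegral; apply/funext => y;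
      rewrite -!sqr_nc /Mop ncM nc_expi mul1r.
  apply: le_trans (hk _ (Lg _ _)) _; rewrite ler_wpM2l//.
  by rewrite -[leRHS]mul1r; apply: mulop_le => //; exact: cmeas_gridsum.
- move=> x; under eq_fun do rewrite qnE ip_MN (adj _ _ (Lg _ _) (LM _ _ Lb)).
  rewrite ip_MN adj; [|exact: LM..]; have LS := op_L2 bS' (LM (- x) _ Lb).
  apply: (cvg0_ip (v := fun=> S' (Mop (- x) b))) => //; first exact: LM.
    apply: (mulop_cvg (q := fun n => gridsum n (E x)) (u := fun=> a) (p := E x)) => //.
    + by move=> n; exact: cmeas_gridsum.
    + move=> y; apply: (gridsum_cvg (G := E x)) => u l ul.
      by apply: ccvg_expi; apply: cvgMr.
    + by rewrite l2_subrr; exact: cvg_cst.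
  by rewrite l2_subrr; exact: cvg_cst.
Qed.

End Symbols.

(** * Regularisation of bicausal operators *)

Section Kernels.
Variable R : realType.
Local Notation C := R[i].
Implicit Types (f g p q : R -> C).

Lemma ip_M_ft x f g : ip (Mop x f) g = ft (fun y => f y * conjc (g y)) x.
Proof.
rewrite ipE; congr cint; apply/funext => y; rewrite /Mop (mulrC y x).
by rewrite -[LHS]mulrA [LHS]mulrC.
Qed.

(** The substitution [y = x - u] regroups a kernel along its diagonals, on which it acts as a
    multiplication followed by a pairing with a translate. *)
Lemma fubini_kernel (t : R -> R -> C) (K : R) p q : cmeas (fun z : R * R => t z.1 z.2) -> 0 <= K ->
  (forall x y, nc (t x y) <= K) -> C1 p -> C1 q ->
  C1 (fun u => cint (fun x => p (x - u) * (q x * t x (x - u)))) /\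
  cint (fun y => cint (fun x => p y * (q x * t x y))) =
  cint (fun u => cint (fun x => p (x - u) * (q x * t x (x - u)))).
Proof.
move=> mt K0 tK Cp Cq.
have mp := C1_meas Cp; have mq := C1_meas Cq.
have mtx x : cmeas (fun y => t x y) := cmeas_slice1 x mt.
have mty y : cmeas (fun x => t x y) := cmeas_slice2 y mt.
have msub : measurable_fun setT (fun z : R * R => z.1 - z.2).
  by apply: measurable_funB; [exact: measurable_fst|exact: measurable_snd].
pose h1 (z : R * R) := p z.1 * (q z.2 * t z.2 z.1).
pose h2 (z : R * R) := p (z.1 - z.2) * (q z.1 * t z.1 (z.1 - z.2)).
pose kp := rint (fun y => nc (p y)); pose kq := rint (fun y => nc (q y)).
have nc1 y x : nc (h1 (y, x)) <= (K * nc (p y)) * nc (q x).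
  rewrite /h1 /= !ncM (mulrC (nc (q x))) mulrA (mulrC K).
  by rewrite ler_wpM2r ?nc_ge0// ler_wpM2l ?nc_ge0.
have nc2 x u : nc (h2 (x, u)) <= (K * nc (q x)) * nc (p (x - u)).
  rewrite /h2 /= !ncM mulrC ler_wpM2r ?nc_ge0// mulrC.
  by rewrite ler_wpM2r ?nc_ge0.
have Cpx x := cint_refl x Cp.
have Lpx x := rint_refl x (C1_nc Cp).
have m1 y : cmeas (fun x => h1 (y, x)).
  by rewrite /h1 /=; apply: cmeasZ; exact: cmeasM.
have m2 x : cmeas (fun u => h2 (x, u)).
  apply: cmeasM; first exact: C1_meas (Cpx x).1.
  rewrite /=; apply: cmeasZ; apply: (cmeas_comp (phi := fun u : R => x - u) _ (mtx x)).
  exact: measurable_funB.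
have C1h1 y : C1 (fun x => h1 (y, x)) by exact: le_C1 (m1 y) (L1Z _ (C1_nc Cq)) (nc1 y).
have C1h2 x : C1 (fun u => h2 (x, u)) by exact: le_C1 (m2 x) (L1Z _ (Lpx x).1) (nc2 x).
have [|||_ _ e1] := @cint_fubini R h1 (fun y => (K * kq) * nc (p y)) _ (L1Z _ (C1_nc Cp)).
- apply: cmeasM; last apply: cmeasM.
  + exact: cmeas_fst mp.
  + exact: cmeas_snd mq.
  + apply: (cmeas_comp (phi := fun z : R * R => (z.2, z.1)) _ mt).
    by apply: measurable_fun_pair; [exact: measurable_snd|exact: measurable_fst].
- exact: C1h1.
- move=> y; apply: le_trans (le_rint (C1_nc (C1h1 y)) (L1Z (K * nc (p y)) (C1_nc Cq)) (nc1 y)) _.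
  by rewrite rintZ; [rewrite mulrAC|exact: C1_nc].
have [|||_ h2u e2] := @cint_fubini R h2 (fun x => (K * kp) * nc (q x)) _ (L1Z _ (C1_nc Cq)).
- apply: cmeasM; last apply: cmeasM.
  + exact: (cmeas_comp (f := p) msub).
  + exact: cmeas_fst mq.
  + apply: (cmeas_comp (phi := fun z : R * R => (z.1, z.1 - z.2)) _ mt).
    by apply: measurable_fun_pair; [exact: measurable_fst|exact: msub].
- exact: C1h2.
- move=> x; apply: le_trans (le_rint (C1_nc (C1h2 x)) (L1Z (K * nc (q x)) (Lpx x).1) (nc2 x)) _.
  by rewrite rintZ; [rewrite (Lpx x).2 mulrAC|exact: (Lpx x).1].
split; first exact: h2u.
rewrite (_ : cint (fun y => _) = cint (fun x => cint (fun y => h1 (y, x)))); last exact: e1.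
rewrite -[RHS]e2; congr cint; apply/funext => x.
have Cx : C1 (fun y => h1 (y, x)).
  apply: (le_C1 (g := fun y => (K * nc (q x)) * nc (p y))).
  - by rewrite /h1 /=; apply: cmeasM; [exact: mp|apply: cmeasZ; exact: mtx].
  - exact: L1Z (C1_nc Cp).
  - by move=> y; apply: le_trans (nc1 y x) _; rewrite mulrAC.
by rewrite -(cint_refl x Cx).2.
Qed.

(** A case of Peetre's inequality: decay at [x] and at [x - u] leaves decay in the difference [u],
    uniformly in [x]. The two sides differ by [1 + (x + y)^2 + 2 x^2 y^2] with [y = x - u]. *)
Lemma weight_split (x u : R) : 1 + u ^+ 2 <= 2 * ((1 + x ^+ 2) * (1 + (x - u) ^+ 2)).
Proof.
have := sqr_ge0 (x * (x - u)); have := sqr_ge0 (x + (x - u)); nra.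
Qed.

End Kernels.

Section Reconstruction.
Variable R : realType.
Local Notation C := R[i].
Implicit Types (f g p q : R -> C).
Variable V : set (op R).
Hypothesis sV : op_subspace V.
Hypothesis cV : wstar_closed V.
Hypothesis gV : forall l m, 0 <= l -> 0 <= m -> V (Mop l \o Dop m).
Variables F F' : op R.
Hypothesis uF : unitary F F'.
Hypothesis Fft : forall f, L2fun f -> C1 f -> Defs.ae_eq (F f) (fun x => nrmc R * ftm f x).

Let bF := unitary_bounded uF.
Let bF' := unitary_bounded' uF.
Let ipF := unitary_ip uF.
Let FD m : op_eq (F \o Dop m) (Mop (- m) \o F).
Proof. exact: (fourier_MD uF Fft).2. Qed.

(* The operator [F' \o mulop kap \o F] is the convolution with [psi]. *)
Lemma conv_ip p psi kap k G : L2fun p -> C1 p -> L2fun psi -> cmeas kap ->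
  0 <= k -> (forall x, nc (kap x) <= k) ->
  Defs.ae_eq (F psi) (fun x => nrmc R * kap x) -> L2fun G ->
  cint (fun y => p y * ip (Dop y psi) G) = ip (F' (mulop kap (F p))) G.
Proof.
move=> Lp Cp Lpsi mk k0 kk Fpsi LG.
have LFp := op_L2 bF Lp; have LFpsi := op_L2 bF Lpsi; have LFG := op_L2 bF LG.
pose w y := F psi y * conjc (F G y); have Cw : C1 w := L2M LFpsi LFG.
have e1 y : ip (Dop y psi) G = ft w (0 - y).
  rewrite -ipF//; last exact: L2_D.
  rewrite (ip_ae (op_L2 bF (L2_D y Lpsi)) (op_L2 (bounded_M (- y)) LFpsi) LFG LFG (FD y Lpsi) (ae_refl _)).
  by rewrite ip_M_ft sub0r.
have Cp' := cint_refl 0 Cp.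
have [Cm em] := multiplication_formula Cp'.1 Cw.
have -> : cint (fun y => p y * ip (Dop y psi) G) = cint (fun x => p (0 - x) * ft w x).
  rewrite -(cint_refl 0 Cm).2; congr cint; apply/funext => y.
  by rewrite e1 !sub0r opprK.
have e2 y : ft (fun x => p (0 - x)) y = ftm p y.
  rewrite /ft /ftm; have Cf : C1 (fun xi => p xi * expi (- (xi * y))).
    by have := C1_ft (- y) Cp; under eq_fun do rewrite mulrN.
  rewrite -(cint_refl 0 Cf).2; congr cint; apply/funext => xi.
  by rewrite !sub0r mulNr opprK.
have LM : L2fun (mulop kap (F p)) by exact: (L2_bounded mk kk LFp).
rewrite em (unitary_adj (unitary_sym uF) LM LG) ipE; apply: (cint_ae _ _ _).2.
- apply: aeS (aeI Fpsi (Fft Lp Cp)) => y [h1 h2].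
  rewrite e2 /w /mulop h1 h2; ring.
- under eq_fun do rewrite e2.
  apply: (cint_ae (f := fun y => mulop kap (F p) y * conjc (F G y)) _ (L2M LM LFG) _).1.
    apply: aeS (aeI Fpsi (Fft Lp Cp)) => y [h1 h2].
    rewrite /w /mulop h1 h2; ring.
  by apply: cmeasM; [exact: ftm_meas|exact: C1_meas].
- exact: C1_meas (L2M LM LFG).
Qed.

Variable T : op R.
Hypothesis bT : bounded_op T.
Hypothesis cT : causal T.
Hypothesis cS : causal (F \o T \o F').

Lemma kernel_mem A (phi psi psi' kap kap' : R -> C) k (c : R) : bounded_op A ->
  L2fun psi -> L2fun psi' -> (forall x, x < 0 -> psi x = 0) -> (forall x, 0 <= x -> psi' x = 0) ->
  cmeas kap -> cmeas kap' -> 0 <= k -> (forall x, nc (kap x) <= k) -> (forall x, nc (kap' x) <= k) ->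
  Defs.ae_eq (F psi) (fun x => nrmc R * kap x) ->
  Defs.ae_eq (F psi') (fun x => nrmc R * kap' x) ->
  cmeas phi -> 0 <= c -> (forall x, nc (phi x) <= c / (1 + x ^+ 2)) ->
  (forall u q, good V q -> good V (fun x => phi (x - u) * q x)) ->
  (forall f g, L2fun f -> L2fun g -> ip (A f) g = ip (T (F' (mulop kap (F (mulop phi f)))))
     (F' (mulop kap' (F (mulop (fun x => conjc (phi x)) g))))) ->
  V A.
Proof.
move=> bA Lpsi Lpsi' psi0 psi'0 mk mk' k0 kk kk' Fpsi Fpsi' mphi c0 phic gphi hA.
have [T' bT' adT] := adjoint bT; have [m m0 hm] := op_bound bT.
pose S := F \o T \o F'; have cS' : causal S := cS.
have bS : bounded_op S by exact: bounded_comp (bounded_comp bF bT) bF'.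
have [S' bS' adS] := adjoint bS.
have LM (x : R) h : L2fun h -> L2fun (Mop x h) by exact: op_L2 (bounded_M x).
pose t x y := ip (T (Dop y psi)) (Dop x psi').
have LF := op_L2 bF Lpsi; have LF' := op_L2 bF Lpsi'.
have tE x y : t x y = ip (Mop x (S (Mop (- y) (F psi)))) (F psi').
  have LD := L2_D y Lpsi; have LD' := L2_D x Lpsi'; have LT := op_L2 bT LD.
  rewrite ip_MN /t -ipF//.
  apply: ip_ae; [exact: op_L2|by apply: (op_L2 bS); exact: LM|exact: op_L2|exact: LM| |exact: FD].
  apply: (@ae_trans _ _ (S (F (Dop y psi)))).
    apply: ae_sym; apply: (op_ae bF); [| exact: LT |].
      exact: (op_L2 bT (op_L2 bF' (op_L2 bF LD))).
    apply: (op_ae bT) => //; first exact: (op_L2 bF' (op_L2 bF LD)).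
    exact: (unitaryK uF LD).
  by apply: (op_ae bS); [exact: op_L2|exact: LM|exact: FD].
have mt : cmeas (fun z : R * R => t z.1 z.2).
  (* Each slice of [t] is the Fourier integral of a product of two square integrable functions,
     hence continuous. *)
  apply: cmeas_separately => [y|x u l ul].
    under eq_fun do rewrite tE ip_M_ft; apply: ft_meas; apply: L2M => //.
    by apply: (op_L2 bS); exact: LM.
  have E y : t x y = ft (fun z => F psi z * conjc (S' (Mop (- x) (F psi')) z)) (- y).
    by rewrite tE ip_MN adS ?ip_M_ft//; exact: LM.
  under eq_fun do rewrite E; rewrite E; apply: ft_seq; last exact: cvgN.
  by apply: L2M => //; apply: (op_L2 bS'); exact: LM.
set K := m * l2 psi * l2 psi'.
have K0 : 0 <= K by rewrite !mulr_ge0 ?l2_ge0.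
have tK x y : nc (t x y) <= K.
  have LD := L2_D y Lpsi; have LD' := L2_D x Lpsi'.
  apply: le_trans (ip_le (op_L2 bT LD) LD') _.
  have -> : l2 (Dop x psi') = l2 psi' by rewrite /l2 nsq_D.
  rewrite ler_wpM2r ?l2_ge0//; apply: le_trans (hm _ LD) _.
  by rewrite /l2 nsq_D.
pose mu u x := phi (x - u) * (phi x * t x (x - u)).
have gmu u : good V (mu u).
  apply: (gphi u); have g0 q : good V q -> good V (fun x => phi x * q x).
    by move/(gphi 0); under eq_fun do rewrite subr0.
  (* On the diagonal [y = x - u] the modulation splits into [Mop (- x)] and a fixed [Mop u].
     Absorbing the latter into the vector leaves exactly the expression treated by [loebl_muhly]. *)
  have E (x : R) : Mop (- (x - u)) (F psi) = Mop (- x) (Mop u (F psi)).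
    apply/funext => y; rewrite /Mop mulrA -expiD; congr (expi _ * _); ring.
  apply: g0; under eq_fun do rewrite tE E.
  exact: (loebl_muhly sV cV gV bS cS' (LM u _ LF) LF').
(* The factor [c ^+ 2] comes from the two cutoffs, 2 from [weight_split] and [K] from the bound on
   [t]. *)
pose rho u : R := (2 * c ^+ 2 * K) * (1 + u ^+ 2)^-1.
have pos (x : R) : 0 < 1 + x ^+ 2 by have := sqr_ge0 x; lra.
have rho0 u : 0 <= rho u by exact: divr_ge0 (mulr_ge0 (mulr_ge0 (ler0n _ _) (sqr_ge0 c)) K0) (ltW (pos u)).
have murho u x : nc (mu u x) <= rho u.
  rewrite /mu /rho !ncM [leLHS]mulrA -[leRHS]mulrA [_ * (1 + _)^-1]mulrC [leRHS]mulrA.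
  apply: ler_pM; rewrite ?mulr_ge0 ?nc_ge0//.
  apply: le_trans (ler_pM (nc_ge0 _) (nc_ge0 _) (phic (x - u)) (phic x)) _.
  rewrite mulrACA -invfM -expr2 -mulrA [leRHS]mulrCA ler_wpM2l ?sqr_ge0//.
  rewrite ler_pdivlMr// mulrC ler_pdivrMr ?mulr_gt0//.
  by have := weight_split x u; lra.
have phi1 x : nc (phi x) <= c.
  apply: le_trans (phic x) _; rewrite ler_pdivrMr// ler_peMr//.
  by have := sqr_ge0 x; lra.
have Lphi : L2fun phi.
  apply: (le_L2 mphi (L1Z (c ^+ 2) (@L1_oneDsqrV R))) => x.
  rewrite -sqr_nc; apply: le_trans (_ : (c / (1 + x ^+ 2)) ^+ 2 <= _).
    by rewrite ler_pXn2r ?nnegrE ?nc_ge0 ?divr_ge0// ltW.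
  rewrite exprMn ler_wpM2l ?sqr_ge0// expr2 ler_piMr ?invr_ge0 ?(ltW (pos x))//.
  by rewrite invf_le1//; have := sqr_ge0 x; lra.
have mphiJ := cmeasJ mphi.
have phi1J x : nc (conjc (phi x)) <= c by rewrite ncJ.
pose Tu u := mulop (mu u) \o Dop u.
have key f g : L2fun f -> L2fun g ->
   C1 (fun u => ip (Tu u f) g) /\ ip (A f) g = cint (fun u => ip (Tu u f) g).
  move=> Lf Lg; pose p := mulop phi f; pose q := mulop (fun x => conjc (phi x)) g.
  have Lp : L2fun p by exact: L2_bounded mphi phi1 Lf.
  have Lq : L2fun q by exact: L2_bounded mphiJ phi1J Lg.
  have Cp : C1 p.
    have := L2M Lphi (L2J Lf); congr C1; apply/funext => x; rewrite conjcK//.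
  have Cq : C1 q.
    have := L2M (L2J Lphi) (L2J Lg); congr C1; apply/funext => x; rewrite conjcK//.
  set H := F' (mulop kap' (F q)).
  have LH : L2fun H by apply: (op_L2 bF'); apply: (L2_bounded mk' kk'); exact: op_L2.
  have [Cu eu] := fubini_kernel mt K0 tK Cp (C1J Cq).
  have eTu u : ip (Tu u f) g = cint (fun x => p (x - u) * (conjc (q x) * t x (x - u))).
    rewrite ipE; congr cint; apply/funext => x.
    rewrite /Tu /p /q /mu /mulop /comp /Dop conjM conjcK; ring.
  split; first by under eq_fun do rewrite eTu.
  rewrite [RHS](congr1 (@cint R) (funext eTu)) -eu.
  have -> : ip (A f) g = ip (T (F' (mulop kap (F p)))) H by exact: hA.
  have LCp : L2fun (F' (mulop kap (F p))).
    by apply: (op_L2 bF'); apply: (L2_bounded mk kk); exact: op_L2.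
  rewrite (adT _ _ LCp LH) -(conv_ip Lp Cp Lpsi mk k0 kk Fpsi (op_L2 bT' LH)).
  congr cint; apply/funext => y; have LTy := op_L2 bT (L2_D y Lpsi).
  rewrite -(adT _ _ (L2_D y Lpsi) LH).
  (* [conv_ip] expands the first argument of an inner product, so the pairing is conjugated before
     the second smoothing is unfolded. *)
  rewrite (ipJ LH LTy) -(conv_ip Lq Cq Lpsi' mk' k0 kk' Fpsi' LTy).
  have Cyx : C1 (fun x => conjc (q x) * t x y).
    apply: (le_C1 (g := fun x => K * nc (q x))).
    - apply: cmeasM; first by apply: cmeasJ; exact: C1_meas.
      exact: cmeas_slice2 mt.
    - exact: L1Z (C1_nc Cq).
    - by move=> x; rewrite ncM ncJ mulrC ler_wpM2r ?nc_ge0.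
  rewrite (cintZ (p y) Cyx); congr (_ * _).
  have E x : q x * ip (Dop x psi') (T (Dop y psi)) = conjc (conjc (q x) * t x y).
    by rewrite conjM conjcK /t -(ipJ LTy (L2_D x Lpsi')).
  by under eq_fun do rewrite E; rewrite (cintJ Cyx) conjcK.
apply: (wstar_weak_integral (Ts := Tu) (rho := rho) sV cV bA) => //.
- exact: L1Z (@L1_oneDsqrV R).
- move=> u; have [u0|u0] := leP 0 u.
    have [_ _ /(_ 0 u (lexx 0) u0)] := gmu u.
    by congr V; congr (mulop _ \o _); apply/funext => x; rewrite mul0r expi0 mul1r.
  (* For [u < 0] the vector [Dop (x - u) psi] lives to the right of [x - u] and [Dop x psi'] to the
     left of [x < x - u]. Causality makes the kernel vanish, so [Tu u] is the zero operator. *)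
  have := V_zero sV; congr V; apply/funext => f; apply/funext => x.
  rewrite /Tu /comp /mulop /mu (_ : t x (x - u) = 0) ?mulr0 ?mul0r//.
  apply: (@cT (x - u)); [exact: L2_D|exact: L2_D| |] => z zx; rewrite /Dop.
    by apply: psi0; rewrite subr_lt0.
  by apply: psi'0; lra.
- move=> u; apply: mulD_dominated => //; by case: (gmu u).
- by move=> f g Lf Lg; apply: C1_meas; case: (key f g Lf Lg).
- by move=> f g Lf Lg; case: (key f g Lf Lg).
Qed.

End Reconstruction.

(** * Explicit approximate units at scale [d] *)

Section Theta.
Variable R : realType.
Local Notation C := R[i].
Variable d : R.
Hypothesis d0 : 0 < d.

(** The average of [expi (s * x)] over [0 <= s < d]. It equals 1 at 0, has modulus at most 1 and
    tends to 1 pointwise as [d] tends to 0. *)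
Definition theta (x : R) : C := eb 1 (d * x).

Lemma thetaE x : theta x = real_complex R d^-1 * eb d x.
Proof.
by rewrite /theta (eb_scale x d0) mulrA -rmorphM/= mulVf ?gt_eqF// mul1r.
Qed.

Lemma cmeas_theta : cmeas theta.
Proof.
apply: (cmeas_comp (phi := fun x : R => d * x) (f := @eb R 1)); first exact: meas_mull.
exact: ft_meas (C1_ind 1).
Qed.

Lemma theta_le1 x : nc (theta x) <= 1.
Proof. by have := eb_le 1 (d * x); rewrite normr1. Qed.

Definition phi2 x := theta x * theta x.

Lemma cmeas_phi2 : cmeas phi2.
Proof. by apply: cmeasM; exact: cmeas_theta. Qed.

Lemma phi2_le1 x : nc (phi2 x) <= 1.
Proof. by rewrite ncM mulr_ile1 ?nc_ge0// theta_le1. Qed.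

(** The square of the modulus of [theta] is [d ^- 2] times that of [eb d], and
    [d ^- 2 * (d ^+ 2 + pi ^+ 2)] is the displayed constant. It blows up as [d] tends to 0, which is
    harmless since [d] is fixed while membership in [V] is proved. *)
Lemma phi2_decay x : nc (phi2 x) <= (1 + (pi / d) ^+ 2) / (1 + x ^+ 2).
Proof.
rewrite ncM -expr2 sqr_nc thetaE sqmodM -sqr_nc nc_real ger0_norm ?invr_ge0 ?(ltW d0)//.
apply: le_trans (ler_wpM2l (sqr_ge0 _) (sqmod_eb_le d x)) _.
rewrite mulrA ler_wpM2r ?invr_ge0 ?addr_ge0 ?sqr_ge0// exprVn mulrDr exprMn exprVn.
by rewrite mulVf ?expf_neq0 ?gt_eqF// [_^-1 * _]mulrC.
Qed.

(** Together with [psi'], an approximate identity on one side of 0: [psi] averages over [[0, d[] and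
    [psi'] over [[- d, 0[], where [ind (- d)] equals -1. Their transforms are [kap] and [kap']. *)
Definition psi x : C := real_complex R d^-1 * ind d x.
Definition psi' x : C := - real_complex R d^-1 * ind (- d) x.
Definition kap x := conjc (theta x).
Definition kap' x := expi (d * x) * conjc (theta x).

Lemma cmeas_kap : cmeas kap.
Proof. by apply: cmeasJ; exact: cmeas_theta. Qed.

Lemma cmeas_kap' : cmeas kap'.
Proof. by apply: cmeasM; [exact: cmeas_expiM|exact: cmeas_kap]. Qed.

Lemma kap_le1 x : nc (kap x) <= 1.
Proof. by rewrite ncJ theta_le1. Qed.

Lemma kap'_le1 x : nc (kap' x) <= 1.
Proof. by rewrite ncM nc_expi mul1r kap_le1. Qed.

Lemma ftmZ (z : C) f x : C1 f -> ftm (fun y => z * f y) x = z * ftm f x.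
Proof.
move=> Cf; have Cf' : C1 (fun xi => f xi * expi (- (xi * x))).
  by have := C1_ft (- x) Cf; under eq_fun do rewrite mulrN.
rewrite /ftm -(cintZ z Cf'); congr cint; apply/funext => y; exact/esym/mulrA.
Qed.

Lemma ftm_psi x : ftm psi x = kap x.
Proof.
rewrite ftmZ; last exact: C1_ind.
by rewrite ftm_ft -/(eb d (- x)) -ebJ /kap thetaE conjM conjc_real.
Qed.

Lemma ftm_psi' x : ftm psi' x = kap' x.
Proof.
rewrite ftmZ; last exact: C1_ind.
rewrite ftm_ft -/(eb (- d) (- x)) eb_opp (mulrN d x) opprK -ebJ /kap' thetaE conjM conjc_real.
by rewrite mulrNN mulrCA.
Qed.

End Theta.

Lemma eb1_0 (R : realType) : eb 1 0 = 1 :> R[i].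
Proof.
have [_ h] := @rint_itv R 0 1 ler01.
have E (x : R) : ind 1 x = real_complex R (0 <= x < 1)%R%:R.
  by have := indR_itv x (@ler01 R); rewrite indR0 subr0 /ind => ->.
rewrite /eb /ft; under eq_fun do rewrite mulr0 expi0 mulr1 E.
apply: complex_eq => /=; first by rewrite -[LHS]/(rint _) h subr0.
exact: rint0.
Qed.

Section CausalMembership.
Variable R : realType.
Local Notation C := R[i].
Implicit Types (f g p q : R -> C).
Variable V : set (op R).
Hypothesis sV : op_subspace V.
Hypothesis cV : wstar_closed V.
Hypothesis gV : forall l m, 0 <= l -> 0 <= m -> V (Mop l \o Dop m).
Variables F F' : op R.
Hypothesis uF : unitary F F'.
Hypothesis Fft : forall f, L2fun f -> C1 f -> Defs.ae_eq (F f) (fun x => nrmc R * ftm f x).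
Variable T : op R.
Hypothesis bT : bounded_op T.
Hypothesis cT : causal T.
Hypothesis cS : causal (F \o T \o F').

Let bF := unitary_bounded uF.
Let bF' := unitary_bounded' uF.

Let l2_F f : L2fun f -> l2 (F f) = l2 f.
Proof. by move=> Lf; rewrite /l2 (nsq_unitary uF). Qed.

Let l2_F' f : L2fun f -> l2 (F' f) = l2 f.
Proof. by move=> Lf; rewrite /l2 (nsq_unitary (unitary_sym uF)). Qed.

Definition sandwich p q := F' \o mulop p \o F \o mulop q.

Lemma bounded_sandwich p q : cmeas p -> cmeas q -> (forall x, nc (p x) <= 1) ->
  (forall x, nc (q x) <= 1) -> bounded_op (sandwich p q).
Proof.
move=> mp mq p1 q1; have bp := bounded_mulop mp ler01 p1; have bq := bounded_mulop mq ler01 q1.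
exact: bounded_comp (bounded_comp (bounded_comp bF' bp) bF) bq.
Qed.

Lemma l2_sandwich p q f : cmeas p -> cmeas q -> (forall x, nc (p x) <= 1) ->
  (forall x, nc (q x) <= 1) -> L2fun f -> l2 (sandwich p q f) <= l2 f.
Proof.
move=> mp mq p1 q1 Lf; have LM := L2_bounded mq q1 Lf; have LF := op_L2 bF LM.
rewrite /sandwich /comp l2_F'; last exact: L2_bounded mp p1 LF.
apply: le_trans (mulop_le mp ler01 p1 LF) _; rewrite mul1r l2_F//.
by apply: le_trans (mulop_le mq ler01 q1 Lf) _; rewrite mul1r.
Qed.

Lemma sandwich_cvg (p q : nat -> R -> C) f : (forall n, cmeas (p n)) -> (forall n, cmeas (q n)) ->
  (forall n x, nc (p n x) <= 1) -> (forall n x, nc (q n x) <= 1) ->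
  (forall x, ccvg (p ^~ x) 1) -> (forall x, ccvg (q ^~ x) 1) -> L2fun f ->
  l2 (fun x => sandwich (p n) (q n) f x - F' (F f) x) @[n --> \oo] --> 0.
Proof.
move=> mp mq p1 q1 pc qc Lf; have Lq n := L2_bounded (mq n) (q1 n) Lf.
have LFq n := op_L2 bF (Lq n); have LF := op_L2 bF Lf.
apply: (op_cvg (u := fun n => mulop (p n) (F (mulop (q n) f))) bF') => //.
  by move=> n; exact: L2_bounded (mp n) (p1 n) (LFq n).
apply: mulop_cvg1 => //; apply: (op_cvg (u := fun n => mulop (q n) f) bF) => //.
apply: (mulop_cvg1 (u := fun=> f)) => //.
by rewrite l2_subrr; exact: cvg_cst.
Qed.

Definition smooth d := sandwich (@kap R d) (@phi2 R d).
(** This operator enters through its adjoint, which undoes the conjugation: both cutoffs in the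
    kernel become [phi2] itself, whose frequencies are nonnegative, whereas those of its conjugate
    are not. *)
Definition smooth' d := sandwich (@kap' R d) (fun x => conjc (@phi2 R d x)).

Lemma phi2J_le1 d x : nc (conjc (@phi2 R d x)) <= 1.
Proof. by rewrite ncJ phi2_le1. Qed.

Lemma bounded_smooth d : bounded_op (smooth d).
Proof. exact: bounded_sandwich (cmeas_kap d) (cmeas_phi2 d) (kap_le1 d) (phi2_le1 d). Qed.

Lemma bounded_smooth' d : bounded_op (smooth' d).
Proof. exact: bounded_sandwich (cmeas_kap' d) (cmeasJ (cmeas_phi2 d)) (kap'_le1 d) (phi2J_le1 d). Qed.

Lemma l2_smooth d f : L2fun f -> l2 (smooth d f) <= l2 f.
Proof. exact: l2_sandwich (cmeas_kap d) (cmeas_phi2 d) (kap_le1 d) (phi2_le1 d). Qed.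

Lemma l2_smooth' d f : L2fun f -> l2 (smooth' d f) <= l2 f.
Proof. exact: l2_sandwich (cmeas_kap' d) (cmeasJ (cmeas_phi2 d)) (kap'_le1 d) (phi2J_le1 d). Qed.

Lemma smoothed_mem d : 0 < d -> exists2 A, V A &
  forall f g, L2fun f -> L2fun g -> ip (A f) g = ip (T (smooth d f)) (smooth' d g).
Proof.
move=> d0.
have bsm := bounded_smooth d; have bsm' := bounded_smooth' d.
have [B bB hB] := adjoint bsm'.
have bA : bounded_op (B \o T \o smooth d) by exact: bounded_comp (bounded_comp bB bT) bsm.
have hA f g : L2fun f -> L2fun g ->
    ip ((B \o T \o smooth d) f) g = ip (T (smooth d f)) (smooth' d g).
  move=> Lf Lg; have LT := op_L2 bT (op_L2 bsm Lf).
  rewrite (ipJ Lg (op_L2 bB LT)) -(hB _ _ Lg LT).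
  by rewrite -(ipJ (op_L2 bsm' Lg) LT).
exists (B \o T \o smooth d); last exact: hA.
have Lp : L2fun (@psi R d) by apply: L2Z; exact: L2_ind.
have Lp' : L2fun (@psi' R d) by apply: L2Z; exact: L2_ind.
have Cp : C1 (@psi R d) by apply: C1Z; exact: C1_ind.
have Cp' : C1 (@psi' R d) by apply: C1Z; exact: C1_ind.
apply: (kernel_mem sV cV gV uF Fft bT cT cS (phi := @phi2 R d) (psi := @psi R d)
  (psi' := @psi' R d) (kap := @kap R d) (kap' := @kap' R d) (k := 1)
  (c := 1 + (pi / d) ^+ 2) bA Lp Lp').
- move=> x x0; rewrite /psi /ind /indR (lt_geF x0)/= x0 andbT.
  have -> : (d <= x) = false by apply/negbTE; rewrite -ltNge; exact: lt_trans x0 d0.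
  by rewrite subrr mulr0.
- move=> x x0; rewrite /psi' /ind /indR x0 (le_gtF x0) andbF /=.
  have -> : (x < - d) = false by apply/negbTE; rewrite -leNgt; apply: le_trans x0; rewrite oppr_le0 ltW.
  by rewrite subrr mulr0.
- exact: cmeas_kap.
- exact: cmeas_kap'.
- exact: ler01.
- exact: kap_le1.
- exact: kap'_le1.
- by apply: aeS (Fft Lp Cp) => x ->; rewrite (ftm_psi d0).
- by apply: aeS (Fft Lp' Cp') => x ->; rewrite (ftm_psi' d0).
- exact: cmeas_phi2.
- by rewrite addr_ge0 ?sqr_ge0.
- exact: phi2_decay.
- move=> u q gq.
  have gth p : good V p -> good V (fun x => theta d (x - u) * p x).
    move=> gp; have := goodZ sV (real_complex R d^-1) (good_eb sV cV gV u (ltW d0) gp).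
    by under eq_fun do rewrite mulrA -thetaE//.
  by have := gth _ (gth _ gq); under eq_fun do rewrite mulrA.
- exact: hA.
Qed.

(** As [d = 1 / (n + 1)] tends to 0, all multipliers in the smoothings stay bounded by 1 and tend to
    1 pointwise. The smoothings are thus contractions converging strongly to the identity, and the
    operators from [smoothed_mem] converge weakly to [T] with the bound of [T]. *)
Theorem bicausal_mem : V T.
Proof.
pose d n : R := n.+1%:R^-1.
have d0 n : 0 < d n by rewrite invr_gt0.
have ex n := cid2 (smoothed_mem (d0 n)).
pose A n := s2val (ex n).
have VA n : V (A n) by exact: (s2valP (ex n)).
have hA n : forall f g, L2fun f -> L2fun g ->
  ip (A n f) g = ip (T (smooth (d n) f)) (smooth' (d n) g) by exact: (s2valP' (ex n)).
have cd x : d n * x @[n --> \oo] --> 0.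
  by rewrite -(mul0r x); apply: cvgMl; exact: cvg_harmonic.
have cth x : ccvg (fun n => theta (d n) x) 1.
  by rewrite -(eb1_0 R); exact: ft_seq (C1_ind 1) (cd x).
have cJ (u : nat -> C) (l : C) : ccvg u l -> ccvg (fun n => conjc (u n)) (conjc l).
  by move=> h; apply: cvg0_le h => n; [exact: nc_ge0|rewrite -conjB ncJ].
have cM (u v : nat -> C) : (forall n, nc (u n) <= 1) -> ccvg u 1 -> ccvg v 1 ->
    ccvg (fun n => u n * v n) 1.
  move=> u1 hu hv; apply: cvg0_le (cvg0D hu hv) => n; first exact: nc_ge0.
  have -> : u n * v n - 1 = (u n - 1) + u n * (v n - 1) by ring.
  by apply: le_trans (ncD _ _) _; rewrite lerD2l ncM ler_piMl ?nc_ge0.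
have ck x : ccvg (fun n => kap (d n) x) 1 by rewrite -(conjc1 R); exact: cJ.
have ck' x : ccvg (fun n => kap' (d n) x) 1.
  apply: cM; [by move=> n; rewrite nc_expi| |exact: ck].
  by rewrite -(expi0 R); exact: ccvg_expi (cd x).
have cp x : ccvg (fun n => phi2 (d n) x) 1.
  by apply: cM => // n; exact: theta_le1.
have cp' x : ccvg (fun n => conjc (phi2 (d n) x)) 1 by rewrite -(conjc1 R); exact: cJ.
have csm f : L2fun f -> l2 (fun x => smooth (d n) f x - F' (F f) x) @[n --> \oo] --> 0.
  move=> Lf; apply: (sandwich_cvg (p := fun n => kap (d n)) (q := fun n => phi2 (d n))) => // n.
  - exact: cmeas_kap.
  - exact: cmeas_phi2.
  - exact: kap_le1.
  - exact: phi2_le1.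
have csm' f : L2fun f -> l2 (fun x => smooth' (d n) f x - F' (F f) x) @[n --> \oo] --> 0.
  move=> Lf; apply: (sandwich_cvg (p := fun n => kap' (d n))
    (q := fun n x => conjc (phi2 (d n) x))) => // n.
  - exact: cmeas_kap'.
  - exact: cmeasJ (cmeas_phi2 _).
  - exact: kap'_le1.
  - exact: phi2J_le1.
have [k k0 hk] := op_bound bT.
apply: (wstar_weak_limit (k := k) sV cV bT VA).
- move=> n f g Lf Lg; rewrite hA//; have Ls := op_L2 (bounded_smooth (d n)) Lf.
  apply: le_trans (ip_le (op_L2 bT Ls) (op_L2 (bounded_smooth' (d n)) Lg)) _.
  rewrite mulrA; apply: ler_pM; rewrite ?l2_ge0//; last exact: l2_smooth'.
  by apply: le_trans (hk _ Ls) _; rewrite ler_wpM2l//; exact: l2_smooth.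
- move=> f g Lf Lg; under eq_fun do rewrite (hA _ _ _ Lf Lg).
  have LFf := op_L2 bF' (op_L2 bF Lf); have LFg := op_L2 bF' (op_L2 bF Lg).
  have FF f' := @unitaryK _ _ _ uF f'.
  rewrite -(ip_ae (op_L2 bT LFf) (op_L2 bT Lf) LFg Lg (op_ae bT LFf Lf (FF _ Lf)) (FF _ Lg)).
  apply: cvg0_ip.
  + by move=> n; exact: op_L2 bT (op_L2 (bounded_smooth _) Lf).
  + by move=> n; exact: op_L2 (bounded_smooth' _) Lg.
  + exact: op_L2.
  + exact: LFg.
  + by apply: (op_cvg bT) => //; [move=> n; exact: op_L2 (bounded_smooth _) Lf|exact: csm].
  + exact: csm'.
Qed.

End CausalMembership.

(** * The algebra of bicausal operators *)

Section OpAlgebra.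
Variable R : realType.
Local Notation C := R[i].
Implicit Types (f g : R -> C) (T S X : op R).

Lemma bounded_zero : bounded_op (@op_zero R).
Proof.
apply: (@opI R _ 0) => // [f Lf|f g Lf Lg _|a f g Lf Lg|f Lf].
- exact: L20.
- exact: ae_refl.
- by apply: aeW => x; rewrite /op_zero mulr0 addr0.
- by rewrite mul0r l2_0.
Qed.

Lemma bounded_scale a T : bounded_op T -> bounded_op (op_scale a T).
Proof.
move=> bT; have [k k0 hk] := op_bound bT.
apply: (@opI R _ (nc a * k)) => [|f Lf|f g Lf Lg fg|b f g Lf Lg|f Lf].
- by rewrite mulr_ge0 ?nc_ge0.
- by apply: L2Z; exact: op_L2.
- by apply: aeS (op_ae bT Lf Lg fg) => x E; rewrite /op_scale E.
- by apply: aeS (op_lin b bT Lf Lg) => x E; rewrite /op_scale E; ring.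
- have LT := op_L2 bT Lf; rewrite (l2Z a LT) -mulrA ler_wpM2l ?nc_ge0//; exact: hk.
Qed.

Lemma bounded_add T S : bounded_op T -> bounded_op S -> bounded_op (op_add T S).
Proof.
move=> bT bS; have [k k0 hk] := op_bound bT; have [m m0 hm] := op_bound bS.
apply: (@opI R _ (k + m)) => [|f Lf|f g Lf Lg fg|b f g Lf Lg|f Lf].
- exact: addr_ge0.
- by apply: L2D; exact: op_L2.
- apply: aeS (aeI (op_ae bT Lf Lg fg) (op_ae bS Lf Lg fg)) => x [E E'].
  by rewrite /op_add E E'.
- apply: aeS (aeI (op_lin b bT Lf Lg) (op_lin b bS Lf Lg)) => x [E E'].
  rewrite /op_add E E'; ring.
- apply: le_trans (l2D (op_L2 bT Lf) (op_L2 bS Lf)) _; rewrite mulrDl.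
  by apply: lerD; [exact: hk|exact: hm].
Qed.

Lemma op_vanish T : bounded_op T -> Defs.ae_eq (T (fun=> 0)) (fun=> 0).
Proof.
move=> bT; have L0 : L2fun (fun=> 0 : C) := @L20 R.
have := op_lin (-1) bT L0 L0.
have -> : (fun t : R => -1 * (0 : C) + 0) = fun=> 0 by apply/funext => t; rewrite mulr0 addr0.
by apply: aeS => x ->; rewrite mulN1r addNr.
Qed.

Lemma op_homog T a f : bounded_op T -> L2fun f ->
  Defs.ae_eq (T (fun x => a * f x)) (fun x => a * T f x).
Proof.
move=> bT Lf; have := op_lin a bT Lf (@L20 R).
have -> : (fun t => a * f t + 0) = (fun t => a * f t) by apply/funext => t; rewrite addr0.
by move=> h; apply: aeS (aeI h (op_vanish bT)) => x [-> ->]; rewrite addr0.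
Qed.

Lemma op_additive T f g : bounded_op T -> L2fun f -> L2fun g ->
  Defs.ae_eq (T (fun x => f x + g x)) (fun x => T f x + T g x).
Proof.
move=> bT Lf Lg; have := op_lin 1 bT Lf Lg.
have -> : (fun t => 1 * f t + g t) = (fun t => f t + g t).
  by apply/funext => t; rewrite mul1r.
by apply: aeS => x ->; rewrite mul1r.
Qed.

Lemma causal_op_eq T S : bounded_op T -> bounded_op S -> op_eq T S -> causal T -> causal S.
Proof.
move=> bT bS TS cT t f g Lf Lg f0 g0; rewrite -(cT t f g Lf Lg f0 g0).
apply: ip_ae => //; [exact: op_L2|exact: op_L2| |exact: ae_refl].
by apply: ae_sym; exact: TS.
Qed.

(** Causality is tested against the part of [S f] lying to the left of [t]; that part is then
    orthogonal to itself. *)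
Lemma causal_support S t f : bounded_op S -> causal S -> L2fun f -> (forall x, x < t -> f x = 0) ->
  Defs.ae_eq (S f) (tail t (S f)).
Proof.
move=> bS cS Lf f0; set h := S f; have Lh : L2fun h := op_L2 bS Lf.
have Lt := L2_tail t Lh; have Lw := L2B Lh Lt.
pose w x := h x - tail t h x.
have w0 x : t <= x -> w x = 0 by move=> tx; rewrite /w tailE tx subrr.
have e1 : ip h w = 0 by exact: (cS t).
have e2 : ip (tail t h) w = 0.
  rewrite ipE (_ : (fun x => _) = fun=> 0) ?cint0//; apply/funext => x.
  have [tx|xt] := leP t x; first by rewrite w0// conjc0 mulr0.
  by rewrite tailE leNgt xt mul0r.
have : ip w w = 0 by rewrite ipBl// e1 e2 subrr.
rewrite ip_self => /(congr1 (@complex.Re R)) /= /(nsq_eq0 Lw).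
by apply: aeS => x /eqP; rewrite subr_eq0 => /eqP.
Qed.

(** [S f] vanishes to the left of [t] only almost everywhere, so its truncation is fed to [T]
    instead. *)
Lemma causal_comp T S : bounded_op T -> bounded_op S -> causal T -> causal S -> causal (T \o S).
Proof.
move=> bT bS cT cS t f g Lf Lg f0 g0; have LS := op_L2 bS Lf; have Lt := L2_tail t LS.
have -> : ip ((T \o S) f) g = ip (T (tail t (S f))) g.
  apply: (ip_ae (op_L2 bT LS) (op_L2 bT Lt) Lg Lg _ (ae_refl _)).
  by apply: (op_ae bT LS Lt); exact: causal_support.
by apply: (cT t) => // x xt; rewrite tailE leNgt xt.
Qed.

Lemma causal_M l : causal (@Mop R l).
Proof.
move=> t f g _ _ f0 g0; rewrite ipE (_ : (fun x => _) = fun=> 0) ?cint0//.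
apply/funext => x; have [tx|xt] := leP t x; first by rewrite g0// conjc0 mulr0.
by rewrite /Mop f0// mulr0 mul0r.
Qed.

Lemma causal_D m : 0 <= m -> causal (@Dop R m).
Proof.
move=> m0 t f g _ _ f0 g0; rewrite ipE (_ : (fun x => _) = fun=> 0) ?cint0//.
apply/funext => x; have [tx|xt] := leP t x; first by rewrite g0// conjc0 mulr0.
rewrite /Dop f0 ?mul0r//; lra.
Qed.

Lemma causal_add T S : bounded_op T -> bounded_op S -> causal T -> causal S -> causal (op_add T S).
Proof.
move=> bT bS cT cS t f g Lf Lg f0 g0; rewrite ipDl//; [|exact: op_L2..].
by rewrite (cT t)// (cS t)// addr0.
Qed.

Lemma causal_scale a T : bounded_op T -> causal T -> causal (op_scale a T).
Proof.
move=> bT cT t f g Lf Lg f0 g0; rewrite ipZl//; last exact: op_L2.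
by rewrite (cT t)// mulr0.
Qed.

Lemma eq0_of_sqmod_lt (z : C) : (forall e : R, 0 < e -> sqmod z < e ^+ 2) -> z = 0.
Proof.
move=> h; apply: nc_eq0; apply/le_anti; rewrite nc_ge0 andbT.
rewrite leNgt; apply/negP => z0; have := h _ z0.
by rewrite sqr_nc ltxx.
Qed.

End OpAlgebra.

(** * Conjugation by a unitary and the comparison of the two topologies *)

Section Conjugation.
Variable R : realType.
Local Notation C := R[i].
Implicit Types (f g : R -> C) (T S X : op R) (V : set (op R)).
Variables W W' : op R.
Hypothesis uW : unitary W W'.

Let bW := unitary_bounded uW.
Let bW' := unitary_bounded' uW.

Lemma conj_bounded X : bounded_op X -> bounded_op (W \o X \o W').
Proof. by move=> bX; exact: bounded_comp (bounded_comp bW bX) bW'. Qed.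

(** Conjugation turns the normal functional with vectors [x n], [y n] into the one with vectors
    [W' (x n)], [W' (y n)], which have the same norms. Stability under sums and multiples goes
    through [wstar_op_eq], as [W] is linear only modulo null sets. *)
Lemma wstar_conj V : op_subspace V -> wstar_closed V ->
  let U := [set X | bounded_op X /\ V (W \o X \o W')] in op_subspace U /\ wstar_closed U.
Proof.
move=> sV cV; have [Vb [V0 [VD VZ]]] := sV; split; first (split; [|split; [|split]]).
- by move=> X [].
- split; first exact: bounded_zero.
  apply: (wstar_op_eq sV cV _ V0); first by apply: conj_bounded; exact: bounded_zero.
  by move=> f Lf; apply: ae_sym; exact: op_vanish bW.
- move=> X Y [bX VX] [bY VY]; split; first exact: bounded_add.
  apply: (wstar_op_eq sV cV _ (VD _ _ VX VY)); first by apply: conj_bounded; exact: bounded_add.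
  move=> f Lf; have Lf' := op_L2 bW' Lf.
  by apply: ae_sym; exact: (op_additive bW (op_L2 bX Lf') (op_L2 bY Lf')).
- move=> a X [bX VX]; split; first exact: bounded_scale.
  apply: (wstar_op_eq sV cV _ (VZ a _ VX)); first by apply: conj_bounded; exact: bounded_scale.
  move=> f Lf; have Lf' := op_L2 bW' Lf.
  by apply: ae_sym; exact: (op_homog a bW (op_L2 bX Lf')).
move=> X [bX hX]; split => //; apply: cV; split; first exact: conj_bounded.
move=> k x y nd e e0.
have nd' i : normal_data (fun n => W' (x i n)) (fun n => W' (y i n)).
  have [Lx [Ly [cx cy]]] := nd i; split; first by move=> n; exact: op_L2.
  split; first by move=> n; exact: op_L2.
  have nW (z : nat -> R -> C) (Lz : forall n, L2fun (z n)) :=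
    funext (fun n => nsq_unitary (unitary_sym uW) (Lz n)).
  by rewrite (nW _ Lx) (nW _ Ly).
have [Y [bY VY] hY] := hX k _ _ nd' e e0.
exists (W \o Y \o W'); [exact: VY|move=> i; have [Lx [Ly _]] := nd i].
rewrite (_ : omega _ _ _ = omega (fun n => W' (x i n)) (fun n => W' (y i n)) (op_sub X Y)); first exact: hY.
rewrite /omega; congr csum; apply/funext => n.
have Lx' := op_L2 bW' (Lx n); have Ly' := op_L2 bW' (Ly n).
have LX := op_L2 bX Lx'; have LY := op_L2 bY Lx'.
have LWX := op_L2 bW LX; have LWY := op_L2 bW LY.
by rewrite (ipBl LWX LWY (Ly n)) (ipBl LX LY Ly') (unitary_adj uW LX (Ly n)) (unitary_adj uW LY (Ly n)).
Qed.

End Conjugation.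

Section WotWstar.
Variable R : realType.
Local Notation C := R[i].
Implicit Types (f g : R -> C) (T S X : op R) (V : set (op R)).

Lemma rsum_single (c : R) : rsum (fun n => if n is 0%N then c else 0) = c.
Proof.
apply: lim_near_cst => //; exists 1%N => // n /= n1; rewrite /series /= big_ltn//.
by rewrite big_nat_cond big1 ?addr0// => -[].
Qed.

Lemma csum_single (u : nat -> C) : (forall n, u n.+1 = 0) -> csum u = u 0%N.
Proof.
move=> u0; apply: complex_eq => /=.
  rewrite -[RHS]rsum_single; congr rsum; apply/funext => -[|n] //.
  by rewrite u0.
rewrite -[RHS]rsum_single; congr rsum; apply/funext => -[|n] //.
by rewrite u0.
Qed.

(** A vector functional is the normal functional whose sequences have a single nonzero term, so weak
    operator neighbourhoods are among the weak-star ones. *)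
Lemma wot_wstar_closed V : wot_closed V -> wstar_closed V.
Proof.
move=> cV X [bX hX]; apply: cV; split => // k x y Lx Ly e e0.
pose single (f : R -> C) (n : nat) : R -> C := if n is 0%N then f else fun=> 0.
have Ls f : L2fun f -> forall n, L2fun (single f n).
  by move=> Lf [|n] //; exact: L20.
have cs f : cvgn (series (fun n => nsq (single f n))).
  apply/cvg_ex; exists (nsq f); apply: cvg_near_cst.
  exists 1%N => // n /= n1; rewrite /series /= big_ltn//.
  rewrite big_nat_cond big1 ?addr0// => -[|i]//= _.
  exact: nsq0.
have nd i : normal_data (single (x i)) (single (y i)).
  split; first exact: Ls; split; first exact: Ls; by split; exact: cs.
have [Y VY hY] := hX k _ _ nd e e0; exists Y => // i; have := hY i.
by rewrite /omega csum_single// => n; rewrite ip0r.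
Qed.

End WotWstar.

Section Bicausal.
Variable R : realType.
Local Notation C := R[i].
Implicit Types (f g : R -> C) (T S X : op R) (V : set (op R)).
Variables F F' : op R.
Hypothesis uF : unitary F F'.
Hypothesis Fft : forall f, L2fun f -> C1 f -> Defs.ae_eq (F f) (fun x => nrmc R * ftm f x).

Let bF := unitary_bounded uF.
Let bF' := unitary_bounded' uF.

Definition bicausal : set (op R) :=
  [set T | bounded_op T /\ causal T /\ causal (F \o T \o F')].

Lemma conj_op_eq X Y : op_eq (F \o X) (Y \o F) -> bounded_op Y -> op_eq Y (F \o X \o F').
Proof.
move=> h bY f Lf; have Lf' := op_L2 bF' Lf.
apply: ae_sym; apply: ae_trans (h _ Lf') _.
exact: (op_ae bY (op_L2 bF Lf') Lf (unitaryK' uF Lf)).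
Qed.

(** Multiplications are causal for either sign of the frequency, translations only for [m >= 0].
    Hence [l >= 0] is detected on the Fourier side, where [Mop l] becomes [Dop l], and the sign of a
    translation is detected directly. *)
Lemma bicausal_M l : 0 <= l -> bicausal (@Mop R l).
Proof.
move=> l0; split; first exact: bounded_M; split; first exact: causal_M.
have [FM _] := fourier_MD uF Fft.
apply: (causal_op_eq (bounded_D l)); last exact: causal_D.
  by apply: conj_bounded => //; exact: bounded_M.
by apply: conj_op_eq; [exact: FM|exact: bounded_D].
Qed.

Lemma bicausal_D m : 0 <= m -> bicausal (@Dop R m).
Proof.
move=> m0; split; first exact: bounded_D; split; first exact: causal_D.
have [_ FD] := fourier_MD uF Fft.
apply: (causal_op_eq (bounded_M (- m))); last exact: causal_M.
  by apply: conj_bounded => //; exact: bounded_D.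
by apply: conj_op_eq; [exact: FD|exact: bounded_M].
Qed.

Lemma bicausal_subalgebra : op_subalgebra bicausal.
Proof.
have bc T : bounded_op T -> bounded_op (F \o T \o F') by move=> bT; exact: conj_bounded.
split; first (split; [|split; [|split]]).
- by move=> T [].
- split; first exact: bounded_zero.
  split; first by move=> t f g *; exact: ip0l.
  apply: (@causal_op_eq R (@op_zero R)); [exact: bounded_zero|apply: bc; exact: bounded_zero| |].
    by move=> f Lf; apply: ae_sym; exact: op_vanish bF.
  by move=> t f g *; exact: ip0l.
- move=> T S [bT [cT cT']] [bS [cS cS']]; split; first exact: bounded_add.
  split; first exact: causal_add.
  apply: (causal_op_eq (bounded_add (bc _ bT) (bc _ bS)) (bc _ (bounded_add bT bS))).
    move=> f Lf; have Lf' := op_L2 bF' Lf.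
    by apply: ae_sym; exact: (op_additive bF (op_L2 bT Lf') (op_L2 bS Lf')).
  by apply: causal_add; [exact: bc|exact: bc|exact: cT'|exact: cS'].
- move=> a T [bT [cT cT']]; split; first exact: bounded_scale.
  split; first exact: causal_scale.
  apply: (causal_op_eq (bounded_scale a (bc _ bT)) (bc _ (bounded_scale a bT))).
    move=> f Lf; have Lf' := op_L2 bF' Lf.
    by apply: ae_sym; exact: (op_homog a bF (op_L2 bT Lf')).
  by apply: causal_scale; [exact: bc|exact: cT'].
move=> T S [bT [cT cT']] [bS [cS cS']]; have bTS := bounded_comp bT bS.
split => //; split; first exact: causal_comp.
apply: (causal_op_eq (bounded_comp (bc _ bT) (bc _ bS)) (bc _ bTS)); last first.
  by apply: causal_comp; [exact: bc|exact: bc|exact: cT'|exact: cS'].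
move=> f Lf; have LS := op_L2 bS (op_L2 bF' Lf).
have LS' := op_L2 bF' (op_L2 bF LS).
apply: (op_ae bF (op_L2 bT LS') (op_L2 bT LS)).
exact: (op_ae bT LS' LS (unitaryK uF LS)).
Qed.

(** Both conditions say that certain vector functionals vanish, and a vector functional that
    vanishes on a set vanishes on its WOT closure. *)
Lemma bicausal_wot_closed : wot_closed bicausal.
Proof.
move=> T [bT hT].
have key f g : L2fun f -> L2fun g -> (forall X, bicausal X -> ip (X f) g = 0) -> ip (T f) g = 0.
  move=> Lf Lg h; apply: eq0_of_sqmod_lt => e e0.
  have [X bX] := hT 1%N (fun=> f) (fun=> g) (fun=> Lf) (fun=> Lg) e e0.
  move=> /(_ ord0); have bX' : bounded_op X by case: bX.
  by rewrite (ipBl (op_L2 bT Lf) (op_L2 bX' Lf) Lg) (h X bX) subr0.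
split => //; split => t f g Lf Lg f0 g0.
  by apply: key => // X [bX [cX _]]; exact: (cX t).
have Lf' := op_L2 bF' Lf; have Lg' := op_L2 bF' Lg.
(* Moving [F] to the other vector exhibits the second condition as a vector functional of [T]
   itself. *)
rewrite (unitary_adj uF (op_L2 bT Lf') Lg); apply: key => // X [bX [_ cX]].
by rewrite -(unitary_adj uF (op_L2 bX Lf') Lg); exact: (cX t).
Qed.

End Bicausal.

(** [bicausal] is one of the WOT-closed algebras intersected in [A_p], so each member of [A_p] is
    bicausal and [bicausal_mem] applies to it. *)
Theorem A_p_sub (R : realType) (V : set (op R)) : op_subspace V -> wstar_closed V ->
  (forall l m, 0 <= l -> 0 <= m -> V (Mop l \o Dop m)) -> @A_p R `<=` V.
Proof.
move=> sV cV gV T hT; have [F [F' [uF Fft]]] := @fourier R.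
have [bT [cT cS]] : bicausal F F' T.
  apply: hT; split; first exact: bicausal_subalgebra.
  split; first exact: bicausal_wot_closed.
  by split => *; [exact: bicausal_M|exact: bicausal_D].
exact: (bicausal_mem sV cV gV uF Fft).
Qed.

(** * Metaplectic operators *)

Section Metaplectic.
Variable R : realType.
Local Notation C := R[i].
Implicit Types (W : op R) (p q : R * R) (g h : R * R -> R * R).

Definition MD p : op R := Mop p.1 \o Dop p.2.

Lemma bounded_MD p : bounded_op (MD p).
Proof. exact: bounded_comp (bounded_M _) (bounded_D _). Qed.

(** The scalar is the phase of a projective representation. It is left unspecified, since linear
    subspaces absorb it; being nonzero, it can be inverted in [implements_sym]. *)
Definition implements W W' (g : R * R -> R * R) := unitary W W' /\
  forall p, exists2 z : C, z != 0 & op_eq (W \o MD p \o W') (op_scale z (MD (g p))).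

Lemma implements_comp W1 W1' W2 W2' g1 g2 : implements W1 W1' g1 -> implements W2 W2' g2 ->
  implements (W2 \o W1) (W1' \o W2') (g2 \o g1).
Proof.
move=> [u1 h1] [u2 h2]; have b1 := unitary_bounded u1; have b1' := unitary_bounded' u1.
have b2 := unitary_bounded u2; have b2' := unitary_bounded' u2.
split.
  split; first exact: bounded_comp; split; first exact: bounded_comp.
  split.
    move=> f Lf; have L2 := op_L2 b2' Lf; have L1 := op_L2 b1 (op_L2 b1' L2).
    exact: ae_trans (op_ae b2 L1 L2 (unitaryK' u1 L2)) (unitaryK' u2 Lf).
  split.
    move=> f Lf; have L1 := op_L2 b1 Lf; have L2 := op_L2 b2' (op_L2 b2 L1).
    exact: ae_trans (op_ae b1' L2 L1 (unitaryK u2 L1)) (unitaryK u1 Lf).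
  move=> f g Lf Lg; have Lf1 := op_L2 b1 Lf; have Lg1 := op_L2 b1 Lg.
  exact: etrans (unitary_ip u2 Lf1 Lg1) (unitary_ip u1 Lf Lg).
move=> p; have [z z0 hz] := h1 p; have [w w0 hw] := h2 (g1 p).
exists (z * w); first by rewrite mulf_neq0.
move=> f Lf; have L2 := op_L2 b2' Lf; have LM := op_L2 (bounded_MD (g1 p)) L2.
have L1 : L2fun ((W1 \o MD p \o W1') (W2' f)).
  by apply: op_L2 L2; apply: bounded_comp => //; apply: bounded_comp => //; exact: bounded_MD.
apply: ae_trans (op_ae b2 L1 (L2Z z LM) (hz _ L2)) _.
apply: ae_trans (op_homog z b2 LM) _.
by apply: aeS (hw _ Lf) => x; rewrite /op_scale -mulrA => <-.
Qed.

Lemma implements_sym W W' g h : implements W W' g -> (forall p, g (h p) = p) -> implements W' W h.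
Proof.
move=> [u hg] gh; have bW := unitary_bounded u; have bW' := unitary_bounded' u.
split; first exact: unitary_sym.
move=> p; have [z z0 hz] := hg (h p); exists z^-1; first by rewrite invr_eq0.
rewrite gh in hz; move=> f Lf; have LW := op_L2 bW Lf.
have Lp := op_L2 (bounded_MD p) LW; have Lh := op_L2 (bounded_MD (h p)) Lf.
have LWh := op_L2 bW Lh; have LWW := op_L2 bW' LW.
have LhW := op_L2 (bounded_MD (h p)) LWW.
have e1 : Defs.ae_eq (MD p (W f)) (fun x => z^-1 * W (MD (h p) f) x).
  apply: ae_trans (_ : Defs.ae_eq _ (fun x => z^-1 * W (MD (h p) (W' (W f))) x)) _.
    by apply: aeS (hz _ LW) => x E; rewrite [X in _ * X]E /op_scale mulrA mulVf// mul1r.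
  have := op_ae bW LhW Lh (op_ae (bounded_MD (h p)) LWW Lf (unitaryK u Lf)).
  by apply: aeS => x ->.
apply: ae_trans (op_ae bW' Lp (L2Z _ LWh) e1) _.
apply: ae_trans (op_homog _ bW' LWh) _.
by apply: aeS (unitaryK u Lh) => x ->.
Qed.

Lemma implements_fourier : exists F F' : op R, implements F F' (fun p => (- p.2, p.1)).
Proof.
have [F [F' [uF Fft]]] := @fourier R; have [FM FD] := fourier_MD uF Fft.
have bF := unitary_bounded uF; have bF' := unitary_bounded' uF.
(* [F] turns [M_l D_m] into [D_l M_(-m)]; restoring the order costs the phase [expi (l * m)]. *)
exists F, F'; split => // p; exists (expi (p.1 * p.2)); first exact: expi_neq0.
move=> f Lf; have L1 := op_L2 bF' Lf; have L2 := L2_D p.2 L1.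
have L3 := op_L2 bF L1; have L4 := op_L2 (bounded_M (- p.2)) L3.
have L5 := op_L2 bF L2.
have L6 := op_L2 (bounded_M (- p.2)) Lf.
apply: ae_trans (FM p.1 _ L2) _.
apply: ae_trans (op_ae (bounded_D p.1) L5 L4 (FD p.2 _ L1)) _.
apply: ae_trans (op_ae (bounded_D p.1) L4 L6 (op_ae (bounded_M (- p.2)) L3 Lf (unitaryK' uF Lf))) _.
apply: aeW => x; rewrite /op_scale /MD /comp /Dop /Mop mulrA -expiD.
by congr (expi _ * _) => /=; ring.
Qed.

(** Multiplication by [expi (s * x ^+ 2 / 2)] commutes with every [M_l], and conjugating [D_m] by it
    leaves the exponent [s * (x ^+ 2 - (x - m) ^+ 2) / 2 = s * m * x - s * m ^+ 2 / 2]: a frequency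
    shift by [s * m] and a constant phase. *)
Lemma implements_chirp s : exists W W' : op R, implements W W' (fun p => (p.1 + s * p.2, p.2)).
Proof.
pose c (t x : R) : C := expi (t * x ^+ 2 / 2).
have mc t : cmeas (c t).
  apply: cmeas_expi; apply: measurable_funM; last exact: measurable_cst.
  by apply: measurable_funM; [exact: measurable_cst|exact: measurable_funX].
have c1 t x : nc (c t x) <= 1 by rewrite nc_expi.
have bc t : bounded_op (mulop (c t)) by exact: bounded_mulop (mc t) ler01 (c1 t).
have cK t x : c t x * c (- t) x = 1.
  by rewrite /c -expiD (_ : _ + _ = 0) ?expi0//; ring.
exists (mulop (c s)), (mulop (c (- s))); split.
  split; first exact: bc; split; first exact: bc.
  split; first by move=> f _; apply: aeW => x /=; rewrite /mulop mulrA cK mul1r.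
  split.
    move=> f _; apply: aeW => x /=; rewrite /mulop mulrA.
    by have := cK (- s) x; rewrite opprK => ->; rewrite mul1r.
  move=> f g _ _; rewrite !ipE; congr cint; apply/funext => x.
  rewrite /mulop conjM mulrACA (_ : c s x * _ = 1) ?mul1r//.
  by rewrite /c expiJ -expiD subrr expi0.
move=> p; exists (expi (- (s * p.2 ^+ 2 / 2))); first exact: expi_neq0.
move=> f Lf; apply: aeW => x.
rewrite /op_scale /MD /comp /mulop /Mop /Dop /c !mulrA -!expiD.
by congr (expi _ * _) => /=; field.
Qed.

Definition mx2 (a b c d : R) p : R * R := (a * p.1 + b * p.2, c * p.1 + d * p.2).

Lemma implements_eq W W' g h : implements W W' g -> g =1 h -> implements W W' h.
Proof. by move=> [u H] gh; split => // p; rewrite -gh. Qed.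

(** A chirp conjugated by the quarter turn; the turn exchanges the coordinates and reverses one of
    them, hence the parameter [- s]. *)
Lemma implements_shear s : exists W W' : op R, implements W W' (fun p => (p.1, p.2 + s * p.1)).
Proof.
have [F [F' iF]] := implements_fourier; have [U [U' iU]] := implements_chirp (- s).
have iF' : implements F' F (fun p => (p.2, - p.1)).
  by apply: (implements_sym iF) => -[a b] /=; rewrite opprK.
have H := implements_comp (implements_comp iF' iU) iF.
do 2 eexists; apply: (implements_eq H) => -[a b] /=.
by congr pair; ring.
Qed.

(* [g = U_x L_c U_y] with [x = (a - 1) / c], [y = (d - 1) / c] and [U], [L] the unipotent shears. *)
Lemma implements_mx2_neq0 a b c d : c != 0 -> a * d - b * c = 1 ->
  exists W W' : op R, implements W W' (mx2 a b c d).
Proof.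
move=> c0 det; have [U [U' iU]] := implements_chirp ((d - 1) / c).
have [L [L' iL]] := implements_shear c; have [Q [Q' iQ]] := implements_chirp ((a - 1) / c).
have H := implements_comp (implements_comp iU iL) iQ.
do 2 eexists; apply: (implements_eq H) => -[u v] /=; rewrite /mx2 /=.
have -> : b = (a * d - 1) / c by rewrite -det; field.
by congr pair; field.
Qed.

Lemma implements_SL2 a b c d : a * d - b * c = 1 ->
  exists W W' : op R, implements W W' (mx2 a b c d).
Proof.
move=> det; have [c0|c0] := eqVneq c 0; last exact: implements_mx2_neq0.
have d0 : d != 0.
  by apply: contra_eq_neq det => ->; rewrite c0 !mulr0 subrr eq_sym oner_neq0.
have [F [F' iF]] := implements_fourier.
have iF' : implements F' F (fun p => (p.2, - p.1)).
  by apply: (implements_sym iF) => -[u v] /=; rewrite opprK.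
(* When [c = 0], composition with a quarter turn moves [d], which is nonzero, into the lower left
   corner. *)
have [W [W' iW]] : exists W W' : op R, implements W W' (mx2 b (- a) d (- c)).
  by apply: implements_mx2_neq0 => //; rewrite -det; ring.
have H := implements_comp iF' iW.
do 2 eexists; apply: (implements_eq H) => -[u v] /=.
by rewrite /mx2 /=; congr pair; ring.
Qed.

End Metaplectic.

(** * From the cone to the quadrant *)

Section ConeTransfer.
Variable R : realType.
Local Notation C := R[i].

Lemma wstar_mem_op_eq (V : set (op R)) W W' p q (z : C) : op_subspace V -> wstar_closed V ->
  unitary W W' -> V (MD q) -> op_eq (W \o MD p \o W') (op_scale z (MD q)) -> V (W \o MD p \o W').
Proof.
move=> sV cV u Vq h; have [_ [_ [_ VZ]]] := sV.
apply: (wstar_op_eq sV cV _ (VZ z _ Vq)); first exact: conj_bounded (bounded_MD p).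
by move=> f Lf; apply: ae_sym; exact: h.
Qed.

(** Both algebras are intersections, so each inclusion pulls back an arbitrary competitor for the
    other side. A WOT-closed algebra pulls back to a weak-star closed space containing the
    generators of [A_S]; a competitor for [A_S] pulls back to a space to which [A_p_sub] applies.
    The second inclusion holds up to [op_eq] because [W \o W'] is the identity only modulo null
    sets. *)
Lemma cone_transfer (S : set (R * R)) (W W' : op R) (g h : R * R -> R * R) : implements W W' g ->
  (forall p, g (h p) = p) -> (forall p, S p -> 0 <= (g p).1 /\ 0 <= (g p).2) ->
  (forall p, 0 <= p.1 -> 0 <= p.2 -> S (h p)) ->
  (forall T, A_S S T -> @A_p R (W \o T \o W')) /\
  (forall T, @A_p R T -> exists2 T', A_S S T' & op_eq T (W \o T' \o W')).
Proof.
move=> iW gh gS hS; have iW' := implements_sym iW gh; have [u hW] := iW; have [u' hW'] := iW'.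
have bW := unitary_bounded u; have bW' := unitary_bounded' u.
split=> [T AT V [[sV VM] [cV [VMl VDm]]]|T AT].
  have cV' := wot_wstar_closed cV.
  have [sU cU] := wstar_conj u sV cV'.
  have : [set X | bounded_op X /\ V (W \o X \o W')] T; last by case.
  apply: AT; split => //; split => // p Sp; split; first exact: bounded_MD p.
  have [z _ hz] := hW p; have [g1 g2] := gS p Sp.
  apply: (wstar_mem_op_eq sV cV' u _ hz).
  by apply: VM; [exact: VMl|exact: VDm].
have key (V : set (op R)) : op_subspace V -> wstar_closed V ->
    (forall p, S p -> V (MD p)) -> bounded_op T /\ V (W' \o T \o W).
  move=> sV cV VS; have [sU cU] := wstar_conj u' sV cV.
  apply: (A_p_sub sU cU) AT => l m l0 m0; split; first exact: bounded_MD (l, m).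
  have [z _ hz] := hW' (l, m).
  by apply: (wstar_mem_op_eq (p := (l, m)) sV cV u' _ hz); apply: VS; exact: hS.
exists (W' \o T \o W).
  by move=> V [sV [cV VS]]; case: (key V sV cV VS).
(* Boundedness comes from applying [key] to one particular competitor, the space of all bounded
   operators. *)
have bT : bounded_op T.
  have sB : op_subspace (@bounded_op R).
    split => //; split; first exact: bounded_zero.
    by split; [exact: bounded_add|exact: bounded_scale].
  apply: (key (@bounded_op R) sB _ _).1; first by move=> X [].
  by move=> p _; exact: bounded_MD.
move=> f Lf; have L1 := op_L2 bW (op_L2 bW' Lf); have LT := op_L2 bT Lf; have LT1 := op_L2 bT L1.
apply: ae_sym; apply: ae_trans (unitaryK' u LT1) _.
exact: (op_ae bT L1 Lf (unitaryK' u Lf)).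
Qed.

End ConeTransfer.

Lemma cone_sym (R : realType) (r1 r2 : R * R) : cone r1 r2 = cone r2 r1.
Proof.
have sub (s1 s2 : R * R) : cone s1 s2 `<=` cone s2 s1.
  by move=> p [a [b [a0 [b0 ->]]]]; exists b, a; split => //; split => //; rewrite addrC [X in (_, X)]addrC.
by apply/seteqP; split; exact: sub.
Qed.

Theorem theorem2p3 (R : realType) (r1 r2 : R * R)
  (hind : r1.1 * r2.2 - r1.2 * r2.1 != 0) :
  exists W W' : op R, unitary W W' /\
    (forall T, A_S (cone r1 r2) T -> @A_p R (W \o T \o W')) /\
    (forall S, @A_p R S -> exists2 T, A_S (cone r1 r2) T & op_eq S (W \o T \o W')).
Proof.
(* Elements of SL(2,R) preserve orientation, so the two edges are listed in positive order first;
   exchanging them leaves the cone unchanged. *)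
wlog D0 : r1 r2 hind / 0 < r1.1 * r2.2 - r1.2 * r2.1.
  move=> hw; have [D|D|D] := ltgtP 0 (r1.1 * r2.2 - r1.2 * r2.1).
  - exact: hw.
  - have D' : 0 < r2.1 * r1.2 - r2.2 * r1.1 by lra.
    by rewrite cone_sym; apply: hw => //; rewrite gt_eqF.
  - by rewrite -D eqxx in hind.
set D := _ - _ in hind D0.
(* The matrix sends [r1] to [(D, 0)] and [r2] to [(0, 1)]. Its inverse has the columns [r1 / D] and
   [r2]: the positive rescaling of [r1] makes the determinant 1 and leaves the cone unchanged. *)
have det : r2.2 * (r1.1 / D) - - r2.1 * (- r1.2 / D) = 1.
  by rewrite mulrA (mulrA (- r2.1)) -mulrBl mulrNN (mulrC r2.2) (mulrC r2.1) divff.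
have [W [W' iW]] := implements_SL2 det.
exists W, W'; split; first by case: iW.
apply: (cone_transfer (h := mx2 (r1.1 / D) r2.1 (r1.2 / D) r2.2) iW).
- by move=> [a b]; rewrite /mx2 /=; congr pair; rewrite /D; field.
- move=> p [a [b [a0 [b0 ->]]]]; rewrite /mx2 /=.
  have -> : r2.2 * (a * r1.1 + b * r2.1) + - r2.1 * (a * r1.2 + b * r2.2) = a * D by rewrite /D; ring.
  have -> : - r1.2 / D * (a * r1.1 + b * r2.1) + r1.1 / D * (a * r1.2 + b * r2.2) = b.
    by rewrite /D; field.
  by split => //; rewrite mulr_ge0// ltW.
- move=> [a b] /= a0 b0; exists (a / D), b; split; first by rewrite divr_ge0// ltW.
  by split => //; rewrite /mx2 /=; congr pair; ring.
Qed.
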